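(* Let $M$ be a closed surface immersed in the unit sphere with parallel mean curvature vector. Then, for any $N$, there exists no isometric immersion $\Phi:M\to\mathbb{S}^N$ with parallel mean curvature vector such that $$\frac53+\frac{11}3H^2\le S\le\frac95+\frac{19}5H^2,\qquad S\not\equiv\frac53+\frac{11}3H^2,$$ and $$S_{\max}<S_{\min}+\frac{120(S_{\min}-2H^2)(3S_{\min}-4-10H^2)(9-5S_{\min}+19H^2)}{2225(S_{\min}-2H^2)^2-420(1+H^2)(S_{\min}-2H^2)-1701(1+H^2)^2},$$ where $S$, $H$, $S_{\max}$, $S_{\min}$ are the quantities associated with $\Phi$.
   Context: $\mathbb{S}^N$ is the unit sphere in $\mathbb{R}^{N+1}$. A closed surface is a compact connected smooth $2$-manifold without boundary. For an isometric immersion of $M$ into $\mathbb{S}^N$ with induced metric $g$: $h$ is the second fundamental form, $S=|h|^2$, $S_{\max}=\sup_MS$, $S_{\min}=\inf_MS$, $\mathbf{H}=\frac12\operatorname{tr}_g h$ is the mean curvature vector field, $H=|\mathbf{H}|$. ''Parallel mean curvature vector'' means $\nabla^\perp\mathbf{H}=0$ for the normal connection; then $H$ is constant. *)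

(* Defs.v *)
From mathcomp Require Import all_boot all_order all_algebra.
From mathcomp Require Import all_classical all_reals all_analysis.

Set Implicit Arguments.
Unset Strict Implicit.
Unset Printing Implicit Defensive.

Import Order.TTheory GRing.Theory Num.Theory.
Import numFieldNormedType.Exports.

Local Open Scope classical_set_scope.
Local Open Scope ring_scope.

(* The library norm on 'rV[R]_n is the sup norm; [dot] and [enorm] are the
   Euclidean inner product and norm. *)
Definition dot (R : realType) (n : nat) (u v : 'rV[R]_n) : R :=
  (u *m v^T) 0 0.

Definition enorm (R : realType) (n : nat) (u : 'rV[R]_n) : R :=
  Num.sqrt (dot u u).

Definition partial (R : realType) (V : normedModType R) (i : 'I_2)
    (f : 'rV[R]_2 -> V) : 'rV[R]_2 -> V :=
  fun x => 'D_(delta_mx 0 i) f x.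

(* For open U: f is of class C^k on U.  The values of [partial i f] outside U
   are irrelevant because derivatives and continuity are local. *)
Fixpoint Ck_on (R : realType) (V : normedModType R) (U : set 'rV[R]_2)
    (k : nat) (f : 'rV[R]_2 -> V) : Prop :=
  (forall x, U x -> {for x, continuous f}) /\
  if k is k'.+1 then
    forall i : 'I_2, (forall x, U x -> derivable f x (delta_mx 0 i)) /\
      Ck_on U k' (partial i f)
  else True.

Definition smooth_on (R : realType) (V : normedModType R)
    (U : set 'rV[R]_2) (f : 'rV[R]_2 -> V) : Prop :=
  forall k, Ck_on U k f.

Record chart (R : realType) (M : topologicalType) := Chart {
  chart_dom : set M;
  chart_cod : set 'rV[R]_2;
  coord : M -> 'rV[R]_2;
  param : 'rV[R]_2 -> M;
  chart_dom_open : open chart_dom;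
  chart_cod_open : open chart_cod;
  coord_cod : forall p, chart_dom p -> chart_cod (coord p);
  param_dom : forall x, chart_cod x -> chart_dom (param x);
  coordK : forall p, chart_dom p -> param (coord p) = p;
  paramK : forall x, chart_cod x -> coord (param x) = x;
  coord_continuous : forall p, chart_dom p -> {for p, continuous coord};
  param_continuous : forall x, chart_cod x -> {for x, continuous param} }.

Definition overlap (R : realType) (M : topologicalType) (c d : chart R M) :
    set 'rV[R]_2 :=
  chart_cod c `&` param c @^-1` chart_dom d.

Definition transition (R : realType) (M : topologicalType) (c d : chart R M) :
    'rV[R]_2 -> 'rV[R]_2 :=
  coord d \o param c.

Record smooth_atlas (R : realType) (M : topologicalType) := SmoothAtlas {
  atlas_index : Type;
  atlas_chart : atlas_index -> chart R M;
  index_at : M -> atlas_index;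
  index_atP : forall p, chart_dom (atlas_chart (index_at p)) p;
  transition_smooth : forall a b,
    smooth_on (overlap (atlas_chart a) (atlas_chart b))
      (transition (atlas_chart a) (atlas_chart b)) }.

(* Together with a [smooth_atlas R M], this makes M a closed surface. *)
Definition closed_surface (M : topologicalType) : Prop :=
  [/\ [set: M] !=set0, hausdorff_space M, @second_countable M,
      compact [set: M] & connected [set: M]].

(* The rows are the partial derivatives of X. *)
Definition tangent_frame (R : realType) (n : nat) (X : 'rV[R]_2 -> 'rV[R]_n)
    (x : 'rV[R]_2) : 'M[R]_(2, n) :=
  \matrix_(i < 2) partial i X x.

(* [metric a x] is the Gram matrix, at the point of coordinates x in the chart
   a, of the two coordinate vector fields. *)
Record riemannian_metric (R : realType) (M : topologicalType)
    (A : smooth_atlas R M) := RiemannianMetric {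
  metric : atlas_index A -> 'rV[R]_2 -> 'M[R]_2;
  metric_smooth : forall a,
    smooth_on (chart_cod (atlas_chart a)) (metric a);
  metric_sym : forall a x, chart_cod (atlas_chart a) x ->
    (metric a x)^T = metric a x;
  metric_pos : forall a x (v : 'rV[R]_2), chart_cod (atlas_chart a) x ->
    v != 0 -> 0 < dot (v *m metric a x) v;
  metric_change : forall a b x,
    overlap (atlas_chart a) (atlas_chart b) x ->
    let t := transition (atlas_chart a) (atlas_chart b) in
    metric a x =
      tangent_frame t x *m metric b (t x) *m (tangent_frame t x)^T }.

(* Local extrinsic geometry of a parametrized immersed surface
   X : U -> S^N, with S^N seen inside R^(N+1). *)

Definition first_form (R : realType) (N : nat) (X : 'rV[R]_2 -> 'rV[R]_N.+1)
    (x : 'rV[R]_2) : 'M[R]_2 :=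
  tangent_frame X x *m (tangent_frame X x)^T.

(* Orthogonal projection of R^(N+1) onto the normal space, in T_(X x) S^N, of
   the surface, i.e. onto the orthogonal complement of the span of the
   (independent) vectors X x, d_0 X x and d_1 X x. *)
Definition normal_part (R : realType) (N : nat) (X : 'rV[R]_2 -> 'rV[R]_N.+1)
    (x : 'rV[R]_2) (u : 'rV[R]_N.+1) : 'rV[R]_N.+1 :=
  let F := col_mx (X x) (tangent_frame X x) in
  u - u *m F^T *m invmx (F *m F^T) *m F.

(* The Levi-Civita connection of S^N is the projection to T S^N of the flat
   one, so h(d_i, d_j) is the normal part of d_i d_j X. *)
Definition second_form (R : realType) (N : nat) (X : 'rV[R]_2 -> 'rV[R]_N.+1)
    (i j : 'I_2) (x : 'rV[R]_2) : 'rV[R]_N.+1 :=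
  normal_part X x (partial i (partial j X) x).

Definition sqnorm_second_form (R : realType) (N : nat)
    (X : 'rV[R]_2 -> 'rV[R]_N.+1) (x : 'rV[R]_2) : R :=
  let ginv := invmx (first_form X x) in
  \sum_(i < 2) \sum_(j < 2) \sum_(k < 2) \sum_(l < 2)
    ginv i k * ginv j l * dot (second_form X i j x) (second_form X k l x).

Definition mean_curvature_vector (R : realType) (N : nat)
    (X : 'rV[R]_2 -> 'rV[R]_N.+1) (x : 'rV[R]_2) : 'rV[R]_N.+1 :=
  let ginv := invmx (first_form X x) in
  2^-1 *: \sum_(i < 2) \sum_(j < 2) ginv i j *: second_form X i j x.

(* The normal connection applied to a normal field along X, in the direction
   d_i. *)
Definition normal_derivative (R : realType) (N : nat)
    (X : 'rV[R]_2 -> 'rV[R]_N.+1) (i : 'I_2) (xi : 'rV[R]_2 -> 'rV[R]_N.+1)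
    (x : 'rV[R]_2) : 'rV[R]_N.+1 :=
  normal_part X x (partial i xi x).

(* A map M -> S^N is a map to 'rV[R]_N.+1 with values of Euclidean norm 1. *)

Definition local_rep (R : realType) (M : topologicalType)
    (A : smooth_atlas R M) (N : nat) (Phi : M -> 'rV[R]_N.+1)
    (a : atlas_index A) : 'rV[R]_2 -> 'rV[R]_N.+1 :=
  Phi \o param (atlas_chart a).

Definition isometric_immersion (R : realType) (M : topologicalType)
    (A : smooth_atlas R M) (g : riemannian_metric A) (N : nat)
    (Phi : M -> 'rV[R]_N.+1) : Prop :=
  (forall p, enorm (Phi p) = 1) /\
  forall a : atlas_index A,
    smooth_on (chart_cod (atlas_chart a)) (local_rep Phi a) /\
    forall x, chart_cod (atlas_chart a) x ->
      row_free (tangent_frame (local_rep Phi a) x) /\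
      first_form (local_rep Phi a) x = metric g a x.

Definition parallel_mean_curvature (R : realType) (M : topologicalType)
    (A : smooth_atlas R M) (N : nat) (Phi : M -> 'rV[R]_N.+1) : Prop :=
  forall (a : atlas_index A) (x : 'rV[R]_2) (i : 'I_2),
    chart_cod (atlas_chart a) x ->
    normal_derivative (local_rep Phi a) i
      (mean_curvature_vector (local_rep Phi a)) x = 0.

(* S and H at p do not depend on the chart; they are computed in the chart
   selected by [index_at]. *)
Definition curv_S (R : realType) (M : topologicalType) (A : smooth_atlas R M)
    (N : nat) (Phi : M -> 'rV[R]_N.+1) (p : M) : R :=
  let a := index_at A p in
  sqnorm_second_form (local_rep Phi a) (coord (atlas_chart a) p).

Definition curv_H (R : realType) (M : topologicalType) (A : smooth_atlas R M)
    (N : nat) (Phi : M -> 'rV[R]_N.+1) (p : M) : R :=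
  let a := index_at A p in
  enorm (mean_curvature_vector (local_rep Phi a) (coord (atlas_chart a) p)).

Definition S_max (R : realType) (M : topologicalType) (A : smooth_atlas R M)
    (N : nat) (Phi : M -> 'rV[R]_N.+1) : R := sup (range (curv_S A Phi)).

Definition S_min (R : realType) (M : topologicalType) (A : smooth_atlas R M)
    (N : nat) (Phi : M -> 'rV[R]_N.+1) : R := inf (range (curv_S A Phi)).

(* Main.v *)
(* We use complex frames E = e1 - i e2.  When the mean curvature vector H is
   parallel, q = <H, h(E, E)> satisfies Lap |q|^2 = 4 K |q|^2 + |D q|^2, and the
   pinching forces K > 0, so q = 0 by the maximum principle.  Hence the map
   (Phi - H) / sqrt (1 + H^2) is a minimal immersion into a unit sphere, for the
   metric scaled by 1 + H^2.  Put rho = (S - 2 H^2) / (1 + H^2).  The normalized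
   higher covariant derivatives of the second fundamental form yield functions
   r, Q >= 0 with
     Lap (log rho) = r - 3 rho + 4,   Lap r = Q + 2 r (1 - r),
   and Lap Q = V + 4 r (1 - r)^2 - 5 |grad r|^2 + (8 - 5 r - rho) Q, where
   |grad Q - 2 (1 - r) grad r|^2 <= V Q.  The maximum principle for rho^8 r
   bounds r.  With x = min rho and u = 1 - x / rho, a suitable polynomial in
   Q, r and u has nonnegative Laplacian under the pinching and gap hypotheses,
   so it is constant by Hopf's strong maximum principle.  Equality in the
   pointwise estimates then forces rho = 5 / 3, that is S = 5 / 3 + 11 / 3 H^2. *)

(* A global frame need not exist, while the maximum principle needs functions that are smooth on all
   of [M]. Gradients and Laplacians are therefore built from the tangential parts of the ambient
   coordinate vectors, for which the Laplacian is a plain sum of squares of vector fields. Frames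
   occur only inside a chart; there the identities become computations in a commutative ring with a
   conjugation and one derivation [E], the connection being a single function [kap]. The values 5/3
   and 9/5 of rho are those of Calabi's minimal spheres of curvature 1/6 and 1/10, on which rho, r
   and Q are constant. Any lower bound for the Laplacian of a polynomial in Q, r and u must
   degenerate at both, which leaves little freedom. The parameter is e = 9 - 5 min rho, running from
   0 at 9/5 to 2/3 at 5/3. For e = 0 the gap hypothesis reads S_max < S_min, so that end is excluded
   at once; the other end is the equality case. The gap hypothesis is otherwise used only through u
   <= e (7 - e) / 198, which agrees with it to first order at e = 0. *)
From HB Require Import structures.
Require Import Defs.
From mathcomp Require Import all_boot all_order all_algebra.
From mathcomp Require Import all_classical all_reals all_analysis.
From mathcomp Require Import complex ring lra.

Set Implicit Arguments.
Unset Strict Implicit.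
Unset Printing Implicit Defensive.

Import Order.TTheory GRing.Theory Num.Theory.
Import numFieldNormedType.Exports.

Local Open Scope classical_set_scope.
Local Open Scope ring_scope.

(** * Smooth functions on plane domains *)

Section SmoothCalculus.
Context {R : realType}.
Implicit Types (U : set 'rV[R]_2) (f g : 'rV[R]_2 -> R) (x v : 'rV[R]_2).

Lemma eq_on_near (T : Type) U (f g : 'rV[R]_2 -> T) x : open U ->
  (forall y, U y -> f y = g y) -> U x -> \forall y \near x, f y = g y.
Proof.
move=> oU fg Ux; have := open_nbhs_nbhs (conj oU Ux).
by apply: filterS => y /fg.
Qed.

Lemma partial_ext (V : normedModType R) U i (f g : 'rV[R]_2 -> V) x : open U ->
  (forall y, U y -> f y = g y) -> U x -> partial i f x = partial i g x.
Proof. by move=> oU fg Ux; apply/near_eq_derive/(eq_on_near oU fg Ux). Qed.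

Lemma Ck_ext (V : normedModType R) U k (f g : 'rV[R]_2 -> V) : open U ->
  (forall y, U y -> f y = g y) -> Ck_on U k f -> Ck_on U k g.
Proof.
elim: k f g => [|k IH] f g oU fg /= [cf df]; split.
- move=> x Ux; have e := eq_on_near oU fg Ux.
  rewrite /prop_for /continuous_at -(fg x Ux).
  have FF : Filter (nbhs x) by exact: nbhs_filter.
  by apply: cvg_trans (cf x Ux); apply: (@near_eq_cvg _ _ _ FF).
- by [].
- move=> x Ux; have e := eq_on_near oU fg Ux.
  rewrite /prop_for /continuous_at -(fg x Ux).
  have FF : Filter (nbhs x) by exact: nbhs_filter.
  by apply: cvg_trans (cf x Ux); apply: (@near_eq_cvg _ _ _ FF).
- move=> i; have [dfi ci] := df i; split.
    by move=> x Ux; apply: near_eq_derivable (dfi x Ux); exact: eq_on_near Ux.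
  by apply: IH ci => // y Uy; exact: partial_ext Uy.
Qed.

Lemma Ck_pred (V : normedModType R) U k (f : 'rV[R]_2 -> V) :
  Ck_on U k.+1 f -> Ck_on U k f.
Proof.
elim: k f => [|k IH] f /= [cf df]; split=> // i.
by have [di [ci Di]] := df i; split=> //; apply: IH.
Qed.

Lemma smooth_ext (V : normedModType R) U (f g : 'rV[R]_2 -> V) : open U ->
  (forall y, U y -> f y = g y) -> smooth_on U f -> smooth_on U g.
Proof. by move=> oU fg sf k; apply: Ck_ext (sf k). Qed.

Lemma smooth_partial (V : normedModType R) U i (f : 'rV[R]_2 -> V) :
  smooth_on U f -> smooth_on U (partial i f).
Proof. by move=> sf k; have [_ /(_ i)[]] := sf k.+1. Qed.

Lemma smooth_continuous (V : normedModType R) U (f : 'rV[R]_2 -> V) x :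
  smooth_on U f -> U x -> {for x, continuous f}.
Proof. by move=> sf; have [+ _] := sf 0; apply. Qed.

Lemma smooth_derivable (V : normedModType R) U i (f : 'rV[R]_2 -> V) x :
  smooth_on U f -> U x -> derivable f x (delta_mx 0 i).
Proof. by move=> sf; have [_ /(_ i)[+ _]] := sf 1; apply. Qed.

Lemma Ck_cst (V : normedModType R) U k (c : V) : open U -> Ck_on U k (fun=> c).
Proof.
move=> oU; elim: k c => [|k IH] c /=; split => //.
- by move=> x _; exact: cst_continuous.
- by move=> x _; exact: cst_continuous.
- move=> i; split=> [x _|]; first exact: derivable_cst.
  apply: Ck_ext (IH 0) => // y _.
  by rewrite /partial derive_cst.
Qed.

Lemma CkD U k f g : open U ->
  Ck_on U k f -> Ck_on U k g -> Ck_on U k (fun x => f x + g x).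
Proof.
move=> oU; elim: k f g => [|k IH] f g /= [cf df] [cg dg]; split=> //.
- by move=> x Ux; apply: continuousD; [apply: cf|apply: cg].
- by move=> x Ux; apply: continuousD; [apply: cf|apply: cg].
- move=> i; have [dfi Df] := df i; have [dgi Dg] := dg i; split.
    by move=> x Ux; apply: derivableD; [apply: dfi|apply: dgi].
  apply: Ck_ext (IH _ _ Df Dg) => // y Uy.
  by rewrite /partial deriveD; [|apply: dfi|apply: dgi].
Qed.

Lemma CkM U k f g : open U ->
  Ck_on U k f -> Ck_on U k g -> Ck_on U k (fun x => f x * g x).
Proof.
move=> oU; elim: k f g => [|k IH] f g.
  by move=> [cf _] [cg _]; split=> // x Ux; apply: continuousM; [apply: cf|apply: cg].
move=> Cf Cg; have Cf' := Ck_pred Cf; have Cg' := Ck_pred Cg.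
move: Cf Cg => /= [cf df] [cg dg]; split=> //.
  by move=> x Ux; apply: continuousM; [apply: cf|apply: cg].
move=> i; have [dfi Df] := df i; have [dgi Dg] := dg i; split.
  by move=> x Ux; apply: derivableM; [apply: dfi|apply: dgi].
apply: Ck_ext (CkD oU (IH _ _ Cf' Dg) (IH _ _ Cg' Df)) => // y Uy.
by rewrite /partial deriveM; [|apply: dfi|apply: dgi].
Qed.

Lemma partialD i f g x : derivable f x (delta_mx 0 i) ->
  derivable g x (delta_mx 0 i) ->
  partial i (fun x => f x + g x) x = partial i f x + partial i g x.
Proof. by move=> df dg; rewrite /partial deriveD. Qed.

Lemma partialM i f g x : derivable f x (delta_mx 0 i) ->
  derivable g x (delta_mx 0 i) ->
  partial i (fun x => f x * g x) x = f x * partial i g x + g x * partial i f x.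
Proof. by move=> df dg; rewrite /partial deriveM. Qed.

Lemma CkV U k f : open U -> (forall x, U x -> f x != 0) ->
  Ck_on U k f -> Ck_on U k (fun x => (f x)^-1).
Proof.
move=> oU f0; elim: k => [|k IH].
  by move=> [cf _]; split=> // x Ux; apply: continuousV; [apply: f0|apply: cf].
move=> Cf; have CV := IH (Ck_pred Cf); case: Cf => cf df; split.
  by move=> x Ux; apply: continuousV; [apply: f0|apply: cf].
move=> i; have [dfi Df] := df i; split.
  by move=> x Ux; apply: derivableV; [apply: f0|apply: dfi].
have N1 : Ck_on U k (fun=> -1 : R) by exact: Ck_cst.
apply: Ck_ext (CkM oU N1 (CkM oU Df (CkM oU CV CV))) => // y Uy.
rewrite /partial deriveV; [|exact: f0|exact: dfi].
by rewrite /GRing.scale /= expr2 invfM; ring.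
Qed.

Lemma derive_comp1 (h : R -> R) f x v : derivable f x v ->
  derivable h (f x) 1 ->
  derivable (h \o f) x v /\ 'D_v (h \o f) x = h^`()%classic (f x) * 'D_v f x.
Proof.
move=> df dh.
pose F (t : R) := f (t *: v + x).
have dF : derivable F 0 1 by exact: (derivable1P _ _ _).1 df.
have F0 : F 0 = f x by rewrite /F scale0r add0r.
have dh' : derivable h (F 0) 1 by rewrite F0.
have c := derive1_comp dF dh'.
have dhF0 : derivable (h \o F) 0 1.
  apply/derivable1_diffP/differentiable_comp; exact/derivable1_diffP.
have E (G : 'rV[R]_2 -> R) : 'D_v G x = (fun t : R => G (t *: v + x))^`()%classic 0.
  rewrite /derive /derive1; set g1 := fun h => h^-1 *: _; set g2 := fun h => h^-1 *: _.
  suff -> : g1 = g2 by [].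
  by rewrite funeqE /g1 /g2 => t /=; rewrite addr0 scale0r add0r.
split; first by exact: ((derivable1P (h \o f) x v).2 dhF0).
by rewrite !E -F0 -c.
Qed.

Lemma Ck_sqrt U k f : open U -> (forall x, U x -> 0 < f x) ->
  Ck_on U k f -> Ck_on U k (fun x => Num.sqrt (f x)).
Proof.
move=> oU f0.
have cs x : U x -> {for x, continuous f} -> {for x, continuous (fun x => Num.sqrt (f x))}.
  by move=> Ux cf; apply: (@continuous_comp _ _ _ f Num.sqrt) => //; exact: sqrt_continuous.
elim: k => [|k IH]; first by move=> [cf _]; split=> // x Ux; apply: cs => //; apply: cf.
move=> Cf; have CS := IH (Ck_pred Cf); case: Cf => cf df; split.
  by move=> x Ux; apply: cs => //; apply: cf.
have CV : Ck_on U k (fun x => (Num.sqrt (f x))^-1).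
  by apply: CkV CS => // x Ux; rewrite gt_eqF // sqrtr_gt0; apply: f0.
move=> i; have [dfi Df] := df i.
have D x : U x -> derivable (Num.sqrt \o f) x (delta_mx 0 i) /\
    'D_(delta_mx 0 i) (Num.sqrt \o f) x =
    (2 * Num.sqrt (f x))^-1 * 'D_(delta_mx 0 i) f x.
  move=> Ux; have sd := is_derive1_sqrt (f0 _ Ux).
  have [|d e] := derive_comp1 (dfi _ Ux) (_ : derivable Num.sqrt (f x) 1).
    by case: sd.
  by split=> //; rewrite e derive1E derive_val.
split; first by move=> x /D[].
have N1 : Ck_on U k (fun=> 2^-1 : R) by exact: Ck_cst.
apply: Ck_ext (CkM oU N1 (CkM oU CV Df)) => // y Uy.
by rewrite /partial; case: (D y Uy) => _ /= ->; rewrite invfM mulrA.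
Qed.

Lemma smooth_cst (V : normedModType R) U (c : V) : open U -> smooth_on U (fun=> c).
Proof. by move=> oU k; apply: Ck_cst. Qed.

Lemma smoothD U f g : open U -> smooth_on U f -> smooth_on U g ->
  smooth_on U (fun x => f x + g x).
Proof. by move=> oU sf sg k; apply: CkD. Qed.

Lemma smoothM U f g : open U -> smooth_on U f -> smooth_on U g ->
  smooth_on U (fun x => f x * g x).
Proof. by move=> oU sf sg k; apply: CkM. Qed.

Lemma smoothN U f : open U -> smooth_on U f -> smooth_on U (fun x => - f x).
Proof.
move=> oU sf; apply: (@smooth_ext _ _ (fun x => -1 * f x)) => //.
  by move=> y _; rewrite mulN1r.
by apply: smoothM => //; apply: smooth_cst.
Qed.

Lemma smoothV U f : open U -> (forall x, U x -> f x != 0) ->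
  smooth_on U f -> smooth_on U (fun x => (f x)^-1).
Proof. by move=> oU f0 sf k; apply: CkV. Qed.

Lemma smooth_sqrt U f : open U -> (forall x, U x -> 0 < f x) ->
  smooth_on U f -> smooth_on U (fun x => Num.sqrt (f x)).
Proof. by move=> oU f0 sf k; apply: Ck_sqrt. Qed.

Lemma smooth_sum (I : Type) (s : seq I) U (F : I -> 'rV[R]_2 -> R) : open U ->
  (forall i, smooth_on U (F i)) -> smooth_on U (fun x => \sum_(i <- s) F i x).
Proof.
move=> oU sF; elim: s => [|i s IH].
  apply: smooth_ext (smooth_cst (0 : R) oU) => // y _; by rewrite big_nil.
apply: smooth_ext (smoothD oU (sF i) IH) => // y _; by rewrite big_cons.
Qed.

Lemma partial_coord n i (F : 'rV[R]_2 -> 'rV[R]_n) x j :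
  derivable F x (delta_mx 0 i) ->
  partial i F x 0 j = partial i (fun y => F y 0 j) x.
Proof. by move=> dF; rewrite /partial derive_mx // mxE. Qed.

Lemma smooth_coord n U (F : 'rV[R]_2 -> 'rV[R]_n) j : open U ->
  smooth_on U F -> smooth_on U (fun y => F y 0 j).
Proof.
move=> oU sF k; elim: k F sF => [|k IH] F sF; split => //.
- by move=> x Ux; apply: (@continuous_comp _ _ _ F (fun M => M 0 j));
    [exact: (smooth_continuous sF)|exact: coord_continuous].
- by move=> x Ux; apply: (@continuous_comp _ _ _ F (fun M => M 0 j));
    [exact: (smooth_continuous sF)|exact: coord_continuous].
- move=> i; split.
    by move=> x Ux; apply: (derivable_mxP _ _ _).1; exact: (smooth_derivable sF).
  have := IH _ (smooth_partial i sF); apply: Ck_ext => // y Uy.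
  by rewrite partial_coord //; exact: (smooth_derivable sF).
Qed.

End SmoothCalculus.

(** * Mean value theorems, differentiability and symmetry of second derivatives *)

Section MeanValue.
Context {R : realType}.
Implicit Types (U : set 'rV[R]_2) (f g : 'rV[R]_2 -> R) (x v : 'rV[R]_2).

Lemma coord_norm_le n (v : 'rV[R]_n.+1) j : `|v 0 j| <= `|v|.
Proof.
rewrite [leRHS]/Num.Def.normr /= mx_normrE.
by apply: le_trans; last exact: (le_bigmax _ _ (0, j)).
Qed.

Lemma rV2_norm_le v (e : R) : `|v 0 0| <= e -> `|v 0 1| <= e -> `|v| <= e.
Proof.
move=> v0 v1; rewrite [leLHS]/Num.Def.normr /= mx_normrE.
apply: bigmax_le => [|[i j] _ /=]; first exact: le_trans (normr_ge0 _) v0.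
rewrite (ord1 i); case: j => -[|[|//]] hj.
  by rewrite (_ : Ordinal hj = 0) //; apply/val_inj.
by rewrite (_ : Ordinal hj = 1) //; apply/val_inj.
Qed.

Lemma rV2E v : v = v 0 0 *: delta_mx 0 0 + v 0 1 *: delta_mx 0 1.
Proof.
apply/rowP => j; rewrite !mxE /=; case: j => -[|[|//]] hj.
  rewrite (_ : Ordinal hj = 0); last exact/val_inj.
  by rewrite eqxx /= mulr1 mulr0 addr0.
rewrite (_ : Ordinal hj = 1); last exact/val_inj.
by rewrite eqxx /= mulr1 mulr0 add0r.
Qed.

Lemma nbhs_distP x (P : set 'rV[R]_2) :
  nbhs x P <-> exists2 e : R, 0 < e & forall y, `|y - x| <= e -> P y.
Proof.
split=> [/nbhs_ballP[e /= e0 He]|[e e0 He]].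
  exists (e / 2); first by rewrite divr_gt0.
  move=> y ye; apply: He; rewrite -ball_normE /= distrC; apply: le_lt_trans ye _.
  by rewrite ltr_pdivrMr // ltr_pMr // ltr1n.
by apply/nbhs_ballP; exists e => // y; rewrite -ball_normE /= distrC => /ltW; apply: He.
Qed.

Lemma derivable_line f a v (s : R) : derivable f (a + s *: v) v ->
  is_derive s 1 (fun t : R => f (a + t *: v)) ('D_v f (a + s *: v)).
Proof.
have E : (fun h : R => h^-1 *: (((fun t : R => f (a + t *: v)) \o shift s) h%:A - f (a + s *: v)))
       = (fun h : R => h^-1 *: ((f \o shift (a + s *: v)) (h *: v) - f (a + s *: v))).
  rewrite funeqE => h /=; congr (_ *: (f _ - _)).
  by rewrite [h%:A]mulr1 scalerDl addrCA.
move=> df; split; first by rewrite /derivable E.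
by rewrite /derive E.
Qed.

Lemma mvt_line f a v (h : R) :
  (forall s : R, `|s| <= `|h| -> derivable f (a + s *: v) v) ->
  exists2 s : R, `|s| <= `|h| & f (a + h *: v) - f a = h * 'D_v f (a + s *: v).
Proof.
move=> df; pose F (t : R) := f (a + t *: v).
have dF (s : R) : `|s| <= `|h| -> is_derive s 1 F ('D_v f (a + s *: v)).
  by move=> /df; exact: derivable_line.
have fa : f a = F 0 by rewrite /F scale0r addr0.
have cF (s : R) : `|s| <= `|h| -> {for s, continuous F}.
  by move=> /dF[dFs _]; apply/differentiable_continuous/derivable1_diffP.
have W (b c : R) : (forall s, b <= s <= c -> `|s| <= `|h|) ->
    {within `[b, c], continuous F}.
  move=> bc; apply/continuous_in_subspaceT => s; rewrite inE /= in_itv /= => /bc.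
  exact: cF.
have [h0|h0] := leP 0 h.
  have I (s : R) : 0 <= s <= h -> `|s| <= `|h| by move=> /andP[s0 sh]; rewrite !ger0_norm.
  have [|s sI e] := @MVT_segment R F (fun t => 'D_v f (a + t *: v)) 0 h h0 _ (W _ _ I).
    by move=> s; rewrite in_itv /= => /andP[/ltW hs /ltW s0]; apply/dF/I/andP.
  exists s; first by apply: I; move: sI; rewrite in_itv.
  by rewrite fa -/(F h) e subr0 mulrC.
have I (s : R) : h <= s <= 0 -> `|s| <= `|h|.
  by move=> /andP[sh s0]; rewrite !ler0_norm // ?lerN2 // ltW.
have [|s sI e] := @MVT_segment R F (fun t => 'D_v f (a + t *: v)) h 0 (ltW h0) _ (W _ _ I).
  by move=> s; rewrite in_itv /= => /andP[/ltW hs /ltW s0]; apply/dF/I/andP.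
exists s; first by apply: I; move: sI; rewrite in_itv.
rewrite fa -/(F h); move: e; rewrite sub0r mulrN => /eqP; rewrite -eqr_oppLR opprB => /eqP ->.
by rewrite mulrC.
Qed.

Lemma partialE (V : normedModType R) i (f : 'rV[R]_2 -> V) x : partial i f x = 'D_(delta_mx 0 i) f x.
Proof. by []. Qed.

Definition partials_on U f := forall x, U x ->
  forall i : 'I_2, derivable f x (delta_mx 0 i).

(** The increment is split along a path parallel to the axes, so that only partial derivatives
    enter, at two different intermediate points. *)
Lemma mean_value2 U f x (e : R) (h0 h1 : R) :
  (forall y, `|y - x| <= e -> U y) -> partials_on U f ->
  `|h0| <= e -> `|h1| <= e ->
  exists z0 z1, [/\ `|z0 - x| <= Num.max `|h0| `|h1|, `|z1 - x| <= Num.max `|h0| `|h1| &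
    f (x + h0 *: delta_mx 0 0 + h1 *: delta_mx 0 1) - f x =
      h0 * partial 0 f z0 + h1 * partial 1 f z1].
Proof.
move=> xU df h0e h1e.
have N (s t : R) : `|x + s *: delta_mx 0 0 + t *: delta_mx 0 1 - x| <= Num.max `|s| `|t|.
  apply: rV2_norm_le; rewrite !mxE /= !(mulr1, mulr0, addr0, add0r) addrAC subrr add0r.
    by rewrite le_max lexx.
  by rewrite le_max lexx orbT.
have N0 (s : R) : `|x + s *: delta_mx 0 0 - x| <= `|s|.
  have := N s 0; rewrite scale0r addr0 => /le_trans; apply.
  by rewrite normr0 ge_max lexx normr_ge0.
have [s0 s0h e0] : exists2 s : R, `|s| <= `|h0| &
    f (x + h0 *: delta_mx 0 0) - f x = h0 * 'D_(delta_mx 0 0) f (x + s *: delta_mx 0 0).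
  apply: mvt_line => s sh; apply/df/xU.
  by apply: le_trans (N0 s) _; apply: le_trans sh _.
have [s1 s1h e1] : exists2 s : R, `|s| <= `|h1| &
    f (x + h0 *: delta_mx 0 0 + h1 *: delta_mx 0 1) - f (x + h0 *: delta_mx 0 0)
     = h1 * 'D_(delta_mx 0 1) f (x + h0 *: delta_mx 0 0 + s *: delta_mx 0 1).
  apply: mvt_line => s sh; apply/df/xU.
  apply: le_trans (N _ _) _; rewrite ge_max h0e /=; exact: le_trans sh _.
exists (x + s0 *: delta_mx 0 0), (x + h0 *: delta_mx 0 0 + s1 *: delta_mx 0 1); split.
- by apply: le_trans (N0 _) _; rewrite le_max s0h.
- by apply: le_trans (N _ _) _; rewrite ge_max !le_max lexx s1h orbT.
- by rewrite /partial -e0 -e1; ring.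
Qed.

Definition C1_on U f := partials_on U f /\
  forall i x, U x -> {for x, continuous (partial i f)}.

Lemma smooth_C1 U f : smooth_on U f -> C1_on U f.
Proof.
move=> sf; split; first by move=> x Ux i; exact: (smooth_derivable sf).
by move=> i x Ux; apply: (smooth_continuous (smooth_partial i sf)).
Qed.

(** [Ck_on] speaks of partial derivatives only; their continuity turns the axis-parallel mean value
    formula into a Fréchet derivative, on which the chain rule and all other directional derivatives
    rest. *)
Lemma C1_differentiable U f x : open U -> C1_on U f -> U x ->
  differentiable f x /\
  (forall v, 'd f x v = v 0 0 * partial 0 f x + v 0 1 * partial 1 f x).
Proof.
move=> oU [df cf] Ux.
pose L (v : 'rV[R]_2) : R := v 0 0 * partial 0 f x + v 0 1 * partial 1 f x.
have Llin : linear L.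
  move=> k u v; rewrite /L !mxE /GRing.scale /=.
  by move: (partial 0 f x) (partial 1 f x) => a b; ring.
pose LM := GRing.isLinear.Build _ _ _ _ _ Llin.
pose LL : {linear _ -> _} := HB.pack L LM.
have Lc : continuous LL.
  move=> v; apply: (@continuousD _ _ _ (fun v : 'rV[R]_2 => v 0 0 * partial 0 f x)
     (fun v : 'rV[R]_2 => v 0 1 * partial 1 f x)).
    by apply: continuousM; [exact: coord_continuous|exact: cst_continuous].
  by apply: continuousM; [exact: coord_continuous|exact: cst_continuous].
have E : (f \o shift x : 'rV[R]_2 -> R) = cst (f x) + (LL : 'rV[R]_2 -> R) +o_ (0 : 'rV[R]_2) id.
  apply/eqaddoP => eps e0.
  have e4 : 0 < eps / 2 by rewrite divr_gt0.
  have C i : exists2 d : R, 0 < d &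
      forall y, `|y - x| <= d -> `|partial i f y - partial i f x| <= eps / 2.
    have /cvgrPdist_le/(_ _ e4)/nbhs_distP[d d0 H] := cf i x Ux.
    by exists d; [exact: d0|move=> y /H; rewrite distrC].
  have [d0 d0p H0] := C 0; have [d1 d1p H1] := C 1.
  have /nbhs_distP[d2 d2p H2] := open_nbhs_nbhs (conj oU Ux).
  apply/nbhs_distP; exists (Num.min d0 (Num.min d1 d2)).
    by rewrite !lt_min d0p d1p d2p.
  move=> v; rewrite subr0 !le_min => /and3P[v0 v1 v2] /=.
  have c0 := le_trans (coord_norm_le v 0) v2.
  have c1 := le_trans (coord_norm_le v 1) v2.
  have [z0 [z1 [n0 n1 e]]] := mean_value2 H2 df c0 c1.
  have M : Num.max `|v 0 0| `|v 0 1| <= `|v| by rewrite ge_max !coord_norm_le.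
  have -> : (f \o shift x - (cst (f x) + LL)) v =
    v 0 0 * (partial 0 f z0 - partial 0 f x) + v 0 1 * (partial 1 f z1 - partial 1 f x).
    rewrite -[LHS]/(f (v + x) - (f x + L v)) /L.
    have -> : f (v + x) = f x + (v 0 0 * partial 0 f z0 + v 0 1 * partial 1 f z1).
      by rewrite -e addrCA subrr addr0 -addrA -rV2E addrC.
    move: (partial 0 f z0) (partial 0 f x) (partial 1 f z1) (partial 1 f x) => a b c k.
    by ring.
  have b0 := H0 _ (le_trans n0 (le_trans M v0)).
  have b1 := H1 _ (le_trans n1 (le_trans M v1)).
  move: b0 b1; move: (partial 0 f z0 - _) (partial 1 f z1 - _) => a b b0 b1.
  apply: (le_trans (ler_normD _ _)); rewrite !normrM.
  have -> : eps * `|v| = `|v| * (eps / 2) + `|v| * (eps / 2) by field.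
  by apply: lerD; apply: ler_pM => //; exact: coord_norm_le.
have D := diff_unique Lc E.
split; last by move=> v; rewrite D.
by apply/diff_locallyP; rewrite D; split.
Qed.

Lemma derive_dir U f x v : open U -> C1_on U f -> U x ->
  derivable f x v /\ 'D_v f x = v 0 0 * partial 0 f x + v 0 1 * partial 1 f x.
Proof.
move=> oU Cf Ux; have [df E] := C1_differentiable oU Cf Ux.
by split; [exact: diff_derivable|rewrite deriveE].
Qed.

Lemma chain_rule U f (t : 'rV[R]_2 -> 'rV[R]_2) x i : open U -> C1_on U f ->
  U (t x) -> derivable t x (delta_mx 0 i) ->
  partial i (f \o t) x =
    partial i t x 0 0 * partial 0 f (t x) + partial i t x 0 1 * partial 1 f (t x).
Proof.
move=> oU Cf Utx dt; have [df E] := C1_differentiable oU Cf Utx.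
pose F (s : R) := t (s *: delta_mx 0 i + x).
have F0 : F 0 = t x by rewrite /F scale0r add0r.
have dF : derivable F 0 1 by exact: (derivable1P _ _ _).1 dt.
have H (W : normedModType R) (G : 'rV[R]_2 -> W) :
    'D_(delta_mx 0 i) G x = 'D_1 (fun s : R => G (s *: delta_mx 0 i + x)) 0.
  rewrite /derive; set g1 := fun h => h^-1 *: _; set g2 := fun h => h^-1 *: _.
  suff -> : g1 = g2 by [].
  by rewrite funeqE /g1 /g2 => s /=; rewrite addr0 scale0r add0r [_%:A]mulr1.
have dfF : differentiable F 0 by exact/derivable1_diffP.
have dfF0 : differentiable f (F 0) by rewrite F0.
have dfc : differentiable (f \o F) 0 by exact: differentiable_comp.
have e2 : 'D_1 F 0 = 'd F 0 1 by apply: deriveE.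
have e1 : 'D_1 (f \o F) 0 = 'd (f \o F) 0 1 by apply: deriveE.
have e3 : 'D_(delta_mx 0 i) (f \o t) x = 'D_1 (f \o F) 0 by exact: H.
rewrite /partial e3 (H _ t) -/F e1 e2.
by rewrite (diff_comp dfF dfF0) /= F0 E.
Qed.

(** Mean value arguments equate [P] and [Q] at different intermediate points; continuity carries the
    equality to their common limit. *)
Lemma eq_at_limit (P Q : 'rV[R]_2 -> R) x (d : R) : 0 < d ->
  {for x, continuous P} -> {for x, continuous Q} ->
  (forall h, 0 < h -> h <= d ->
     exists y z, [/\ `|y - x| <= h, `|z - x| <= h & P y = Q z]) -> P x = Q x.
Proof.
move=> dp cP cQ H; apply/eqP; rewrite -subr_eq0 -normr_le0.
apply/ler_addgt0Pl => eps e0; rewrite addr0.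
have e2 : 0 < eps / 2 by rewrite divr_gt0.
have /cvgrPdist_le/(_ _ e2)/nbhs_distP[d0 d0p H0] := cP.
have /cvgrPdist_le/(_ _ e2)/nbhs_distP[d1 d1p H1] := cQ.
pose h := Num.min d (Num.min d0 d1).
have hp : 0 < h by rewrite !lt_min dp d0p d1p.
have [hd hd0 hd1] : [/\ h <= d, h <= d0 & h <= d1].
  by rewrite !ge_min !lexx !orbT.
have [y [z [yh zh e]]] := H h hp hd.
have K1 := H0 _ (le_trans yh hd0); have K2 := H1 _ (le_trans zh hd1).
have -> : P x - Q x = (P x - P y) - (Q x - Q z) by rewrite e; ring.
by apply: (le_trans (ler_normB _ _)); rewrite (splitr eps) lerD.
Qed.

(** The mean value theorem is applied to the difference [g] in direction [i], and then to
    [partial i f] in direction [j]. The left side is symmetric in [i] and [j], whence Schwarz's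
    theorem. *)
Lemma second_difference U f x (h : R) i j : open U -> smooth_on U f ->
  i != j -> 0 < h -> (forall y, `|y - x| <= h -> U y) ->
  exists2 y, `|y - x| <= h &
    f (x + h *: delta_mx 0 i + h *: delta_mx 0 j) - f (x + h *: delta_mx 0 i)
      - (f (x + h *: delta_mx 0 j) - f x) = h * (h * partial j (partial i f) y).
Proof.
move=> oU sf ij hp xU.
have hh : `|h| = h by rewrite gtr0_norm.
have N (s t : R) : `|s| <= h -> `|t| <= h ->
    `|x + s *: delta_mx 0 i + t *: delta_mx 0 j - x| <= h.
  move=> sh th; rewrite addrAC (addrC x) addrK.
  have K (k : 'I_2) : `|(s *: delta_mx 0 i + t *: delta_mx 0 j : 'rV[R]_2) 0 k| <= h.
    rewrite !mxE /=; have [ki|ki] := eqVneq k i.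
      by rewrite ki (negbTE ij) mulr1 mulr0 addr0.
    by case: (k == j); rewrite ?(mulr1, mulr0, add0r) // normr0 ltW.
  exact: rV2_norm_le.
have N0 (s : R) : `|s| <= h -> `|x + s *: delta_mx 0 i - x| <= h.
  by move=> sh; have := N s 0 sh; rewrite normr0 scale0r addr0 => /(_ (ltW hp)).
pose g (y : 'rV[R]_2) := f (y + h *: delta_mx 0 j) - f y.
have dg (y : 'rV[R]_2) : `|y - x| <= h -> `|y + h *: delta_mx 0 j - x| <= h ->
    derivable g y (delta_mx 0 i) /\
    'D_(delta_mx 0 i) g y = partial i f (y + h *: delta_mx 0 j) - partial i f y.
  move=> y1 y2.
  have dd : derivable f (y + h *: delta_mx 0 j) (delta_mx 0 i).
    by apply: (smooth_derivable sf); exact: xU.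
  have dy : derivable f y (delta_mx 0 i).
    by apply: (smooth_derivable sf); exact: xU.
  pose fh y := f (y + h *: delta_mx 0 j).
  have E : (fun t : R => t^-1 *: ((fh \o shift y) (t *: delta_mx 0 i) - fh y)) =
     (fun t : R => t^-1 *: ((f \o shift (y + h *: delta_mx 0 j)) (t *: delta_mx 0 i) -
     f (y + h *: delta_mx 0 j))).
    by rewrite funeqE => t; rewrite /fh /= addrA.
  have dfh : derivable fh y (delta_mx 0 i) by rewrite /derivable E.
  split; first exact: derivableB dfh dy.
  rewrite (deriveB dfh dy); congr (_ - _).
  by rewrite /derive E.
have [|s sh e] := @mvt_line g x (delta_mx 0 i) h.
  move=> s; rewrite hh => sh; apply: (dg _ _ _).1; first exact: N0.
  by apply: N => //; rewrite hh.
rewrite hh in sh.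
have n2 : `|x + s *: delta_mx 0 i + h *: delta_mx 0 j - x| <= h.
  by apply: N => //; rewrite hh.
rewrite (dg _ (N0 _ sh) n2).2 in e.
have [|s' sh' e'] := @mvt_line (partial i f) (x + s *: delta_mx 0 i) (delta_mx 0 j) h.
  move=> s'; rewrite hh => sh'.
  by apply: (smooth_derivable (smooth_partial i sf)); apply/xU/N.
rewrite hh in sh'.
exists (x + s *: delta_mx 0 i + s' *: delta_mx 0 j); first exact: N.
by rewrite -[partial j _ _]/('D_(delta_mx 0 j) (partial i f) _) -e' -e.
Qed.

Lemma partialC U f x i j : open U -> smooth_on U f -> U x ->
  partial i (partial j f) x = partial j (partial i f) x.
Proof.
move=> oU sf Ux; have [->//|ij] := eqVneq i j.
have /nbhs_distP[d dp Hd] := open_nbhs_nbhs (conj oU Ux).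
apply: (eq_at_limit dp).
- exact: smooth_continuous (smooth_partial i (smooth_partial j sf)) Ux.
- exact: smooth_continuous (smooth_partial j (smooth_partial i sf)) Ux.
move=> h hp hd.
have hU y : `|y - x| <= h -> U y by move=> yh; exact: Hd (le_trans yh hd).
have ji : j != i by rewrite eq_sym.
have [y yh ey] := second_difference oU sf ji hp hU.
have [z zh ez] := second_difference oU sf ij hp hU.
exists y, z; split; [exact: yh|exact: zh|].
move: ey ez; move: (partial i _ y) (partial j _ z) => a b ey ez.
apply: (mulfI (lt0r_neq0 hp)); apply: (mulfI (lt0r_neq0 hp)).
rewrite -ey -ez (addrAC x); ring.
Qed.

End MeanValue.

(** * Maximum principles for sums of squares of vector fields *)

(* Otherwise unification unfolds partial derivatives into limits. *)
Opaque partial.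

Ltac gen_partial := repeat
  match goal with |- context [partial ?i ?f ?x] => generalize (partial i f x); intro end.

Section MaximumPrinciple.
Context {R : realType}.
Implicit Types (U : set 'rV[R]_2) (f g : 'rV[R]_2 -> R) (x v : 'rV[R]_2).

Lemma smooth_partialD U i f g x : smooth_on U f -> smooth_on U g -> U x ->
  partial i (fun y => f y + g y) x = partial i f x + partial i g x.
Proof.
by move=> sf sg Ux; apply: partialD;
  [exact: smooth_derivable sf Ux|exact: smooth_derivable sg Ux].
Qed.

Lemma smooth_partialM U i f g x : smooth_on U f -> smooth_on U g -> U x ->
  partial i (fun y => f y * g y) x = f x * partial i g x + g x * partial i f x.
Proof.
by move=> sf sg Ux; apply: partialM;
  [exact: smooth_derivable sf Ux|exact: smooth_derivable sg Ux].
Qed.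

Lemma partial_cst i (k : R) x : partial i (fun=> k) x = 0.
Proof. by rewrite partialE derive_cst. Qed.

Definition vderiv (c : 'I_2 -> 'rV[R]_2 -> R) f : 'rV[R]_2 -> R :=
  fun x => c 0 x * partial 0 f x + c 1 x * partial 1 f x.

Lemma vderiv_ext U c f g x : open U -> (forall y, U y -> f y = g y) -> U x ->
  vderiv c f x = vderiv c g x.
Proof. by move=> oU fg Ux; rewrite /vderiv !(partial_ext _ oU fg Ux). Qed.

Lemma smooth_vderiv U c f : open U -> (forall i, smooth_on U (c i)) ->
  smooth_on U f -> smooth_on U (vderiv c f).
Proof.
move=> oU sc sf.
by apply: smoothD => //; apply: smoothM => //; apply: smooth_partial.
Qed.

Lemma vderivD U c f g x : smooth_on U f -> smooth_on U g -> U x ->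
  vderiv c (fun y => f y + g y) x = vderiv c f x + vderiv c g x.
Proof.
by move=> sf sg Ux; rewrite /vderiv (smooth_partialD 0 sf sg Ux) (smooth_partialD 1 sf sg Ux); gen_partial; ring.
Qed.

Lemma vderivM U c f g x : smooth_on U f -> smooth_on U g -> U x ->
  vderiv c (fun y => f y * g y) x = f x * vderiv c g x + g x * vderiv c f x.
Proof.
by move=> sf sg Ux; rewrite /vderiv (smooth_partialM 0 sf sg Ux) (smooth_partialM 1 sf sg Ux); gen_partial; ring.
Qed.

Lemma partial_vderiv U c f k x : open U -> (forall i, smooth_on U (c i)) ->
  smooth_on U f -> U x ->
  partial k (vderiv c f) x =
    c 0 x * partial k (partial 0 f) x + partial 0 f x * partial k (c 0) x +
    (c 1 x * partial k (partial 1 f) x + partial 1 f x * partial k (c 1) x).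
Proof.
move=> oU sc sf Ux; have sp i := smooth_partial i sf.
rewrite /vderiv (smooth_partialD k (smoothM oU (sc 0) (sp 0)) (smoothM oU (sc 1) (sp 1)) Ux).
rewrite (smooth_partialM k (sc 0) (sp 0) Ux).
by rewrite (smooth_partialM k (sc 1) (sp 1) Ux); gen_partial.
Qed.

Lemma vderiv_cst c (k : R) x : vderiv c (fun=> k) x = 0.
Proof. by rewrite /vderiv !partial_cst !mulr0 addr0. Qed.

Lemma smooth_id U : open U -> smooth_on U (id : 'rV[R]_2 -> 'rV[R]_2).
Proof.
move=> oU; case=> [|k]; first by split; [move=> x _; exact: cvg_id|].
split=> [x _|i]; first exact: cvg_id.
split=> [x _|]; first exact: derivable_id.
apply: Ck_ext (Ck_cst _ (delta_mx 0 i : 'rV[R]_2) oU) => // y _.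
by rewrite partialE derive_id.
Qed.

Lemma line_in U x v : open U -> U x ->
  exists2 d : R, 0 < d & forall s : R, `|s| <= d -> U (x + s *: v).
Proof.
move=> oU Ux; have /nbhs_distP[e ep He] := open_nbhs_nbhs (conj oU Ux).
have k0 : 0 < `|v| + 1 by rewrite ltr_wpDl.
exists (e / (`|v| + 1)); first by rewrite divr_gt0.
move=> s sd; apply: He; rewrite addrAC subrr add0r normrZ.
apply: le_trans (ler_wpM2r (normr_ge0 v) sd) _.
by rewrite mulrAC ler_pdivrMr // ler_pM2l // lerDl.
Qed.

(** On the line through [x] a positive second derivative would make the first derivative positive
    just after 0, and by the mean value theorem [f] would exceed its maximum. *)
Lemma derive_dir_max U f x v : open U -> smooth_on U f -> U x ->
  (forall y, U y -> f y <= f x) ->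
  'D_v f x = 0 /\ 'D_v (fun y => 'D_v f y) x <= 0.
Proof.
move=> oU sf Ux fx; have [d dp dU] := line_in v oU Ux.
pose F (t : R) := f (x + t *: v).
pose G (t : R) := 'D_v f (x + t *: v).
have F0 : F 0 = f x by rewrite /F scale0r addr0.
have G0 : G 0 = 'D_v f x by rewrite /G scale0r addr0.
have dF (s : R) : `|s| <= d -> is_derive s 1 F (G s).
  move=> /dU Us; apply: derivable_line.
  by have [] := derive_dir v oU (smooth_C1 sf) Us.
have I (s : R) : (s \in `]-d, d[) = (`|s| < d) by rewrite in_itv /= ltr_norml.
have zI : (0 : R) \in `]-d, d[ by rewrite I normr0.
have Gz : 'D_v f x = 0.
  have M : is_derive (0:R) 1 F 0.
    apply: (@derive1_at_max _ F (- d) d 0) => //.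
    - by lra.
    - by move=> t; rewrite I => /ltW /dF[].
    - by move=> t; rewrite I => /ltW /dU Ut; rewrite F0; apply: fx.
  have D0 : is_derive (0:R) 1 F (G 0) by apply: dF; rewrite normr0 ltW.
  by rewrite -G0 -(@derive_val _ _ _ _ _ _ _ D0) (@derive_val _ _ _ _ _ _ _ M).
split=> //; rewrite leNgt; apply/negP => pos.
have sDf : smooth_on U (fun y => 'D_v f y).
  have sc (i : 'I_2) : smooth_on U (fun=> v 0 i) by exact: smooth_cst.
  apply: (smooth_ext oU _ (smooth_vderiv oU sc sf)) => y Uy.
  by have [_ ->] := derive_dir v oU (smooth_C1 sf) Uy.
have dG : is_derive (0:R) 1 G ('D_v (fun y => 'D_v f y) x).
  have Ux0 : U (x + (0 : R) *: v) by rewrite scale0r addr0.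
  rewrite -[X in 'D_v _ X](addr0 x) -[X in x + X](scale0r v).
  by apply: derivable_line; have [] := derive_dir v oU (smooth_C1 sDf) Ux0.
move: ('D_v _ x) pos dG => m pos dG.
have [cG vG] := dG.
have /cvgrPdist_lt/(_ m pos) : (fun h : R => h^-1 *: ((G \o shift 0) h%:A - G 0)) @ 0^' --> m.
  by rewrite -vG.
case=> e /= ep He.
have [h [hp hd he]] : exists h : R, [/\ 0 < h, h <= d & h < e].
  exists (Num.min d (e / 2)); rewrite lt_min dp divr_gt0 //= ge_min lexx.
  by split=> //; rewrite gt_min [X in _ || X]ltr_pdivrMr // ltr_pMr // ltr1n orbT.
have Gpos (s : R) : 0 < s -> s <= h -> 0 < G s.
  move=> s0 sh.
  have sn : s != 0 by rewrite gt_eqF.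
  have sb : ball_ [eta Num.Def.normr] 0 e s.
    by rewrite /= sub0r normrN gtr0_norm //; exact: le_lt_trans sh he.
  have := He s sb sn.
  rewrite addr0 [s%:A]mulr1 G0 Gz subr0 => H.
  have : 0 < s^-1 * G s by move: H; rewrite ltr_norml => /andP[_]; rewrite ltrBlDr ltrDl.
  by rewrite pmulr_rgt0 // invr_gt0.
have [||s sI e'] := @MVT R F G 0 h hp.
- move=> s; rewrite in_itv /= => /andP[s0 sh]; apply: dF.
  by rewrite gtr0_norm // (le_trans (ltW sh) hd).
- apply: derivable_within_continuous => s; rewrite in_itv /= => /andP[s0 sh].
  by have [] := dF s (_ : `|s| <= d); first by rewrite ger0_norm // (le_trans sh hd).
have := fx _ (dU h (_ : `|h| <= d)); rewrite gtr0_norm // => /(_ hd).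
rewrite -/(F h) -F0 -subr_le0 e' subr0 leNgt => /negP; apply.
move: sI; rewrite in_itv /= => /andP[s0 /ltW sh].
by rewrite mulr_gt0 // Gpos.
Qed.

(** At a critical point the derivatives of the coefficients drop out of the iterated derivative, so
    the field may be frozen to the constant vector [v] = c(x). *)
Lemma vderiv_max U c f x : open U -> (forall i, smooth_on U (c i)) ->
  smooth_on U f -> U x -> (forall y, U y -> f y <= f x) ->
  vderiv c f x = 0 /\ vderiv c (vderiv c f) x <= 0.
Proof.
move=> oU sc sf Ux fx.
have P (v : 'rV[R]_2) : v 0 0 * partial 0 f x + v 0 1 * partial 1 f x = 0.
  have [+ _] := derive_dir_max v oU sf Ux fx.
  by have [_ ->] := derive_dir v oU (smooth_C1 sf) Ux.
have Pi i : partial i f x = 0.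
  by rewrite partialE; have [] := derive_dir_max (delta_mx 0 i) oU sf Ux fx.
split; first by rewrite /vderiv !Pi !mulr0 addr0.
pose v : 'rV[R]_2 := c 0 x *: delta_mx 0 0 + c 1 x *: delta_mx 0 1.
have [v0 v1] : v 0 0 = c 0 x /\ v 0 1 = c 1 x.
  by rewrite !mxE /= !(mulr0, mulr1, addr0, add0r).
have [_] := derive_dir_max v oU sf Ux fx.
have sv (i : 'I_2) : smooth_on U (fun=> v 0 i) by exact: smooth_cst.
have sD := smooth_vderiv oU sv sf.
have E y : U y -> vderiv (fun i _ => v 0 i) f y = 'D_v f y.
  by move=> Uy; have [_ ->] := derive_dir v oU (smooth_C1 sf) Uy.
have -> : 'D_v (fun y => 'D_v f y) x = 'D_v (vderiv (fun i _ => v 0 i) f) x.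
  by apply: near_eq_derive; apply: eq_on_near oU _ Ux => y Uy; rewrite E.
have [_ ->] := derive_dir v oU (smooth_C1 sD) Ux.
have spf i := smooth_partial i sf.
have svi i : smooth_on U (fun=> v 0 i) by exact: smooth_cst.
rewrite v0 v1.
have -> : vderiv c (vderiv c f) x =
   c 0 x * partial 0 (vderiv (fun i _ => v 0 i) f) x +
   c 1 x * partial 1 (vderiv (fun i _ => v 0 i) f) x.
  rewrite {1}/vderiv (partial_vderiv 0 oU sc sf Ux) (partial_vderiv 1 oU sc sf Ux).
  rewrite (partial_vderiv 0 oU svi sf Ux) (partial_vderiv 1 oU svi sf Ux).
  rewrite v0 v1.
  move: (partial 0 (partial 0 f) x) (partial 0 (partial 1 f) x) => a00 a01.
  move: (partial 1 (partial 0 f) x) (partial 1 (partial 1 f) x) => a10 a11.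
  by rewrite (Pi 0) (Pi 1); gen_partial; ring.
by [].
Qed.

Lemma closed_box_compact x (r : R) : compact [set y : 'rV[R]_2 | `|y - x| <= r].
Proof.
apply: bounded_closed_compact.
  exists (`|x| + r); split; first exact: num_real.
  move=> M Mr y /= yr; apply/ltW; apply: le_lt_trans Mr.
  by rewrite -(subrK x y) addrC (le_trans (ler_normD _ _)) // lerD2l.
have -> : [set y : 'rV[R]_2 | `|y - x| <= r] = (fun y => `|y - x|) @^-1` [set t | t <= r] by [].
apply: closed_comp; last exact: closed_le.
move=> y _; apply: (@continuous_comp _ _ _ (fun y : 'rV[R]_2 => y - x) (fun z => `|z|)).
  by apply: continuousB; [exact: cvg_id|exact: cst_continuous].
exact: norm_continuous.
Qed.

End MaximumPrinciple.

(** * Hopf's strong maximum principle *)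

Section HopfLemma.
Context {R : realType}.
Implicit Types (U : set 'rV[R]_2) (f g : 'rV[R]_2 -> R) (x y z v : 'rV[R]_2).

(** Hopf's argument needs round balls with a smooth boundary, which the sup norm of the library does
    not provide. *)
Definition sqdist x y : R := (x 0 0 - y 0 0) ^+ 2 + (x 0 1 - y 0 1) ^+ 2.

Lemma smooth_coord_fun U (j : 'I_2) : open U -> smooth_on U (fun y : 'rV[R]_2 => y 0 j).
Proof. by move=> oU; apply: (smooth_coord j oU (smooth_id oU)). Qed.

Lemma partial_coord_fun i (j : 'I_2) x : partial i (fun y : 'rV[R]_2 => y 0 j) x = (i == j)%:R.
Proof.
rewrite -(@partial_coord _ _ _ (id : 'rV[R]_2 -> 'rV[R]_2) _ j); last exact: derivable_id.
by rewrite partialE derive_id mxE eqxx eq_sym.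
Qed.

Lemma smooth_sqdist U z : open U -> smooth_on U (fun y => sqdist y z).
Proof.
move=> oU; have S j := smooth_coord_fun j oU.
have T j : smooth_on U (fun y : 'rV[R]_2 => y 0 j - z 0 j).
  by apply: smoothD => //; apply: smooth_cst.
have P j := smoothM oU (T j) (T j).
by apply: smooth_ext (smoothD oU (P 0) (P 1)) => // y _; rewrite /sqdist !expr2.
Qed.

Lemma vderiv_sqdist U c z y : open U -> U y ->
  vderiv c (fun y => sqdist y z) y =
    2 * (c 0 y * (y 0 0 - z 0 0) + c 1 y * (y 0 1 - z 0 1)).
Proof.
move=> oU Uy; have S j := smooth_coord_fun j oU.
have K j : smooth_on U (fun=> - z 0 j) by exact: smooth_cst.
have T j := smoothD oU (S j) (K j).
have E i j : partial i (fun y : 'rV[R]_2 => y 0 j - z 0 j) y = (i == j)%:R.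
  by rewrite (smooth_partialD i (S j) (K j) Uy) partial_coord_fun partial_cst addr0.
have D i j : partial i (fun y : 'rV[R]_2 => (y 0 j - z 0 j) * (y 0 j - z 0 j)) y =
    2 * (i == j)%:R * (y 0 j - z 0 j).
  by rewrite (smooth_partialM i (T j) (T j) Uy) E; ring.
have F i : partial i (fun y => sqdist y z) y =
    2 * (i == 0)%:R * (y 0 0 - z 0 0) + 2 * (i == 1)%:R * (y 0 1 - z 0 1).
  rewrite -!D -(smooth_partialD i (smoothM oU (T 0) (T 0)) (smoothM oU (T 1) (T 1)) Uy).
  by apply: (@partial_ext _ _ U) => // w _; rewrite /sqdist !expr2.
rewrite /vderiv (F 0) (F 1) !eqxx (_ : (0 == 1 :> 'I_2) = false) // (_ : (1 == 0 :> 'I_2) = false) //=.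
by move: (c 0 y) (c 1 y) (y 0 0 - _) (y 0 1 - _) => a b p q; ring.
Qed.

Lemma continuous_sqdist z : continuous (fun y => sqdist y z).
Proof. by move=> y; apply: (smooth_continuous (smooth_sqdist z openT)). Qed.

Lemma sqdist_eq0 x y : sqdist x y <= 0 -> x = y.
Proof.
rewrite /sqdist => H.
have a0 := sqr_ge0 (x 0 0 - y 0 0); have b0 := sqr_ge0 (x 0 1 - y 0 1).
have /eqP e0 : (x 0 0 - y 0 0) ^+ 2 == 0 by rewrite eq_le a0 andbT; lra.
have /eqP e1 : (x 0 1 - y 0 1) ^+ 2 == 0 by rewrite eq_le b0 andbT; lra.
move/eqP: e0; rewrite sqrf_eq0 subr_eq0 => /eqP e0.
move/eqP: e1; rewrite sqrf_eq0 subr_eq0 => /eqP e1.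
by rewrite (rV2E x) (rV2E y) e0 e1.
Qed.

Lemma sqdist_le_norm x y (e : R) : `|x - y| <= e -> sqdist x y <= 2 * e ^+ 2.
Proof.
move=> xy; rewrite /sqdist.
have c j : (x 0 j - y 0 j) ^+ 2 <= e ^+ 2.
  have h : `|x 0 j - y 0 j| <= e.
    by apply: le_trans xy; have := coord_norm_le (x - y) j; rewrite !mxE.
  by rewrite -(real_normK (num_real (x 0 j - y 0 j)))  ler_sqr ?nnegrE // (le_trans _ h).
by have := c 0; have := c 1; lra.
Qed.

Lemma norm_lt_sqdist x y (e : R) : 0 <= e -> sqdist x y <= 2 * e ^+ 2 -> `|x - y| <= 2 * e.
Proof.
move=> e0 H.
have c (a b : R) : a ^+ 2 + b ^+ 2 <= 2 * e ^+ 2 -> `|a| <= 2 * e.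
  move=> ab; rewrite -(@ler_sqr _ `|a|) ?nnegrE ?mulr_ge0 // real_normK ?num_real //.
  by have := sqr_ge0 b; have := sqr_ge0 e; rewrite exprMn; lra.
apply: rV2_norm_le; rewrite !mxE; first exact: c H.
by apply: (c _ (x 0 0 - y 0 0)); rewrite [leLHS]addrC; exact: H.
Qed.

Variables (J : finType) (c : J -> 'I_2 -> 'rV[R]_2 -> R).

Definition sumsq_op f x := \sum_A vderiv (c A) (vderiv (c A) f) x.

(** Positivity of the principal symbol of [sumsq_op] on the covector (p, q). *)
Definition elliptic_on U := forall x (p q : R), U x -> (p != 0) || (q != 0) ->
  0 < \sum_A (c A 0 x * p + c A 1 x * q) ^+ 2.

Lemma smooth_sub (V : normedModType R) U W (f : 'rV[R]_2 -> V) :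
  (forall y, W y -> U y) -> smooth_on U f -> smooth_on W f.
Proof.
move=> WU sf k; elim: k f sf => [|k IH] f sf; split=> //.
- by move=> y /WU Uy; exact: smooth_continuous sf Uy.
- by move=> y /WU Uy; exact: smooth_continuous sf Uy.
- move=> i; split; first by move=> y /WU Uy; exact: smooth_derivable sf Uy.
  by apply: IH; apply: smooth_partial.
Qed.

Lemma smooth_sumsq_op U f : open U -> (forall A i, smooth_on U (c A i)) ->
  smooth_on U f -> smooth_on U (sumsq_op f).
Proof.
move=> oU sc sf; apply: smooth_sum => // A.
by apply: smooth_vderiv => //; apply: smooth_vderiv.
Qed.

Lemma sumsq_op_max U f x : open U -> (forall A i, smooth_on U (c A i)) ->
  smooth_on U f -> U x -> (forall y, U y -> f y <= f x) -> sumsq_op f x <= 0.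
Proof.
move=> oU sc sf Ux fx; rewrite /sumsq_op -oppr_ge0 -sumrN sumr_ge0 // => A _.
by rewrite oppr_ge0; have [] := vderiv_max oU (sc A) sf Ux fx.
Qed.

Lemma sumsq_opD U f g x : open U -> (forall A i, smooth_on U (c A i)) ->
  smooth_on U f -> smooth_on U g -> U x ->
  sumsq_op (fun y => f y + g y) x = sumsq_op f x + sumsq_op g x.
Proof.
move=> oU sc sf sg Ux; rewrite /sumsq_op -big_split; apply: eq_bigr => A _ /=.
rewrite -(vderivD _ (smooth_vderiv oU (sc A) sf) (smooth_vderiv oU (sc A) sg) Ux).
by apply: vderiv_ext oU _ Ux => y Uy; rewrite (vderivD _ sf sg Uy).
Qed.

Lemma sumsq_opZ U (k : R) g x : open U -> (forall A i, smooth_on U (c A i)) ->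
  smooth_on U g -> U x -> sumsq_op (fun y => k * g y) x = k * sumsq_op g x.
Proof.
move=> oU sc sg Ux; rewrite /sumsq_op mulr_sumr; apply: eq_bigr => A _ /=.
have Z h y : smooth_on U h -> U y -> vderiv (c A) (fun y => k * h y) y = k * vderiv (c A) h y.
  move=> sh Uy; rewrite (vderivM _ (smooth_cst k oU) sh Uy) vderiv_cst.
  by rewrite mulr0 addr0.
rewrite -(Z _ _ (smooth_vderiv oU (sc A) sg) Ux).
by apply: vderiv_ext oU _ Ux => y Uy; rewrite (Z _ _ sg Uy).
Qed.

(* The barrier is w + b w^2 with w = k - |y - y1|^2, vanishing on a circle
   through z: at z its second derivatives are those of w plus 2b|grad w|^2. *)
Lemma hopf_barrier U y1 z : open U -> (forall A i, smooth_on U (c A i)) ->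
  elliptic_on U -> U z -> z <> y1 ->
  exists b : R, let w y := sqdist z y1 - sqdist y y1 in 0 < b /\
    0 < sumsq_op (fun y => w y + b * (w y * w y)) z.
Proof.
move=> oU sc ell Uz zy.
pose w y := sqdist z y1 - sqdist y y1.
have sw : smooth_on U w.
  by apply: smoothD (smoothN oU (smooth_sqdist y1 oU)) => //; apply: smooth_cst.
have wz : w z = 0 by rewrite /w subrr.
have sww := smoothM oU sw sw.
pose p := z 0 0 - y1 0 0; pose q := z 0 1 - y1 0 1.
have pq : (p != 0) || (q != 0).
  rewrite -negb_and; apply/negP => /andP[/eqP p0 /eqP q0]; apply: zy.
  by apply: sqdist_eq0; rewrite /sqdist -/p -/q p0 q0 expr0n addr0.
pose G := \sum_A (c A 0 z * p + c A 1 z * q) ^+ 2.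
have G0 : 0 < G by exact: ell.
have dw A : vderiv (c A) w z = - (2 * (c A 0 z * p + c A 1 z * q)).
  rewrite /w (vderivD _ (smooth_cst (sqdist z y1) oU) (smoothN oU (smooth_sqdist y1 oU)) Uz).
  rewrite vderiv_cst add0r.
  have -> : vderiv (c A) (fun y => - sqdist y y1) z = vderiv (c A) (fun y => -1 * sqdist y y1) z.
    by apply: vderiv_ext oU _ Uz => y _; rewrite mulN1r.
  rewrite (vderivM _ (smooth_cst (-1 : R) oU) (smooth_sqdist y1 oU) Uz) vderiv_cst.
  by rewrite mulr0 addr0 mulN1r (vderiv_sqdist _ _ oU Uz).
have Lww : sumsq_op (fun y => w y * w y) z = 8 * G.
  rewrite /sumsq_op /G mulr_sumr; apply: eq_bigr => A _.
  have svw := smooth_vderiv oU (sc A) sw.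
  have -> : vderiv (c A) (vderiv (c A) (fun y => w y * w y)) z =
      vderiv (c A) (fun y => w y * vderiv (c A) w y + w y * vderiv (c A) w y) z.
    by apply: vderiv_ext oU _ Uz => y Uy; rewrite (vderivM _ sw sw Uy).
  rewrite (vderivD _ (smoothM oU sw svw) (smoothM oU sw svw) Uz).
  rewrite (vderivM _ sw svw Uz) wz dw.
  by move: (vderiv _ _ _) (c A 0 z * p + _) => s t; ring.
pose L := sumsq_op w z.
exists ((`|L| + 1) / G); split; first by rewrite divr_gt0 // ltr_wpDl.
rewrite -/w (sumsq_opD oU sc sw (smoothM oU (smooth_cst _ oU) sww) Uz).
rewrite (sumsq_opZ _ oU sc sww Uz) Lww -/L.
have -> : (`|L| + 1) / G * (8 * G) = 8 * (`|L| + 1) by field; rewrite gt_eqF.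
have := ler_norm (- L); rewrite normrN; have := normr_ge0 L.
by move: `|L| => l; lra.
Qed.

(** If f < M somewhere near [x0], the point [z] of the contact set f = M nearest to it is touched by
    a round ball that meets the contact set nowhere else. Adding a small multiple of the barrier
    pushes [f] strictly below [M] on the boundary of a box around [z] and keeps the value [M] at
    [z]; the sum then has an interior maximum at which the operator is positive, a contradiction. *)
Lemma strong_max_local U f x0 (M : R) : open U ->
  (forall A i, smooth_on U (c A i)) -> elliptic_on U -> smooth_on U f ->
  (forall y, U y -> 0 <= sumsq_op f y) -> (forall y, U y -> f y <= M) ->
  U x0 -> f x0 = M -> \forall y \near x0, f y = M.
Proof.
move=> oU sc ell sf Lf fM Ux0 fx0.
have /nbhs_distP[e4 e4p H4] := open_nbhs_nbhs (conj oU Ux0).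
(* Points at least as close to [y0] as [z] are within 2e of [y0] in the sup norm, hence within 3e of
   [x0]: the box of size 4e contains the whole ball used below. *)
pose e := e4 / 4; have ep : 0 < e by rewrite divr_gt0.
have HU y : `|y - x0| <= 4 * e -> U y by move=> ye; apply: H4; move: ye; rewrite /e; lra.
apply/nbhs_distP; exists e => // y0 y0e.
apply: contrapT => fy0.
pose K := [set y : 'rV[R]_2 | `|y - x0| <= 4 * e /\ f y = M].
have KU y : K y -> U y by case=> /HU.
have cK : compact K.
  have cB := @closed_box_compact R x0 (4 * e).
  apply: (subclosed_compact _ cB); last by move=> y [].
  rewrite closedE => y; apply: contra_notP => nK.
  have [yb|yb] := leP `|y - x0| (4 * e); last first.
    have k0 : 0 < (`|y - x0| - 4 * e) / 2 by rewrite divr_gt0 // subr_gt0.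
    apply/nbhs_distP; exists ((`|y - x0| - 4 * e) / 2) => // y' y'y [y'b _].
    have := ler_normD (y - y') (y' - x0); rewrite subrKA => tri.
    by move: y'y y'b tri yb; rewrite (distrC y y'); lra.
  have fy : f y != M by apply/eqP => fy; apply: nK.
  have cf := smooth_continuous sf (HU _ yb).
  have nM : nbhs (f y) [set t | t != M].
    by apply: open_nbhs_nbhs; split; [exact: open_neq|exact: fy].
  have nn : nbhs y (f @^-1` [set t | t != M]) := cf _ nM.
  by apply: filterS nn => y' /= /eqP n [].
have Kx0 : K x0 by split=> //; rewrite subrr normr0; lra.
have [z zK zmin'] := EVT_min_rV (ex_intro _ x0 Kx0) cK
  (continuous_subspaceT (@continuous_sqdist y0)).
have zmin t : K t -> sqdist z y0 <= sqdist t y0 by move=> Kt; apply: zmin'; rewrite inE.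
move: zK; rewrite inE => -[zb fz].
have near_y0 y : sqdist y y0 <= sqdist z y0 -> `|y - x0| <= 3 * e.
  move=> yz; have l1 : sqdist y y0 <= 2 * e ^+ 2.
    apply: le_trans yz _; apply: le_trans (zmin _ Kx0) _.
    by apply: sqdist_le_norm; rewrite distrC.
  have l2 := norm_lt_sqdist (ltW ep) l1.
  have := ler_normD (y - y0) (y0 - x0); rewrite subrKA => /le_trans; apply.
  by move: l2 y0e; lra.
have inside y : sqdist y y0 < sqdist z y0 -> f y < M.
  move=> yz; have yb := near_y0 _ (ltW yz).
  have yb4 : `|y - x0| <= 4 * e by apply: le_trans yb _; lra.
  rewrite lt_neqAle fM ?andbT; last exact: HU.
  by apply/eqP => fy; have := zmin y (conj yb4 fy); rewrite leNgt yz.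
(* The ball with diameter from [y0] to [z] lies in the ball about [y0] through [z] and shares with
   its boundary the point [z] alone. *)
pose y1 : 'rV[R]_2 := 2^-1 *: (y0 + z).
have y1E j : y1 0 j = (y0 0 j + z 0 j) / 2 by rewrite !mxE mulrC.
have zy1 : z <> y1.
  move=> zy; apply: fy0; rewrite -fz; congr f; apply: sqdist_eq0.
  rewrite /sqdist; have := congr1 (fun v : 'rV[R]_2 => v 0 0) zy.
  have := congr1 (fun v : 'rV[R]_2 => v 0 1) zy; rewrite !y1E => E1 E0.
  have -> : y0 0 0 - z 0 0 = 0 by lra.
  have -> : y0 0 1 - z 0 1 = 0 by lra.
  by rewrite !expr0n addr0.
have touch y : sqdist y y1 <= sqdist z y1 -> y <> z -> f y < M.
  move=> ys yz; apply: inside; rewrite ltNge; apply/negP => yz0.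
  apply: yz; apply: sqdist_eq0.
  have E : sqdist z y0 - sqdist y y0 - sqdist y z = 2 * (sqdist z y1 - sqdist y y1).
    by rewrite /sqdist !y1E; field.
  by move: E ys yz0; lra.
have Uz : U z by apply: HU.
have [b [bp Lh]] := hopf_barrier oU sc ell Uz zy1.
set w := fun y => sqdist z y1 - sqdist y y1 in Lh.
set h := fun y => w y + b * (w y * w y) in Lh.
have sw W : open W -> smooth_on W w.
  by move=> oW; apply: smoothD (smoothN oW (smooth_sqdist y1 oW)) => //; apply: smooth_cst.
have sh W : open W -> smooth_on W h.
  move=> oW; apply: smoothD => //; first exact: sw.
  by apply: smoothM => //; [exact: smooth_cst|apply: smoothM => //; exact: sw].
have cw : continuous w by move=> y; exact: smooth_continuous (sw _ openT) I.
have ch : continuous h by move=> y; exact: smooth_continuous (sh _ openT) I.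
have wz : w z = 0 by rewrite /w subrr.
have hz : h z = 0 by rewrite /h wz; ring.
have hE y : h y = w y * (1 + b * w y) by rewrite /h; ring.
clearbody h.
have [d [dp dU dL dw]] : exists d : R, [/\ 0 < d, (forall y, `|y - z| <= d -> U y),
    (forall y, `|y - z| <= d -> 0 < sumsq_op h y) &
    (forall y, `|y - z| <= d -> 0 < 1 + b * w y)].
  have /nbhs_distP[d1 d1p H1] := open_nbhs_nbhs (conj oU Uz).
  have cL := smooth_continuous (smooth_sumsq_op oU sc (sh _ oU)) Uz.
  have n0 : nbhs (sumsq_op h z) [set t | 0 < t].
    by apply: open_nbhs_nbhs; split; [exact: open_gt|exact: Lh].
  have /nbhs_distP[d2 d2p H2] := cL _ n0.
  have wb : - b^-1 < w z by rewrite wz oppr_lt0 invr_gt0.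
  have nb : nbhs (w z) [set t | - b^-1 < t].
    by apply: open_nbhs_nbhs; split; [exact: open_gt|exact: wb].
  have /nbhs_distP[d3 d3p H3] := cw z _ nb.
  exists (Num.min d1 (Num.min d2 d3)); split; first by rewrite !lt_min d1p d2p d3p.
  - by move=> y; rewrite !le_min => /and3P[yd _ _]; exact: H1.
  - by move=> y; rewrite !le_min => /and3P[_ yd _]; exact: H2.
  - move=> y; rewrite !le_min => /and3P[_ _ yd]; have /= := H3 y yd.
    by rewrite -(ltr_pM2l bp) mulrN divff ?gt_eqF // -ltrBDl sub0r.
have hneg y : `|y - z| <= d -> w y < 0 -> h y < 0.
  by move=> yd wy; rewrite hE pmulr_llt0 // dw.
have cf W : W `<=` U -> {within W, continuous f}.
  move=> WU; apply: continuous_in_subspaceT => y; rewrite inE => /WU.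
  exact: smooth_continuous sf.
pose S := [set y : 'rV[R]_2 | `|y - z| = d /\ 0 <= w y].
have Sd y : S y -> `|y - z| <= d by move=> [-> _].
have cS : compact S.
  have cB := @closed_box_compact R z d.
  apply: (subclosed_compact _ cB); last exact: Sd.
  have -> : S = (fun y => `|y - z|) @^-1` [set t | t = d] `&` w @^-1` [set t | 0 <= t].
    by apply/seteqP; split.
  apply: closedI; apply: closed_comp.
  - move=> y _; apply: (@continuous_comp _ _ _ (fun y : 'rV[R]_2 => y - z) (fun z => `|z|)).
      by apply: continuousB; [exact: cvg_id|exact: cst_continuous].
    exact: norm_continuous.
  - exact: closed_eq.
  - by move=> y _; exact: cw.
  - exact: closed_ge.
(* Where w < 0 the barrier is negative and any k > 0 serves. The rest [S] of the boundary is compact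
   and avoids the contact set, so [f] stays below [M] by a margin there that dictates [k]. *)
have [k [kp kS]] : exists k : R, 0 < k /\ forall y, `|y - z| = d -> f y + k * h y < M.
  have base (k : R) y : 0 < k -> `|y - z| = d -> w y < 0 -> f y + k * h y < M.
    move=> kp yd wy; have yd' : `|y - z| <= d by rewrite yd.
    have fy := fM _ (dU _ yd'); have kh : k * h y < 0 by rewrite pmulr_rlt0 // hneg.
    by move: fy kh; lra.
  have [[s0 Ss0]|/forallNP S0] := pselect (exists s, S s); last first.
    exists 1; split=> // y yd; apply: base => //.
    by rewrite ltNge; apply/negP => wy; apply: (S0 y).
  have S0 : S !=set0 by exists s0.
  have SU : S `<=` U by move=> y /Sd /dU.
  have [s sS smax] := EVT_max_rV S0 cS (cf _ SU).
  have [s' s'S s'max] := EVT_max_rV S0 cS (continuous_subspaceT ch).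
  have fs : f s < M.
    move: sS; rewrite inE => -[sd ws]; apply: touch; first by rewrite -subr_ge0.
    by move=> sz; move: sd; rewrite sz subrr normr0 => d0; move: dp; rewrite -d0 ltxx.
  have nz : 0 < 2 * (`|h s'| + 1) by rewrite mulr_gt0 // ltr_wpDl.
  exists ((M - f s) / (2 * (`|h s'| + 1))); split; first by rewrite divr_gt0 // subr_gt0.
  move=> y yd; have [wy|wy] := ltP (w y) 0.
    by apply: base => //; rewrite divr_gt0 // subr_gt0.
  have yS : y \in S by rewrite inE.
  have l1 := smax _ yS; have l2 := le_trans (s'max _ yS) (ler_norm _).
  have l3 : (M - f s) / (2 * (`|h s'| + 1)) * h y <= (M - f s) / 2.
    rewrite -mulrA ler_pM2l ?subr_gt0 // invfM -mulrA ler_piMr //.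
    by rewrite ler_pdivrMl ?mulr1 ?ltr_wpDl // (le_trans l2) // lerDl.
  by move: l1 l3 fs; lra.
have zB : [set y : 'rV[R]_2 | `|y - z| <= d] z by rewrite /= subrr normr0 ltW.
have BU : [set y : 'rV[R]_2 | `|y - z| <= d] `<=` U by exact: dU.
pose F y := f y + k * h y.
have skh W : open W -> smooth_on W (fun y => k * h y).
  by move=> oW; apply: smoothM => //; [exact: smooth_cst|exact: sh].
have sF : smooth_on U F by apply: smoothD => //; exact: skh.
have cF : {within [set y : 'rV[R]_2 | `|y - z| <= d], continuous F}.
  by apply: continuous_in_subspaceT => y; rewrite inE => /BU; exact: smooth_continuous sF.
have [m mB mmax] := EVT_max_rV (ex_intro _ z zB) (@closed_box_compact R z d) cF.
have Fm : M <= F m.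
  have := mmax z; rewrite inE => /(_ zB); apply: le_trans.
  by rewrite /F hz mulr0 addr0 fz.
move: mB; rewrite inE /= => mB.
have md : `|m - z| < d.
  by rewrite lt_neqAle mB andbT; apply/eqP => /kS; rewrite ltNge -/(F m) Fm.
pose W := (fun y : 'rV[R]_2 => `|y - z|) @^-1` [set t | t < d].
have oW : open W.
  apply: open_comp; last exact: open_lt.
  move=> y _; apply: (@continuous_comp _ _ _ (fun y : 'rV[R]_2 => y - z) (fun z => `|z|)).
    by apply: continuousB; [exact: cvg_id|exact: cst_continuous].
  exact: norm_continuous.
have WU y : W y -> U y by move=> Wy; apply: dU; apply: ltW.
have scW A i : smooth_on W (c A i) by exact: smooth_sub WU (sc A i).
have sfW := smooth_sub WU sf.
have : sumsq_op F m <= 0.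
  apply: (@sumsq_op_max W) => //; first exact: smooth_sub WU sF.
  by move=> y Wy; apply: mmax; rewrite inE /=; apply: ltW.
rewrite (sumsq_opD oW scW sfW (skh _ oW)) // (sumsq_opZ _ oW scW (sh _ oW)) //.
have l1 := Lf m (dU _ mB); have l2 := mulr_gt0 kp (dL m mB).
by rewrite leNgt => /negP; apply; apply: ltr_wpDl.
Qed.

End HopfLemma.

(** * The ring of smooth complex functions on a chart domain *)

Section ComplexParts.
Variable R : realType.
Implicit Types a b : R[i].

Lemma ReD a b : complex.Re (a + b) = complex.Re a + complex.Re b.
Proof. by case: a b => [? ?] []. Qed.
Lemma ImD a b : complex.Im (a + b) = complex.Im a + complex.Im b.
Proof. by case: a b => [? ?] []. Qed.
Lemma ReN a : complex.Re (- a) = - complex.Re a.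
Proof. by case: a. Qed.
Lemma ImN a : complex.Im (- a) = - complex.Im a.
Proof. by case: a. Qed.
Lemma ReM a b : complex.Re (a * b) = complex.Re a * complex.Re b - complex.Im a * complex.Im b.
Proof. by case: a b => [? ?] []. Qed.
Lemma ImM a b : complex.Im (a * b) = complex.Re a * complex.Im b + complex.Im a * complex.Re b.
Proof. by case: a b => [? ?] []. Qed.
Lemma Re_conj a : complex.Re (conjc a) = complex.Re a.
Proof. by case: a. Qed.
Lemma Im_conj a : complex.Im (conjc a) = - complex.Im a.
Proof. by case: a. Qed.
Lemma complex_ext a b : complex.Re a = complex.Re b -> complex.Im a = complex.Im b -> a = b.
Proof. by case: a b => [? ?] [? ?] /= -> ->. Qed.

End ComplexParts.

Section SmoothRing.
Variables (R : realType) (U : set 'rV[R]_2) (oU : open U).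

(* Smooth complex functions on U, extended by 0 outside of U, so that equality
   is equality on U; the unit of the ring is the indicator function of U. *)
Definition csmooth (f : 'rV[R]_2 -> R[i]) := [/\ smooth_on U (@complex.Re _ \o f),
  smooth_on U (@complex.Im _ \o f) & forall x, ~ U x -> f x = 0].

(** Openness indexes the type because the ring operations need it to preserve smoothness, and
    instances are inferred from the type alone. *)
Record smfun (o : open U) := SFun {
  smfun_fun :> 'rV[R]_2 -> R[i];
  smfunP : csmooth smfun_fun }.

Local Notation A := (smfun oU).

HB.instance Definition _ := gen_eqMixin A.
HB.instance Definition _ := gen_choiceMixin A.

Lemma smfun_ext (f g : A) : (forall x, U x -> f x = g x) -> f = g.
Proof.
case: f g => f pf [g pg] /= fg.
have e : f = g.
  apply/funext => x; have [Ux|nUx] := pselect (U x); first exact: fg.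
  by case: pf pg => _ _ zf [_ _ zg]; rewrite zf // zg.
by subst g; congr SFun; exact: Prop_irrelevance.
Qed.

Lemma csmooth0 : csmooth (fun=> 0).
Proof. by split=> //; apply: smooth_ext (smooth_cst (0 : R) oU). Qed.

Lemma csmooth_ind (k : R[i]) : csmooth (fun x => if `[< U x >] then k else 0).
Proof.
split; last by move=> x nU; rewrite asboolF.
  by apply: smooth_ext (smooth_cst (complex.Re k) oU) => // y Uy /=; rewrite asboolT.
by apply: smooth_ext (smooth_cst (complex.Im k) oU) => // y Uy /=; rewrite asboolT.
Qed.

Lemma csmoothD (f g : A) : csmooth (fun x => f x + g x).
Proof.
case: f g => f [rf jf zf] [g [rg jg zg]]; split=> /=; last first.
- by move=> x nU; rewrite zf // zg // addr0.
- by apply: smooth_ext (smoothD oU jf jg) => // y _ /=; rewrite ImD.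
- by apply: smooth_ext (smoothD oU rf rg) => // y _ /=; rewrite ReD.
Qed.

Lemma csmoothN (f : A) : csmooth (fun x => - f x).
Proof.
case: f => f [rf jf zf]; split=> /=; last first.
- by move=> x nU; rewrite zf // oppr0.
- by apply: smooth_ext (smoothN oU jf) => // y _ /=; rewrite ImN.
- by apply: smooth_ext (smoothN oU rf) => // y _ /=; rewrite ReN.
Qed.

Lemma csmoothM (f g : A) : csmooth (fun x => f x * g x).
Proof.
case: f g => f [rf jf zf] [g [rg jg zg]]; split=> /=; last first.
- by move=> x nU; rewrite zf // zg // mulr0.
- by apply: smooth_ext (smoothD oU (smoothM oU rf jg) (smoothM oU jf rg)) => // y _ /=; rewrite ImM.
- by apply: smooth_ext (smoothD oU (smoothM oU rf rg) (smoothN oU (smoothM oU jf jg))) => // y _ /=; rewrite ReM.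
Qed.

Lemma csmooth_cj (f : A) : csmooth (fun x => conjc (f x)).
Proof.
case: f => f [rf jf zf]; split=> /=; last first.
- by move=> x nU; rewrite zf // conjc0.
- by apply: smooth_ext (smoothN oU jf) => // y _ /=; rewrite Im_conj.
- by apply: smooth_ext rf => // y _ /=; rewrite Re_conj.
Qed.

Definition sf0 : A := SFun _ csmooth0.
Definition sf1 : A := SFun _ (csmooth_ind 1).
Definition sf_add (f g : A) : A := SFun _ (csmoothD f g).
Definition sf_opp (f : A) : A := SFun _ (csmoothN f).
Definition sf_mul (f g : A) : A := SFun _ (csmoothM f g).
Definition sf_cj (f : A) : A := SFun _ (csmooth_cj f).

Lemma sf_addA : associative sf_add.
Proof. by move=> f g h; apply: smfun_ext => x _ /=; rewrite addrA. Qed.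
Lemma sf_addC : commutative sf_add.
Proof. by move=> f g; apply: smfun_ext => x _ /=; rewrite addrC. Qed.
Lemma sf_add0 : left_id sf0 sf_add.
Proof. by move=> f; apply: smfun_ext => x _ /=; rewrite add0r. Qed.
Lemma sf_addN : left_inverse sf0 sf_opp sf_add.
Proof. by move=> f; apply: smfun_ext => x _ /=; rewrite addNr. Qed.
HB.instance Definition _ := GRing.isZmodule.Build A sf_addA sf_addC sf_add0 sf_addN.

Lemma sf_mulA : associative sf_mul.
Proof. by move=> f g h; apply: smfun_ext => x _ /=; rewrite mulrA. Qed.
Lemma sf_mulC : commutative sf_mul.
Proof. by move=> f g; apply: smfun_ext => x _ /=; rewrite mulrC. Qed.
Lemma sf_mul1 : left_id sf1 sf_mul.
Proof. by move=> f; apply: smfun_ext => x Ux /=; rewrite asboolT // mul1r. Qed.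
Lemma sf_mulD : left_distributive sf_mul +%R.
Proof. by move=> f g h; apply: smfun_ext => x _ /=; rewrite mulrDl. Qed.
HB.instance Definition _ := GRing.Zmodule_isComPzRing.Build A sf_mulA sf_mulC sf_mul1 sf_mulD.

Lemma sf_cj_additive : additive sf_cj.
Proof. by move=> f g; apply: smfun_ext => x _ /=; rewrite rmorphB. Qed.
HB.instance Definition _ := GRing.isAdditive.Build A A sf_cj sf_cj_additive.
Lemma sf_cj_multiplicative : multiplicative sf_cj.
Proof.
split=> [f g|]; apply: smfun_ext => x Ux /=; first by rewrite rmorphM.
by rewrite asboolT // rmorph1.
Qed.
HB.instance Definition _ := GRing.isMultiplicative.Build A A sf_cj sf_cj_multiplicative.

Lemma sf_cjK : involutive sf_cj.
Proof. by move=> f; apply: smfun_ext => x _ /=; rewrite conjcK. Qed.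

Lemma smfunD (f g : A) x : (f + g) x = f x + g x. Proof. by []. Qed.
Lemma smfunN (f : A) x : (- f) x = - f x. Proof. by []. Qed.
Lemma smfunM (f g : A) x : (f * g) x = f x * g x. Proof. by []. Qed.
Lemma smfun0 x : (0 : A) x = 0. Proof. by []. Qed.
Lemma smfun1 x : U x -> (1 : A) x = 1.
Proof. by move=> Ux; rewrite /= asboolT. Qed.
Lemma smfun_cj (f : A) x : (sf_cj f) x = conjc (f x). Proof. by []. Qed.
Lemma smfun_nat k x : U x -> (k%:R : A) x = k%:R.
Proof.
move=> Ux; elim: k => [|k IH]; first exact: smfun0.
by rewrite -!natr1 smfunD IH smfun1.
Qed.
Lemma smfun_sum (I : Type) (s : seq I) (F : I -> A) x :
  (\sum_(i <- s) F i) x = \sum_(i <- s) F i x.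
Proof. by elim: s => [|i s IH]; rewrite ?big_nil // !big_cons smfunD IH. Qed.

Lemma csmooth_sreal (f : 'rV[R]_2 -> R) : smooth_on U f ->
  csmooth (fun x => if `[< U x >] then (f x)%:C%C else 0).
Proof.
move=> sf; split; last by move=> x nU; rewrite asboolF.
  by apply: smooth_ext sf => // y Uy /=; rewrite asboolT.
by apply: smooth_ext (smooth_cst (0 : R) oU) => // y Uy /=; rewrite asboolT.
Qed.

Definition sreal (f : 'rV[R]_2 -> R) (sf : smooth_on U f) : A := SFun _ (csmooth_sreal sf).

Definition scst (k : R[i]) : A := SFun _ (csmooth_ind k).

Lemma srealE f (sf : smooth_on U f) x : U x -> sreal sf x = (f x)%:C%C.
Proof. by move=> Ux; rewrite /= asboolT. Qed.

Lemma scstE k x : U x -> scst k x = k.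
Proof. by move=> Ux; rewrite /= asboolT. Qed.

Lemma cj_sreal f (sf : smooth_on U f) : sf_cj (sreal sf) = sreal sf.
Proof. by apply: smfun_ext => x Ux; rewrite smfun_cj srealE // conjc_real. Qed.

Lemma csmooth_partial i (f : A) : csmooth (fun x => if `[< U x >] then
  (partial i (@complex.Re _ \o f) x +i* partial i (@complex.Im _ \o f) x)%C else 0).
Proof.
case: f => f [rf jf zf]; split=> /=; last by move=> x nU; rewrite asboolF.
  by apply: smooth_ext (smooth_partial i rf) => // y Uy /=; rewrite asboolT.
by apply: smooth_ext (smooth_partial i jf) => // y Uy /=; rewrite asboolT.
Qed.

Definition sd i (f : A) : A := SFun _ (csmooth_partial i f).

Lemma sdE i (f : A) x : U x ->
  sd i f x = (partial i (@complex.Re _ \o f) x +i* partial i (@complex.Im _ \o f) x)%C.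
Proof. by move=> Ux; rewrite /= asboolT. Qed.

Lemma sf_Re (f : A) : smooth_on U (@complex.Re _ \o f). Proof. by case: (smfunP f). Qed.
Lemma sf_Im (f : A) : smooth_on U (@complex.Im _ \o f). Proof. by case: (smfunP f). Qed.

Lemma sdD i (f g : A) : sd i (f + g) = sd i f + sd i g.
Proof.
apply: smfun_ext => x Ux; rewrite smfunD !sdE //.
have -> : @complex.Re _ \o (f + g) = (fun y => (@complex.Re _ \o f) y + (@complex.Re _ \o g) y).
  by apply/funext => y; rewrite /= ReD.
have -> : @complex.Im _ \o (f + g) = (fun y => (@complex.Im _ \o f) y + (@complex.Im _ \o g) y).
  by apply/funext => y; rewrite /= ImD.
rewrite (smooth_partialD i (sf_Re f) (sf_Re g) Ux).
by rewrite (smooth_partialD i (sf_Im f) (sf_Im g) Ux).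
Qed.

Lemma sdM i (f g : A) : sd i (f * g) = sd i f * g + f * sd i g.
Proof.
apply: smfun_ext => x Ux; rewrite smfunD !smfunM !sdE //.
have [rf jf] := (sf_Re f, sf_Im f); have [rg jg] := (sf_Re g, sf_Im g).
have eR y : U y -> (@complex.Re _ \o (f * g)) y = (@complex.Re _ \o f) y * (@complex.Re _ \o g) y
    + - ((@complex.Im _ \o f) y * (@complex.Im _ \o g) y) by rewrite /= ReM.
have eI y : U y -> (@complex.Im _ \o (f * g)) y = (@complex.Re _ \o f) y * (@complex.Im _ \o g) y
    + (@complex.Im _ \o f) y * (@complex.Re _ \o g) y by rewrite /= ImM.
rewrite (partial_ext i oU eR Ux) (partial_ext i oU eI Ux).
rewrite (smooth_partialD i (smoothM oU rf jg) (smoothM oU jf rg) Ux).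
rewrite (smooth_partialD i (smoothM oU rf rg) (smoothN oU (smoothM oU jf jg)) Ux).
have -> : partial i (fun y => - ((@complex.Im _ \o f) y * (@complex.Im _ \o g) y)) x
   = - partial i (fun y => (@complex.Im _ \o f) y * (@complex.Im _ \o g) y) x.
  rewrite !partialE deriveN //; exact: smooth_derivable (smoothM oU jf jg) Ux.
rewrite (smooth_partialM i rf rg Ux) (smooth_partialM i jf jg Ux).
rewrite (smooth_partialM i rf jg Ux) (smooth_partialM i jf rg Ux) /=.
gen_partial; case: (f x) (g x) => [a b] [a' b'] /=.
by apply: complex_ext; rewrite ?(ReD, ImD, ReM, ImM) /=; ring.
Qed.

Lemma sd_cj i (f : A) : sd i (sf_cj f) = sf_cj (sd i f).
Proof.
apply: smfun_ext => x Ux; rewrite smfun_cj !sdE //.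
have eR y : U y -> (@complex.Re _ \o sf_cj f) y = (@complex.Re _ \o f) y by rewrite /= Re_conj.
have eI y : U y -> (@complex.Im _ \o sf_cj f) y = - (@complex.Im _ \o f) y by rewrite /= Im_conj.
rewrite (partial_ext i oU eR Ux) (partial_ext i oU eI Ux).
have -> : partial i (fun y => - (@complex.Im _ \o f) y) x = - partial i (@complex.Im _ \o f) x.
  by rewrite !partialE deriveN //; exact: smooth_derivable (sf_Im f) Ux.
by [].
Qed.

Lemma sdC i j (f : A) : sd i (sd j f) = sd j (sd i f).
Proof.
apply: smfun_ext => x Ux; rewrite (sdE i (sd j f) Ux) (sdE j (sd i f) Ux).
have eR k y : U y -> (@complex.Re _ \o sd k f) y = partial k (@complex.Re _ \o f) y.
  by move=> Uy; rewrite /= asboolT.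
have eI k y : U y -> (@complex.Im _ \o sd k f) y = partial k (@complex.Im _ \o f) y.
  by move=> Uy; rewrite /= asboolT.
rewrite (partial_ext i oU (eR j) Ux) (partial_ext j oU (eR i) Ux).
rewrite (partial_ext i oU (eI j) Ux) (partial_ext j oU (eI i) Ux).
have e1 := partialC i j oU (sf_Re f) Ux; have e2 := partialC i j oU (sf_Im f) Ux.
exact: (congr2 (@Complex R) e1 e2).
Qed.

Lemma sd_sreal i f (sf : smooth_on U f) (sp : smooth_on U (partial i f)) :
  sd i (sreal sf) = sreal sp.
Proof.
apply: smfun_ext => x Ux; rewrite sdE // srealE //.
have eR y : U y -> (@complex.Re _ \o sreal sf) y = f y by move=> Uy; rewrite /= asboolT.
have eI y : U y -> (@complex.Im _ \o sreal sf) y = 0 by move=> Uy; rewrite /= asboolT.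
by rewrite (partial_ext i oU eR Ux) (partial_ext i oU eI Ux) partial_cst.
Qed.

Lemma sd_scst i k : sd i (scst k) = 0.
Proof.
apply: smfun_ext => x Ux; rewrite sdE // smfun0.
have eR y : U y -> (@complex.Re _ \o scst k) y = complex.Re k by move=> Uy; rewrite /= asboolT.
have eI y : U y -> (@complex.Im _ \o scst k) y = complex.Im k by move=> Uy; rewrite /= asboolT.
by rewrite (partial_ext i oU eR Ux) (partial_ext i oU eI Ux) !partial_cst.
Qed.

End SmoothRing.

(** * Complex frame calculus *)

Section FrameCalculus.
Variables (C : comPzRingType) (cj : {rmorphism C -> C}) (E : C -> C) (kap half : C).
Variable n : nat.
Hypothesis cjK : involutive cj.
Hypothesis ED : forall a b, E (a + b) = E a + E b.
Hypothesis EM : forall a b, E (a * b) = E a * b + a * E b.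
Hypothesis halfE : 2 * half = 1.

Definition Eb a := cj (E (cj a)).

Hypothesis Ecomm : forall a, E (Eb a) - Eb (E a) = kap * Eb a - cj kap * E a.

(** [Ecomm] is the torsion-free structure equation of the frame, with [kap] its connection
    coefficient. As [E] = e1 - i e2 for an orthonormal frame, [lap] is the Laplace-Beltrami operator
    itself, without a factor. *)
Definition lap a := Eb (E a) - cj kap * E a.

Implicit Types (a b : C) (u v : 'rV[C]_n) (k l : nat).

Lemma E0 : E 0 = 0.
Proof. by apply: (addrI (E 0)); rewrite addr0 -ED addr0. Qed.

Lemma E1 : E 1 = 0.
Proof. by apply: (addrI (E 1)); rewrite -{3}[1]mulr1 EM mulr1 mul1r addr0. Qed.

Lemma EN a : E (- a) = - E a.
Proof. by apply/eqP; rewrite -subr_eq0 opprK -ED addNr E0. Qed.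

Lemma EB a b : E (a - b) = E a - E b.
Proof. by rewrite ED EN. Qed.

Lemma En k : E k%:R = 0.
Proof. by elim: k => [|k IH]; [rewrite E0|rewrite -natr1 ED E1 IH addr0]. Qed.

Lemma EbD a b : Eb (a + b) = Eb a + Eb b.
Proof. by rewrite /Eb rmorphD ED rmorphD. Qed.

Lemma EbN a : Eb (- a) = - Eb a.
Proof. by rewrite /Eb rmorphN EN rmorphN. Qed.

Lemma EbM a b : Eb (a * b) = Eb a * b + a * Eb b.
Proof. by rewrite /Eb rmorphM EM rmorphD !rmorphM !cjK. Qed.

Lemma Ebn k : Eb k%:R = 0.
Proof. by rewrite /Eb rmorph_nat En rmorph0. Qed.

Lemma cjE a : cj (E a) = Eb (cj a).
Proof. by rewrite /Eb cjK. Qed.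

Lemma cjEb a : cj (Eb a) = E (cj a).
Proof. by rewrite /Eb cjK. Qed.

Lemma cjn k : cj k%:R = k%:R.
Proof. exact: rmorph_nat. Qed.

Lemma Ehalf : E half = 0.
Proof.
have : E (2 * half) = 0 by rewrite halfE E1.
rewrite EM En mul0r add0r => H.
by rewrite -[E half]mul1r -halfE (mulrC 2) -mulrA H mulr0.
Qed.

Lemma cjhalf : cj half = half.
Proof.
have : 2 * cj half = 1 by rewrite -(cjn 2) -rmorphM halfE rmorph1.
by move=> H; rewrite -[cj half]mul1r -halfE mulrAC H mul1r.
Qed.

Lemma half_inj a : 2 * a = 0 -> a = 0.
Proof. by move=> H; rewrite -[a]mul1r -halfE mulrAC H mul0r. Qed.

Definition EV u := map_mx E u.
Definition EbV u := map_mx Eb u.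
Definition cjV u := map_mx cj u.
(** The complex bilinear product; the Hermitian one is [bdot u (cjV v)]. *)
Definition bdot u v := \sum_j u 0 j * v 0 j.

Lemma dotC u v : bdot u v = bdot v u.
Proof. by apply: eq_bigr => j _; rewrite mulrC. Qed.

Lemma dotDl u v w : bdot (u + v) w = bdot u w + bdot v w.
Proof. by rewrite -big_split; apply: eq_bigr => j _; rewrite mxE mulrDl. Qed.

Lemma dotDr u v w : bdot w (u + v) = bdot w u + bdot w v.
Proof. by rewrite dotC dotDl !(dotC w). Qed.

Lemma dotZl a u w : bdot (a *: u) w = a * bdot u w.
Proof. by rewrite mulr_sumr; apply: eq_bigr => j _; rewrite mxE mulrA. Qed.

Lemma dotZr a u w : bdot w (a *: u) = a * bdot w u.
Proof. by rewrite dotC dotZl dotC. Qed.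

Lemma dotNl u w : bdot (- u) w = - bdot u w.
Proof. by rewrite -scaleN1r dotZl mulN1r. Qed.

Lemma dotNr u w : bdot w (- u) = - bdot w u.
Proof. by rewrite -scaleN1r dotZr mulN1r. Qed.

Lemma dotBl u v w : bdot (u - v) w = bdot u w - bdot v w.
Proof. by rewrite dotDl dotNl. Qed.

Lemma cj_dot u v : cj (bdot u v) = bdot (cjV u) (cjV v).
Proof. by rewrite rmorph_sum; apply: eq_bigr => j _; rewrite rmorphM !mxE. Qed.

Lemma cjVK u : cjV (cjV u) = u.
Proof. by apply/rowP => j; rewrite !mxE cjK. Qed.

Lemma cjVD u v : cjV (u + v) = cjV u + cjV v.
Proof. by apply/rowP => j; rewrite !mxE rmorphD. Qed.

Lemma cjVN u : cjV (- u) = - cjV u.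
Proof. by apply/rowP => j; rewrite !mxE rmorphN. Qed.

Lemma cjVZ a u : cjV (a *: u) = cj a *: cjV u.
Proof. by apply/rowP => j; rewrite !mxE rmorphM. Qed.

Lemma cjV_EV u : cjV (EV u) = EbV (cjV u).
Proof. by apply/rowP => j; rewrite !mxE cjE. Qed.

Lemma E_sum (I : Type) (s : seq I) (F : I -> C) :
  E (\sum_(i <- s) F i) = \sum_(i <- s) E (F i).
Proof. exact: (big_morph E ED E0). Qed.

Lemma E_dot u v : E (bdot u v) = bdot (EV u) v + bdot u (EV v).
Proof.
by rewrite E_sum -big_split; apply: eq_bigr => j _; rewrite EM !mxE.
Qed.

Lemma EVD u v : EV (u + v) = EV u + EV v.
Proof. by apply/rowP => j; rewrite !mxE ED. Qed.

Lemma EVN u : EV (- u) = - EV u.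
Proof. by apply/rowP => j; rewrite !mxE EN. Qed.

Lemma EVZ a u : EV (a *: u) = E a *: u + a *: EV u.
Proof. by apply/rowP => j; rewrite !mxE EM. Qed.

(* [D k] and [Db k] are the (1,0) and (0,1) parts of the Levi-Civita
   derivative of a field of spin weight k. *)
Definition D k a := E a + k%:R * kap * a.
Definition Db k a := Eb a - k%:R * cj kap * a.
Definition DV k u := EV u + (k%:R * kap) *: u.
Definition DbV k u := EbV u - (k%:R * cj kap) *: u.

Lemma DVj k u (j : 'I_n) : DV k u 0 j = E (u 0 j) + k%:R * kap * u 0 j.
Proof. by rewrite !mxE. Qed.

Lemma DbVj k u (j : 'I_n) : DbV k u 0 j = Eb (u 0 j) - k%:R * cj kap * u 0 j.
Proof. by rewrite !mxE. Qed.

(* [curv] is twice the Gauss curvature, since [E] = e1 - i e2 has norm sqrt 2. *)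
Definition curv := Eb kap + E (cj kap) - 2 * (kap * cj kap).

(** The Ricci identity. [D] raises the weight by one and [Db] lowers it, hence the indices [k.+2]
    and [k] of the outer operators; starting from [k.+1] keeps the lowered weight a natural
    number. *)
Lemma comm_Ds k a :
  Db k.+2 (D k.+1 a) = D k (Db k.+1 a) + k.+1%:R * curv * a.
Proof.
rewrite /D /Db /curv ED EN EbD !EM !EbM !En !Ebn.
have -> : E (Eb a) = Eb (E a) + (kap * Eb a - cj kap * E a) by rewrite -Ecomm; ring.
rewrite -[k.+2]addn2 -[k.+1]addn1 !natrD.
by move: (Eb (E a)) (Eb a) (E a) (E (cj kap)) (Eb kap) (cj kap) => *; ring.
Qed.

Lemma comm_D k u :
  DbV k.+2 (DV k.+1 u) = DV k (DbV k.+1 u) + (k.+1%:R * curv) *: u.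
Proof.
apply/rowP => j; have := comm_Ds k (u 0 j); rewrite /D /Db => H.
by rewrite !mxE H; ring.
Qed.

(** Conjugation negates the weight and exchanges [D] with [Db], so the product is a scalar of weight
    k - l. *)
Lemma D_dotcj k l u v : bdot (DV k u) (cjV v) + bdot u (cjV (DbV l v)) =
  E (bdot u (cjV v)) + (k%:R - l%:R) * kap * bdot u (cjV v).
Proof.
rewrite E_dot.
have -> : cjV (DbV l v) = EV (cjV v) - (l%:R * kap) *: cjV v.
  by apply/rowP => j; rewrite !mxE rmorphB !rmorphM cjEb cjn cjK.
rewrite dotDl dotDr dotNr dotZl dotZr.
by move: (bdot (EV u) _) (bdot u (EV _)) (bdot u _) => *; ring.
Qed.

Lemma Db_dotcj k l u v : bdot (DbV k u) (cjV v) + bdot u (cjV (DV l v)) =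
  Eb (bdot u (cjV v)) - (k%:R - l%:R) * cj kap * bdot u (cjV v).
Proof.
have := congr1 cj (D_dotcj l k v u).
rewrite !rmorphD !rmorphM !rmorphB !cj_dot !cjVK !cjn cjE cj_dot cjVK.
rewrite (dotC (cjV (DV l v))) (dotC (cjV v)) (dotC (cjV v)) addrC => ->.
ring.
Qed.

Lemma D_dot k l u v : bdot (DV k u) v + bdot u (DV l v) =
  E (bdot u v) + (k%:R + l%:R) * kap * bdot u v.
Proof.
rewrite E_dot dotDl dotDr dotZl dotZr.
by move: (bdot (EV u) _) (bdot u (EV _)) (bdot u _) => *; ring.
Qed.

Lemma Db_dot k l u v : bdot (DbV k u) v + bdot u (DbV l v) =
  Eb (bdot u v) - (k%:R + l%:R) * cj kap * bdot u v.
Proof.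
have -> : Eb (bdot u v) = bdot (EbV u) v + bdot u (EbV v).
  rewrite /Eb cj_dot E_dot rmorphD !cj_dot !cjVK.
  by congr (bdot _ _ + bdot _ _); apply/rowP => j; rewrite !mxE.
rewrite dotBl dotDr dotNr dotZl dotZr.
by move: (bdot (EbV u) _) (bdot u (EbV _)) (bdot u _) => *; ring.
Qed.

Lemma DVZ k l a u : DV (k + l) (a *: u) = D k a *: u + a *: DV l u.
Proof.
apply/rowP => j; rewrite !mxE /D EM natrD.
by move: (E (u 0 j)) (u 0 j) (E a) => *; ring.
Qed.

Lemma DbVZ k l a u : DbV (k + l) (a *: u) = Db k a *: u + a *: DbV l u.
Proof.
apply/rowP => j; rewrite !mxE /Db EbM natrD.
by move: (Eb (u 0 j)) (u 0 j) (Eb a) (cj kap) => *; ring.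
Qed.

Lemma DVD k u v : DV k (u + v) = DV k u + DV k v.
Proof. by rewrite /DV EVD scalerDr addrACA. Qed.

Lemma DbVD k u v : DbV k (u + v) = DbV k u + DbV k v.
Proof.
apply/rowP => j; rewrite !mxE EbD.
by move: (Eb (u 0 j)) (Eb (v 0 j)) => *; ring.
Qed.

Lemma DVN k u : DV k (- u) = - DV k u.
Proof. by apply/rowP => j; rewrite !mxE EN; move: (E _) => *; ring. Qed.

Lemma DbVN k u : DbV k (- u) = - DbV k u.
Proof. by apply/rowP => j; rewrite !mxE EbN; move: (Eb _) (cj kap) => *; ring. Qed.

Lemma lapE a : lap a = Db 1 (E a).
Proof. by rewrite /lap /Db mul1r. Qed.

(** For an isotropic vector of square norm 2 only the mixed terms survive summation over the ambient
    coordinates. With a = E f and b = Eb f this is the squared length of the gradient. *)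
Lemma sum_half_sqr u a b : bdot u u = 0 -> bdot u (cjV u) = 2 ->
  \sum_j (half * (cjV u 0 j * a + u 0 j * b)) ^+ 2 = a * b.
Proof.
move=> u0 u2.
have -> : \sum_j (half * (cjV u 0 j * a + u 0 j * b)) ^+ 2 =
    half * half * (a * a * bdot (cjV u) (cjV u) + b * b * bdot u u + 2 * a * b * bdot u (cjV u)).
  rewrite !mulr_sumr -!big_split mulr_sumr; apply: eq_bigr => j _ /=.
  by move: (cjV u 0 j) (u 0 j) => *; ring.
have -> : bdot (cjV u) (cjV u) = 0 by rewrite -cj_dot u0 rmorph0.
rewrite u0 u2.
have -> : half * half * (a * a * 0 + b * b * 0 + 2 * a * b * 2) = (2 * half) * (2 * half) * (a * b) by ring.
by rewrite halfE !mul1r.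
Qed.

(** Contraction of two matrices, each a sum of four of rank one: the shape taken by the derivative
    of the tangential projection. *)
Lemma dot_four (p1 p2 p3 p4 q1 q2 q3 q4 r1 r2 r3 r4 s1 s2 s3 s4 : 'rV[C]_n) :
  \sum_i \sum_j (p1 0 i * q1 0 j + p2 0 i * q2 0 j + p3 0 i * q3 0 j + p4 0 i * q4 0 j)
    * (r1 0 i * s1 0 j + r2 0 i * s2 0 j + r3 0 i * s3 0 j + r4 0 i * s4 0 j) =
  (bdot p1 r1 * bdot q1 s1 + bdot p1 r2 * bdot q1 s2 + bdot p1 r3 * bdot q1 s3 + bdot p1 r4 * bdot q1 s4)
  + (bdot p2 r1 * bdot q2 s1 + bdot p2 r2 * bdot q2 s2 + bdot p2 r3 * bdot q2 s3 + bdot p2 r4 * bdot q2 s4)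
  + (bdot p3 r1 * bdot q3 s1 + bdot p3 r2 * bdot q3 s2 + bdot p3 r3 * bdot q3 s3 + bdot p3 r4 * bdot q3 s4)
  + (bdot p4 r1 * bdot q4 s1 + bdot p4 r2 * bdot q4 s2 + bdot p4 r3 * bdot q4 s3 + bdot p4 r4 * bdot q4 s4).
Proof.
pose T (p q r s : 'rV[C]_n) i := \sum_j p 0 i * q 0 j * (r 0 i * s 0 j).
have TE p q r s : bdot p r * bdot q s = \sum_i T p q r s i.
  by rewrite /bdot mulr_suml; apply: eq_bigr => i _; rewrite mulr_sumr;
     apply: eq_bigr => j _; ring.
rewrite !TE -!big_split; apply: eq_bigr => i _; rewrite /T -!big_split.
by apply: eq_bigr => j _ /=; ring.
Qed.

(** * Surfaces with parallel mean curvature in a complex frame *)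

Section ParallelMeanCurvature.
Variables (X H : 'rV[C]_n).
Let F1 := EV X.
Let F2 := DV 1 F1.
Let a2 := bdot F2 (cjV F2).
Let h2 := bdot H H.
Let q := bdot H F2.
Hypothesis Xreal : cjV X = X.
Hypothesis Hreal : cjV H = H.
Hypothesis XX : bdot X X = 1.
Hypothesis F11 : bdot F1 F1 = 0.
Hypothesis F1c1 : bdot F1 (cjV F1) = 2.
Hypothesis DbF1 : DbV 1 F1 = 2 *: (H - X).
Hypothesis HX : bdot H X = 0.
Hypothesis HF1 : bdot H F1 = 0.

Lemma pmc_XF1 : bdot X F1 = 0.
Proof.
have := E_dot X X; rewrite XX E1 -/F1 (dotC F1) => e.
by apply: half_inj; rewrite e; ring.
Qed.

Lemma pmc_HcF1 : bdot H (cjV F1) = 0.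
Proof. by have := congr1 cj HF1; rewrite cj_dot Hreal rmorph0. Qed.

Lemma pmc_XcF1 : bdot X (cjV F1) = 0.
Proof. by have := congr1 cj pmc_XF1; rewrite cj_dot Xreal rmorph0. Qed.

Lemma cjV_DbF1 : cjV (DbV 1 F1) = 2 *: (H - X).
Proof. by rewrite DbF1 cjVZ cjVD cjVN Hreal Xreal cjn. Qed.

Lemma pmc_F2c1 : bdot F2 (cjV F1) = 0.
Proof.
have := D_dotcj 1 1 F1 F1; rewrite F1c1 En cjV_DbF1 dotZr dotDr dotNr.
rewrite (dotC F1 H) (dotC F1 X) HF1 pmc_XF1 -/F2; move: (bdot F2 _) => z e.
have -> : z = z + 2 * (0 - 0) by ring.
by rewrite e; ring.
Qed.

Lemma pmc_F2F1 : bdot F2 F1 = 0.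
Proof.
have := D_dot 1 1 F1 F1; rewrite F11 E0 mulr0 addr0 -/F2 (dotC F1) => e.
by apply: half_inj; rewrite -[RHS]e; ring.
Qed.

Lemma pmc_F2X : bdot F2 X = 0.
Proof.
have := D_dot 1 0 F1 X; rewrite (dotC F1 X) pmc_XF1 E0 mulr0 addr0 -/F2.
have -> : DV 0 X = F1 by rewrite /DV mul0r scale0r addr0.
by rewrite F11 addr0.
Qed.

(* The derivative along the tangential part of the A-th coordinate vector of the
   ambient space: unlike [E], it does not depend on the frame. *)
Definition tang A a := half * (cjV F1 0 A * E a + F1 0 A * Eb a).

(** The tangential parts of the ambient basis vectors resolve the identity of the tangent plane,
    which gives the principal part. Their covariant derivatives are normal components times
    tangential ones and cancel in the sum, so no further first-order term remains. *)
Lemma sum_tang_lap a : \sum_A tang A (tang A a) = lap a.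
Proof.
have e1 : bdot (cjV F1) (EV F1) = - (2 * kap).
  have := pmc_F2c1; rewrite dotC dotDr dotZr (dotC _ F1) F1c1 mul1r => /eqP.
  by rewrite addr_eq0 => /eqP ->; ring.
have e2 : bdot (cjV F1) (EV (cjV F1)) = 0.
  have := E_dot (cjV F1) (cjV F1); rewrite -cj_dot F11 rmorph0 E0 (dotC (EV _)) => e.
  by apply: half_inj; rewrite [RHS]e; ring.
have e3 : bdot F1 (EbV (cjV F1)) = - (2 * cj kap).
  have := congr1 cj e1; rewrite cj_dot cjVK rmorphN rmorphM cjn => <-.
  by rewrite cjV_EV.
have e4 : bdot F1 (EbV F1) = 0.
  have := congr1 cj e2; rewrite cj_dot cjVK rmorph0 => <-.
  by rewrite cjV_EV cjVK.
have -> : \sum_A tang A (tang A a) = half * half * (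
    E a * (bdot (cjV F1) (EV (cjV F1)) + bdot F1 (EbV (cjV F1)))
    + Eb a * (bdot (cjV F1) (EV F1) + bdot F1 (EbV F1))
    + E (E a) * bdot (cjV F1) (cjV F1) + (E (Eb a) + Eb (E a)) * bdot F1 (cjV F1)
    + Eb (Eb a) * bdot F1 F1).
  have Ebh : Eb half = 0 by rewrite /Eb cjhalf Ehalf rmorph0.
  have ee j : EV F1 0 j = E (F1 0 j) by rewrite mxE.
  have eeb j : EbV F1 0 j = Eb (F1 0 j) by rewrite mxE.
  have ec j : EV (cjV F1) 0 j = E (cjV F1 0 j) by rewrite mxE.
  have ecb j : EbV (cjV F1) 0 j = Eb (cjV F1 0 j) by rewrite mxE.
  pose S (k : C) u v A : C := k * (u 0 A * v 0 A).
  have SE (k : C) u v : \sum_A S k u v A = k * bdot u v by rewrite -mulr_sumr.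
  transitivity (\sum_A (S (half * half * E a) (cjV F1) (EV (cjV F1)) A
    + S (half * half * E a) F1 (EbV (cjV F1)) A
    + S (half * half * Eb a) (cjV F1) (EV F1) A + S (half * half * Eb a) F1 (EbV F1) A
    + S (half * half * E (E a)) (cjV F1) (cjV F1) A
    + S (half * half * (E (Eb a) + Eb (E a))) F1 (cjV F1) A
    + S (half * half * Eb (Eb a)) F1 F1 A)); last by rewrite !big_split /= !SE; ring.
  apply: eq_bigr => A _.
  rewrite /tang /S ee eeb ec ecb !EM !EbM Ehalf Ebh !ED !EbD !EM !EbM /=.
  move: (E (F1 0 A)) (Eb (F1 0 A)) (E (cjV F1 0 A)) (Eb (cjV F1 0 A)) => g1 g2 g3 g4.
  by move: (cjV F1 0 A) (F1 0 A) => f g; ring.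
rewrite e1 e2 e3 e4 F11 F1c1 -cj_dot F11 rmorph0 /lap.
have -> : E (Eb a) = Eb (E a) + (kap * Eb a - cj kap * E a) by rewrite -Ecomm; ring.
move: (Eb (E a)) => z.
have -> : half * half * (E a * (0 - 2 * cj kap) + Eb a * (- (2 * kap) + 0) + E (E a) * 0 +
   (z + (kap * Eb a - cj kap * E a) + z) * 2 + Eb (Eb a) * 0) =
   (2 * half) * (2 * half) * (z - cj kap * E a) by ring.
by rewrite halfE !mul1r.
Qed.

Lemma sum_tang_sqr a : \sum_A (tang A a) ^+ 2 = E a * Eb a.
Proof. exact: sum_half_sqr. Qed.

Lemma lap_X j : lap (X 0 j) = 2 * (H 0 j - X 0 j).
Proof.
have := congr1 (fun u : 'rV[C]_n => u 0 j) DbF1.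
by rewrite !mxE lapE /Db.
Qed.

(** The matrix of the orthogonal projection of the ambient space onto the tangent plane ([P_E]). Its
    derivatives carry the second fundamental form. *)
Let P A j := tang A (X 0 j).

Lemma P_E A j : P A j = half * (cjV F1 0 A * F1 0 j + F1 0 A * cjV F1 0 j).
Proof.
rewrite /P /tang; congr (half * (_ * _ + _ * _)); first by rewrite [RHS]mxE.
have Xj : cj (X 0 j) = X 0 j by rewrite -{2}Xreal mxE.
by rewrite [RHS]mxE [in RHS]mxE cjE Xj.
Qed.

Lemma E_P A j : E (P A j) =
  half * (2 * (H 0 A - X 0 A) * F1 0 j + cjV F1 0 A * F2 0 j +
          F2 0 A * cjV F1 0 j + F1 0 A * (2 * (H 0 j - X 0 j))).
Proof.
have c (k : 'I_n) : E (cjV F1 0 k) = 2 * (H 0 k - X 0 k) + kap * cjV F1 0 k.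
  have := congr1 (fun u : 'rV[C]_n => u 0 k) cjV_DbF1.
  rewrite !mxE rmorphB !rmorphM cjEb cjn cjK => /eqP; rewrite subr_eq => /eqP ->.
  by rewrite mul1r.
have f (k : 'I_n) : E (F1 0 k) = F2 0 k - kap * F1 0 k.
  by rewrite /F2 DVj mul1r addrK.
rewrite P_E EM Ehalf mul0r add0r ED !EM !c !f.
by move: (cjV F1 0 A) (cjV F1 0 j) (F1 0 A) (F1 0 j) (F2 0 A) (F2 0 j) => *; ring.
Qed.

Lemma Eb_P A j : Eb (P A j) = cj (E (P A j)).
Proof.
rewrite cjE; congr Eb; rewrite P_E rmorphM rmorphD !rmorphM cjhalf.
have c (k : 'I_n) : cj (cjV F1 0 k) = F1 0 k by rewrite mxE cjK.
have d (k : 'I_n) : cj (F1 0 k) = cjV F1 0 k by rewrite [RHS]mxE.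
by rewrite !c !d; congr (_ * _); rewrite addrC.
Qed.

Lemma dot_Y_self : bdot (2 *: (H - X)) (2 *: (H - X)) = 4 * (1 + h2).
Proof.
rewrite dotZl dotZr dotDl dotNl !dotDr !dotNr (dotC X H) HX XX -/h2; ring.
Qed.

(** The left side makes sense without a frame, so this is what turns |F2|^2 into a function on the
    whole surface. *)
Lemma sum_sqr_hess : \sum_A \sum_B \sum_j (tang A (P B j)) ^+ 2 = 4 * (1 + h2) + a2.
Proof.
rewrite exchange_big /=; under eq_bigr do rewrite exchange_big /=.
under eq_bigr do under eq_bigr do rewrite sum_tang_sqr Eb_P E_P.
set Y := 2 *: (H - X).
have Yj (k : 'I_n) : 2 * (H 0 k - X 0 k) = Y 0 k by rewrite !mxE.
have cY (k : 'I_n) : cj (Y 0 k) = Y 0 k.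
  have e : cjV Y = Y by rewrite /Y cjVZ cjVD cjVN Hreal Xreal cjn.
  by rewrite -{2}e [RHS]mxE.
have cF (k : 'I_n) : cj (F1 0 k) = cjV F1 0 k by rewrite [RHS]mxE.
have ccF (k : 'I_n) : cj (cjV F1 0 k) = F1 0 k by rewrite mxE cjK.
have cF2 (k : 'I_n) : cj (F2 0 k) = cjV F2 0 k by rewrite [RHS]mxE.
have YF : bdot Y F1 = 0 by rewrite dotZl dotDl dotNl HF1 pmc_XF1 subr0 mulr0.
have YcF : bdot Y (cjV F1) = 0 by rewrite dotZl dotDl dotNl pmc_HcF1 pmc_XcF1 subr0 mulr0.
have cF11 : bdot (cjV F1) (cjV F1) = 0 by rewrite -cj_dot F11 rmorph0.
have cF2c1 : bdot F1 (cjV F2) = 0.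
  by have := congr1 cj pmc_F2c1; rewrite cj_dot cjVK dotC rmorph0.
have cF2F1 : bdot (cjV F1) (cjV F2) = 0 by rewrite dotC -cj_dot pmc_F2F1 rmorph0.
under eq_bigr do under eq_bigr do rewrite !Yj !rmorphM !rmorphD !rmorphM !cY !cF !ccF !cF2 cjhalf.
have -> : \sum_B \sum_j half * (Y 0 B * F1 0 j + cjV F1 0 B * F2 0 j + F2 0 B * cjV F1 0 j + F1 0 B * Y 0 j)
    * (half * (Y 0 B * cjV F1 0 j + F1 0 B * cjV F2 0 j + cjV F2 0 B * F1 0 j + cjV F1 0 B * Y 0 j)) =
   half * half * \sum_B \sum_j (Y 0 B * F1 0 j + cjV F1 0 B * F2 0 j + F2 0 B * cjV F1 0 j + F1 0 B * Y 0 j)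
    * (Y 0 B * cjV F1 0 j + F1 0 B * cjV F2 0 j + cjV F2 0 B * F1 0 j + cjV F1 0 B * Y 0 j).
  rewrite mulr_sumr; apply: eq_bigr => B _; rewrite mulr_sumr; apply: eq_bigr => j _.
  by move: (F1 0 B) (F2 0 B) (F1 0 j) (F2 0 j) => *; ring.
rewrite dot_four (dotC (cjV F1) Y) (dotC F1 Y) (dotC (cjV F1) F1) YF YcF cF11 F11 F1c1 cF2c1 cF2F1.
rewrite pmc_F2F1 ?pmc_F2c1 -/a2 dot_Y_self.
transitivity ((2 * half) * (2 * half) * (4 * (1 + h2) + a2)); last by rewrite halfE !mul1r.
ring.
Qed.

(** The form [q] depends on the frame through a phase, but its modulus does not; this recovers the
    modulus from frame-free derivatives. *)
Lemma sum_sqr_shape :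
  \sum_A \sum_B (\sum_j H 0 j * tang A (P B j)) ^+ 2 = half * (q * cj q) + 2 * (h2 * h2).
Proof.
pose N B := \sum_j H 0 j * E (P B j).
have cH (k : 'I_n) : cj (H 0 k) = H 0 k by rewrite -{2}Hreal mxE.
have NE B : N B = half * (q * cjV F1 0 B + 2 * h2 * F1 0 B).
  have -> : N B = half * ((2 * (H 0 B - X 0 B)) * bdot H F1 + cjV F1 0 B * bdot H F2
     + F2 0 B * bdot H (cjV F1) + F1 0 B * bdot H (2 *: (H - X))).
    rewrite /bdot !mulr_sumr -!big_split mulr_sumr; apply: eq_bigr => j _ /=.
    have -> : (2 *: (H - X)) 0 j = 2 * (H 0 j - X 0 j) by rewrite !mxE.
    by rewrite E_P; move: (F1 0 B) (F2 0 B) (F1 0 j) (F2 0 j) => *; ring.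
  rewrite HF1 pmc_HcF1 dotZr dotDr dotNr HX -/q -/h2; ring.
have tE A B : \sum_j H 0 j * tang A (P B j) = half * (cjV F1 0 A * N B + F1 0 A * cj (N B)).
  rewrite /N rmorph_sum !mulr_sumr -big_split mulr_sumr; apply: eq_bigr => j _ /=.
  by rewrite /tang Eb_P rmorphM cH; move: (F1 0 A) (cj (E _)) => *; ring.
rewrite exchange_big /=; under eq_bigr do under eq_bigr do rewrite tE.
under eq_bigr do rewrite (sum_half_sqr _ _ F11 F1c1).
have cF (k : 'I_n) : cj (F1 0 k) = cjV F1 0 k by rewrite [RHS]mxE.
have ccF (k : 'I_n) : cj (cjV F1 0 k) = F1 0 k by rewrite mxE cjK.
have ch2 : cj h2 = h2 by rewrite cj_dot Hreal.
have -> : \sum_i N i * cj (N i) = half * half * (q * cj q * bdot F1 (cjV F1)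
   + 4 * h2 * h2 * bdot F1 (cjV F1) + 2 * h2 * q * bdot (cjV F1) (cjV F1) + 2 * h2 * cj q * bdot F1 F1).
  pose S (k : C) u v j : C := k * (u 0 j * v 0 j).
  have SE (k : C) u v : \sum_j S k u v j = k * bdot u v by rewrite -mulr_sumr.
  transitivity (\sum_j (S (half * half * q * cj q) F1 (cjV F1) j
    + S (half * half * 4 * h2 * h2) F1 (cjV F1) j
    + S (half * half * 2 * h2 * q) (cjV F1) (cjV F1) j
    + S (half * half * 2 * h2 * cj q) F1 F1 j)); last by rewrite !big_split /= !SE; ring.
  apply: eq_bigr => j _; rewrite /S NE !rmorphM rmorphD !rmorphM cF ccF cjhalf ch2 cjn.
  by move: (F1 0 j) (cjV F1 0 j) => *; ring.
rewrite -cj_dot F11 rmorph0 F1c1.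
transitivity ((2 * half) * (half * (q * cj q) + (2 * half) * (2 * (h2 * h2)))); first ring.
by rewrite halfE !mul1r.
Qed.

Hypothesis parallel : EV H = bdot (EV H) X *: X + (half * bdot (EV H) (cjV F1)) *: F1
  + (half * bdot (EV H) F1) *: cjV F1.

Lemma DV0 u : DV 0 u = EV u.
Proof. by rewrite /DV mul0r scale0r addr0. Qed.

Lemma EV_H : EV H = - (h2 *: F1) - (half * q) *: cjV F1.
Proof.
have e1 : bdot (EV H) X = 0.
  have := E_dot H X; rewrite HX E0 -/F1 HF1 addr0 => <-.
  by [].
have e2 : bdot (EV H) (cjV F1) = - (2 * h2).
  have := D_dotcj 0 1 H F1; rewrite pmc_HcF1 E0 mulr0 addr0 DV0 cjV_DbF1 dotZr dotDr dotNr HX.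
  by rewrite subr0 -/h2 => /eqP; rewrite addr_eq0 => /eqP.
have e3 : bdot (EV H) F1 = - q.
  have := D_dot 0 1 H F1; rewrite HF1 E0 mulr0 addr0 DV0 -/F2 -/q => /eqP.
  by rewrite addr_eq0 => /eqP.
rewrite parallel e1 e2 e3 scale0r add0r.
have -> : half * - (2 * h2) = - ((2 * half) * h2) by ring.
by rewrite halfE mul1r mulrN !scaleNr.
Qed.

Lemma E_h2 : E h2 = 0.
Proof.
rewrite /h2 E_dot (dotC H) EV_H dotBl dotNl !dotZl !(dotC _ H) HF1 pmc_HcF1.
by rewrite !mulr0 !oppr0 !addr0.
Qed.

Lemma pmc_DbF2 : DbV 2 F2 = 2 *: (EV H - F1) + curv *: F1.
Proof.
rewrite comm_D DbF1 mul1r; congr (_ + _); rewrite DV0 EVZ En scale0r add0r.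
by congr (_ *: _); rewrite EVD EVN.
Qed.

(** The Gauss equation: [F2] is orthogonal to [cjV F1], and differentiating this relation along [Eb]
    brings in the curvature through the Ricci identity for [F1]. *)
Lemma pmc_curv : 2 * curv = 4 * (1 + h2) - a2.
Proof.
have := Db_dotcj 2 1 F2 F1; rewrite pmc_F2c1 (_ : Eb 0 = 0); last exact: (Ebn 0).
rewrite mulr0 subr0 -/F2 -/a2 pmc_DbF2 EV_H dotDl !dotZl !dotDl !dotNl !dotZl F1c1.
rewrite -cj_dot F11 rmorph0 => e.
by apply/eqP; rewrite -subr_eq0; apply/eqP; rewrite -[RHS]e; ring.
Qed.

(** Both [DbV 0 H] and [DbV 2 F2] are tangential because H is parallel, while [F2] and [H] are
    normal: [q] is a holomorphic quadratic differential. *)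
Lemma Db_q : Db 2 q = 0.
Proof.
have := Db_dot 0 2 H F2; rewrite -/q => e.
have -> : Db 2 q = Eb q - (0%:R + 2%:R) * cj kap * q by rewrite /Db add0r.
rewrite -e.
have -> : DbV 0 H = cjV (EV H).
  by rewrite cjV_EV Hreal /DbV mul0r scale0r subr0.
rewrite EV_H cjVD !cjVN !cjVZ cjVK dotDl !dotNl !dotZl (dotC _ F2) (dotC F1 F2).
rewrite pmc_F2c1 pmc_F2F1 pmc_DbF2 EV_H dotDr !dotZr !dotDr !dotNr !dotZr HF1 pmc_HcF1; ring.
Qed.

Lemma lap_q : lap (q * cj q) = D 2 q * cj (D 2 q) + 2 * curv * (q * cj q).
Proof.
have e1 : Eb q = 2 * cj kap * q.
  by move/eqP: Db_q; rewrite subr_eq0 => /eqP.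
have e2 : E (cj q) = 2 * kap * cj q.
  by have := congr1 cj e1; rewrite cjEb !rmorphM cjK cjn.
have e3 : E (q * cj q) = D 2 q * cj q by rewrite EM e2 /D; ring.
rewrite lapE e3.
have -> : Db 1 (D 2 q * cj q) = Db 3 (D 2 q) * cj q + D 2 q * (Eb (cj q) + 2 * cj kap * cj q).
  by rewrite /Db EbM; ring.
rewrite comm_Ds Db_q.
have -> : D 1 0 = 0 by rewrite /D E0 mulr0 addr0.
by rewrite /D rmorphD cjE !rmorphM cjn; ring.
Qed.

(** The term with [q] is the trace-free part of the shape operator in direction H; without it X - H
    is homothetic to X along the surface. *)
Lemma EV_center : q = 0 -> EV (X - H) = (1 + h2) *: F1.
Proof.
move=> q0; rewrite EVD EVN EV_H q0 mulr0 scale0r subr0 opprK.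
by rewrite scalerDl scale1r.
Qed.

End ParallelMeanCurvature.

(** * Minimal surfaces: Laplacian identities for rho, r and Q *)

Section Minimal.
Variables (X : 'rV[C]_n) (nu : C).
Let F1 := EV X.
Let F2 := DV 1 F1.
Let a2 := bdot F2 (cjV F2).
Hypothesis Xreal : cjV X = X.
Hypothesis F11 : bdot F1 F1 = 0.
Hypothesis F1c1 : bdot F1 (cjV F1) = 2.
Hypothesis DbF1 : DbV 1 F1 = (-2) *: X.
Hypothesis nuE : nu * a2 = 1.

(** Here [nu] = 1 / |F2|^2 and [sig] is the logarithmic derivative of |F2|^2, so E nu = - sig nu.
    Hence nu G3, nu w4 and nu v5 are the first three (1,0) derivatives of nu F2, and each new
    identity below comes from one more use of the Ricci identity. *)
Variables (rho sig rr QQ : C) (G3 w4 v5 : 'rV[C]_n).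
Hypothesis rhoE : rho = half * a2.
Hypothesis sigE : sig = nu * E a2.
Hypothesis G3E : G3 = DV 2 F2 - sig *: F2.
Hypothesis rrE : rr = nu * bdot G3 (cjV G3).
Hypothesis w4E : w4 = DV 3 G3 - sig *: G3.
Hypothesis QQE : QQ = nu * bdot w4 (cjV w4).
Hypothesis v5E : v5 = DV 4 w4 - sig *: w4.

Lemma XF1 : bdot X F1 = 0.
Proof.
have := Db_dot 1 1 F1 F1; rewrite F11 (_ : Eb 0 = 0); last exact: (Ebn 0).
rewrite mulr0 subr0 DbF1 dotZl dotZr (dotC F1) => H.
by apply/half_inj/half_inj; rewrite -[RHS]oppr0 -H; ring.
Qed.

Lemma F2c1 : bdot F2 (cjV F1) = 0.
Proof.
have := D_dotcj 1 1 F1 F1; rewrite F1c1 En DbF1 cjVZ Xreal dotZr (dotC F1) XF1.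
by rewrite subrr !mul0r mulr0 !addr0.
Qed.

Lemma DbF2_curv : DbV 2 F2 = (curv - 2) *: F1.
Proof.
rewrite comm_D DbF1 (DVZ 0 0).
have -> : D 0 (-2) = 0 by rewrite /D EN En !mul0r oppr0 addr0.
have -> : DV 0 X = F1 by rewrite /DV mul0r scale0r addr0.
by move: (F1) curv => f c; apply/rowP => j; rewrite !mxE; ring.
Qed.

Lemma curvE : curv = 2 - rho.
Proof.
have := Db_dotcj 2 1 F2 F1; rewrite F2c1 (_ : Eb 0 = 0); last exact: (Ebn 0).
rewrite mulr0 subr0 -/F2 -/a2 DbF2_curv dotZl F1c1 => H.
apply/eqP; rewrite -subr_eq0; apply/eqP/half_inj.
have -> : 2 * (curv - (2 - rho)) = 2 * (curv - 2) + (2 * half) * a2 by rewrite rhoE; ring.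
by rewrite halfE mul1r mulrC.
Qed.

Lemma DbF2 : DbV 2 F2 = - (rho *: F1).
Proof. by rewrite DbF2_curv curvE addrAC subrr add0r scaleNr. Qed.

Lemma cja2 : cj a2 = a2.
Proof. by rewrite cj_dot cjVK dotC. Qed.

Lemma cjnu : cj nu = nu.
Proof.
have H : cj nu * a2 = 1 by rewrite -{1}cja2 -rmorphM nuE rmorph1.
by rewrite -[cj nu]mulr1 -nuE mulrCA H mulr1.
Qed.

Lemma E_a2 : E a2 = sig * a2.
Proof. by rewrite sigE mulrAC nuE mul1r. Qed.

Lemma E_rho : E rho = sig * rho.
Proof. by rewrite rhoE EM Ehalf mul0r add0r E_a2; ring. Qed.

Lemma E_nu : E nu = - (sig * nu).
Proof.
have := congr1 E nuE; rewrite EM E1 E_a2 => H.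
have : nu * (E nu * a2 + nu * (sig * a2)) = 0 by rewrite H mulr0.
have -> : nu * (E nu * a2 + nu * (sig * a2)) = (nu * a2) * (E nu + sig * nu) by ring.
by rewrite nuE mul1r => /eqP; rewrite addr_eq0 => /eqP.
Qed.

Lemma Eb_nu : Eb nu = - (cj sig * nu).
Proof. by rewrite -{1}cjnu -cjE E_nu rmorphN rmorphM cjnu. Qed.

Lemma D2F2 : DV 2 F2 = G3 + sig *: F2.
Proof. by rewrite G3E subrK. Qed.

Lemma D3G3 : DV 3 G3 = w4 + sig *: G3.
Proof. by rewrite w4E subrK. Qed.

Lemma D4w4 : DV 4 w4 = v5 + sig *: w4.
Proof. by rewrite v5E subrK. Qed.

Lemma G3c2 : bdot G3 (cjV F2) = 0.
Proof.
have := D_dotcj 2 2 F2 F2; rewrite -/a2 subrr !mul0r addr0 E_a2 DbF2 cjVN cjVZ.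
rewrite dotNr dotZr F2c1 mulr0 oppr0 addr0 D2F2 dotDl dotZl -/a2.
by move/eqP; rewrite -subr_eq0 addrK => /eqP.
Qed.

Lemma F2X : bdot F2 X = 0.
Proof.
have := D_dot 1 0 F1 X; rewrite (dotC F1 X) XF1 E0 mulr0 addr0 -/F2.
have -> : DV 0 X = F1 by rewrite /DV mul0r scale0r addr0.
by rewrite F11 addr0.
Qed.

Lemma G3c1 : bdot G3 (cjV F1) = 0.
Proof.
have := D_dotcj 2 1 F2 F1; rewrite F2c1 E0 mulr0 addr0 DbF1 cjVZ Xreal dotZr F2X.
by rewrite mulr0 addr0 D2F2 dotDl dotZl F2c1 mulr0 addr0.
Qed.

(** The Ricci identity makes [DbV 3 G3] a multiple of [F2] with [Db 1 sig] in the coefficient;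
    differentiating the orthogonality of [G3] and [F2] identifies that coefficient with - r. Both
    statements come out together. *)
Lemma DbG3 : DbV 3 G3 = - (rr *: F2) /\ Db 1 sig = rr - 3 * rho + 4.
Proof.
have H : DbV 3 G3 = - ((Db 1 sig + 3 * rho - 4) *: F2).
  rewrite G3E DbVD DbVN comm_D DbF2 (DbVZ 1 2) DbF2.
  rewrite DVN (DVZ 0 1) -/F2 curvE.
  rewrite /D E_rho; move: (F1) (F2) (Db 1 sig) => f g s.
  by apply/rowP => j; rewrite !mxE; ring.
have e : Db 1 sig + 3 * rho - 4 = rr.
  have := Db_dotcj 3 2 G3 F2; rewrite G3c2 (_ : Eb 0 = 0); last exact: (Ebn 0).
  rewrite mulr0 subr0 H dotNl dotZl -/a2 D2F2 cjVD cjVZ dotDr dotZr G3c2 mulr0 addr0 => K.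
  by move: K; rewrite addrC => /subr0_eq K; rewrite rrE K [RHS]mulrCA nuE mulr1.
by rewrite H e; split=> //; rewrite -e; ring.
Qed.

Lemma E_rr : E rr = nu * bdot w4 (cjV G3).
Proof.
have [H _] := DbG3.
rewrite rrE EM E_nu; have := D_dotcj 3 3 G3 G3; rewrite subrr !mul0r addr0 => <-.
rewrite H cjVN cjVZ dotNr dotZr G3c2 D3G3 dotDl dotZl.
by move: (bdot w4 _) (bdot G3 _) => *; ring.
Qed.

Lemma w4c2 : bdot w4 (cjV F2) = 0.
Proof.
have := D_dotcj 3 2 G3 F2; rewrite G3c2 E0 mulr0 addr0 DbF2 cjVN cjVZ dotNr dotZr G3c1.
by rewrite mulr0 oppr0 addr0 D3G3 dotDl dotZl G3c2 mulr0 addr0.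
Qed.

Lemma Dbw4 : DbV 4 w4 = (2 - 2 * rr) *: G3 - E rr *: F2.
Proof.
have [H Hs] := DbG3.
rewrite w4E DbVD DbVN comm_D H (DbVZ 1 3) H Hs.
rewrite DVN (DVZ 0 2) D2F2 curvE /D.
move: (G3) (F2) (E rr) rr => g f y r.
by apply/rowP => j; rewrite !mxE; ring.
Qed.

Lemma cjrr : cj rr = rr.
Proof. by rewrite rrE rmorphM cjnu cj_dot cjVK dotC. Qed.

Lemma Eb_rr : Eb rr = cj (E rr).
Proof. by rewrite cjE cjrr. Qed.

Lemma cjErr : cj (E rr) = nu * bdot G3 (cjV w4).
Proof. by rewrite E_rr rmorphM cjnu cj_dot cjVK dotC. Qed.

Lemma F2cG3 : bdot F2 (cjV G3) = 0.
Proof.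
have := congr1 cj G3c2; rewrite cj_dot cjVK dotC rmorph0.
by [].
Qed.

Lemma F2cw4 : bdot F2 (cjV w4) = 0.
Proof.
have := congr1 cj w4c2; rewrite cj_dot cjVK dotC rmorph0.
by [].
Qed.

Lemma lap_rho : rho * lap rho = rho * rho * (rr - 3 * rho + 4) + E rho * Eb rho.
Proof.
have [_ Hs] := DbG3.
rewrite lapE E_rho.
have -> : Db 1 (sig * rho) = Db 1 sig * rho + sig * Eb rho by rewrite /Db EbM; ring.
by rewrite Hs; ring.
Qed.

Lemma lap_rr : lap rr = QQ + 2 * rr * (1 - rr).
Proof.
rewrite lapE {1}E_rr.
have -> : Db 1 (nu * bdot w4 (cjV G3)) = Eb nu * bdot w4 (cjV G3)
    + nu * (Eb (bdot w4 (cjV G3)) - (4%:R - 3%:R) * cj kap * bdot w4 (cjV G3)).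
  by rewrite /Db EbM; ring.
rewrite -Db_dotcj Dbw4 Eb_nu D3G3 cjVD cjVZ dotDl dotNl dotDr !dotZl dotZr F2cG3.
rewrite QQE; move: rrE => ->.
by ring.
Qed.

Lemma E_QQ : E QQ = nu * bdot v5 (cjV w4) + 2 * (1 - rr) * E rr.
Proof.
rewrite QQE EM E_nu; have := D_dotcj 4 4 w4 w4; rewrite subrr !mul0r addr0 => <-.
rewrite Dbw4 cjVD cjVN !cjVZ dotDr dotNr !dotZr w4c2 D4w4 dotDl dotZl.
rewrite rmorphB rmorphM cjn cjrr E_rr.
by ring.
Qed.

Lemma lap_QQ : lap QQ = nu * bdot v5 (cjV v5) + 4 * rr * (1 - rr) * (1 - rr)
  - 5 * (E rr * Eb rr) + (8 - 5 * rr - rho) * QQ.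
Proof.
have [_ Hs] := DbG3.
rewrite lapE E_QQ.
have Ebr1 : Eb (1 - rr) = - Eb rr by rewrite EbD EbN (Ebn 1) add0r.
have -> : Db 1 (nu * bdot v5 (cjV w4) + 2 * (1 - rr) * E rr) =
   Eb nu * bdot v5 (cjV w4)
    + nu * (Eb (bdot v5 (cjV w4)) - (5%:R - 4%:R) * cj kap * bdot v5 (cjV w4))
   - 2 * Eb rr * E rr + 2 * (1 - rr) * lap rr.
  rewrite lapE /Db EbD !EbM Ebr1 Ebn.
  by ring.
rewrite -Db_dotcj lap_rr Eb_nu.
(* The second derivative of r occurs only along [F2], and [w4] is orthogonal to [F2], so it
   disappears from the Laplacian of Q. *)
have Dbv5 : DbV 5 v5 = (6 - 3 * rr - rho) *: w4 - (3 * E rr) *: G3 - D 1 (E rr) *: F2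
    + (sig * E rr - sig * E rr) *: F2.
  rewrite v5E DbVD DbVN comm_D Dbw4 (DbVZ 1 4) Dbw4 Hs.
  rewrite DVD DVN (DVZ 0 3) D3G3 (DVZ 1 2) D2F2 curvE.
  rewrite /D EB EM En; move: (w4) (G3) (F2) (E (E rr)) (E rr) rr => w g f z y r.
  by apply/rowP => j; rewrite !mxE; ring.
rewrite Dbv5 subrr scale0r addr0 D4w4 cjVD cjVZ dotDr !dotDl !dotNl !dotZl dotZr F2cw4.
have -> : nu * ((6 - 3 * rr - rho) * bdot w4 (cjV w4) - 3 * E rr * bdot G3 (cjV w4)
   - D 1 (E rr) * 0 + (bdot v5 (cjV v5) + cj sig * bdot v5 (cjV w4)))
  = (6 - 3 * rr - rho) * QQ - 3 * E rr * Eb rr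
    + nu * bdot v5 (cjV v5) + cj sig * (nu * bdot v5 (cjV w4)).
  rewrite Eb_rr cjErr QQE.
  by ring.
by ring.
Qed.

End Minimal.
End FrameCalculus.

(** * The adapted frame of a chart *)

Section LinearAlgebra.
Variable R : fieldType.

Lemma invmx_right n (A B : 'M[R]_n) : A *m B = 1%:M -> invmx A = B.
Proof.
move=> AB; have [uA _] := mulmx1_unit AB.
by rewrite -[RHS]mul1mx -(mulVmx uA) -mulmxA AB mulmx1.
Qed.

(** The inverse of a Gram matrix is read off from any matrix that orthonormalizes the vectors,
    without cofactors. *)
Lemma invmx_congruence n (A M : 'M[R]_n) : M *m A *m M^T = 1%:M -> invmx A = M^T *m M.
Proof.
rewrite -mulmxA => /mulmx1C H; apply: invmx_right.
by rewrite mulmxA H.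
Qed.

End LinearAlgebra.

Lemma sum2 (V : nmodType) (F : 'I_2 -> V) : \sum_i F i = F 0 + F 1.
Proof. by rewrite big_ord_recl big_ord1; congr (F _ + F _); apply/val_inj. Qed.

Section ChartFrame.
Variables (R : realType) (N : nat) (U : set 'rV[R]_2) (oU : open U).
Variable X : 'rV[R]_2 -> 'rV[R]_N.+1.
Hypothesis sX : smooth_on U X.
Hypothesis X1 : forall x, U x -> enorm (X x) = 1.
Hypothesis Xfree : forall x, U x -> row_free (tangent_frame X x).

Local Notation A := (smfun oU).
Local Notation n := N.+1.

Lemma sXj j : smooth_on U (fun y => X y 0 j).
Proof. exact: smooth_coord. Qed.

Lemma tangent_frameE x i j : U x -> tangent_frame X x i j = partial i (fun y => X y 0 j) x.
Proof. by move=> Ux; rewrite mxE partial_coord //; exact: smooth_derivable sX Ux. Qed.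

Definition gram i k (y : 'rV[R]_2) : R :=
  \sum_j partial i (fun y => X y 0 j) y * partial k (fun y => X y 0 j) y.

Lemma first_formE x i k : U x -> first_form X x i k = gram i k x.
Proof.
by move=> Ux; rewrite mxE; apply: eq_bigr => j _; rewrite [_^T _ _]mxE !tangent_frameE.
Qed.

Lemma smooth_gram i k : smooth_on U (gram i k).
Proof.
by apply: smooth_sum => // j; apply: smoothM => //; apply: smooth_partial; exact: sXj.
Qed.

Lemma gramC i k y : gram i k y = gram k i y.
Proof. by apply: eq_bigr => j _; rewrite mulrC. Qed.

Lemma gram_pos x (p q : R) : U x -> (p != 0) || (q != 0) ->
  0 < p ^+ 2 * gram 0 0 x + 2 * p * q * gram 0 1 x + q ^+ 2 * gram 1 1 x.
Proof.
move=> Ux pq.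
pose T i j := partial i (fun y => X y 0 j) x.
have -> : p ^+ 2 * gram 0 0 x + 2 * p * q * gram 0 1 x + q ^+ 2 * gram 1 1 x =
    \sum_j (p * T 0 j + q * T 1 j) ^+ 2.
  rewrite /gram !mulr_sumr -!big_split; apply: eq_bigr => j _ /=; rewrite -/(T 0 j) -/(T 1 j).
  by move: (T 0 j) (T 1 j) => *; ring.
rewrite lt_neqAle sumr_ge0 ?andbT; last by move=> j _; exact: sqr_ge0.
apply/eqP => /esym/eqP; rewrite psumr_eq0; last by move=> j _; exact: sqr_ge0.
move=> /allP z.
pose v : 'rV[R]_2 := p *: delta_mx 0 0 + q *: delta_mx 0 1.
have v0 : v *m tangent_frame X x = 0.
  have v0 : v 0 0 = p by rewrite !mxE /= mulr1 mulr0 addr0.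
  have v1 : v 0 1 = q by rewrite !mxE /= mulr1 mulr0 add0r.
  apply/rowP => j; rewrite mxE sum2 v0 v1 [RHS]mxE !(tangent_frameE _ _ Ux).
  by have := z j (mem_index_enum j); rewrite sqrf_eq0 => /eqP.
have := Xfree Ux; rewrite -kermx_eq0 => /eqP K.
have : (v <= kermx (tangent_frame X x))%MS by apply/sub_kermxP.
rewrite K submx0 => /eqP v00; move: pq.
have -> : p = v 0 0 by rewrite !mxE /= mulr1 mulr0 addr0.
have -> : q = v 0 1 by rewrite !mxE /= mulr1 mulr0 add0r.
by rewrite v00 !mxE eqxx.
Qed.

Lemma gram00_gt0 x : U x -> 0 < gram 0 0 x.
Proof.
move=> Ux; have := @gram_pos x 1 0 Ux.
by rewrite oner_neq0 expr1n mul1r expr0n !mul0r mulr0 mul0r !addr0; apply.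
Qed.

Definition vol2 y := gram 0 0 y * gram 1 1 y - gram 0 1 y * gram 0 1 y.

Lemma vol2_gt0 x : U x -> 0 < vol2 x.
Proof.
move=> Ux; have g0 := gram00_gt0 Ux.
have := @gram_pos x (- gram 0 1 x) (gram 0 0 x) Ux; rewrite (gt_eqF g0) orbT => /(_ isT).
rewrite /vol2; move: (gram 0 0 x) (gram 0 1 x) (gram 1 1 x) g0 => a b c a0.
have -> : (- b) ^+ 2 * a + 2 * (- b) * a * b + a ^+ 2 * c = a * (a * c - b * b) by ring.
by rewrite pmulr_rgt0.
Qed.

(** Gram-Schmidt on d_0, d_1: e1 = al d_0 and e2 = be (g00 d_1 - g01 d_0), where g00 d_1 - g01 d_0
    has square length g00 (g00 g11 - g01^2). *)
Definition fr_al y := (Num.sqrt (gram 0 0 y))^-1.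
Definition fr_be y := (Num.sqrt (gram 0 0 y * vol2 y))^-1.

Lemma smooth_al : smooth_on U fr_al.
Proof.
apply: smoothV => // [x Ux|]; first by rewrite gt_eqF // sqrtr_gt0 gram00_gt0.
by apply: smooth_sqrt; [exact: oU|exact: gram00_gt0|exact: smooth_gram].
Qed.

Lemma smooth_vol2 : smooth_on U vol2.
Proof.
apply: smoothD => //; first by apply: smoothM => //; exact: smooth_gram.
by apply: smoothN => //; apply: smoothM => //; exact: smooth_gram.
Qed.

Lemma smooth_be : smooth_on U fr_be.
Proof.
have p x : U x -> 0 < gram 0 0 x * vol2 x.
  by move=> Ux; rewrite mulr_gt0 ?gram00_gt0 ?vol2_gt0.
apply: smoothV => // [x Ux|]; first by rewrite gt_eqF // sqrtr_gt0 p.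
by apply: smooth_sqrt => //; apply: smoothM => //; [exact: smooth_gram|exact: smooth_vol2].
Qed.

Lemma alE x : U x -> fr_al x * fr_al x * gram 0 0 x = 1.
Proof.
move=> Ux; have g0 := gram00_gt0 Ux.
rewrite /fr_al -invfM -expr2 sqr_sqrtr ?ltW // mulVf // gt_eqF //.
Qed.

Lemma beE x : U x -> fr_be x * fr_be x * (gram 0 0 x * vol2 x) = 1.
Proof.
move=> Ux; have g0 : 0 < gram 0 0 x * vol2 x by rewrite mulr_gt0 ?gram00_gt0 ?vol2_gt0.
by rewrite /fr_be -invfM -expr2 sqr_sqrtr ?ltW // mulVf // gt_eqF.
Qed.

Definition fr_G i k : A := sreal oU (smooth_gram i k).
Definition fr_ral : A := sreal oU smooth_al.
Definition fr_rbe : A := sreal oU smooth_be.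
Definition fr_ii : A := scst oU 'i%C.
Definition fr_half : A := scst oU (2^-1).
Definition fr_cj : {rmorphism A -> A} := @sf_cj R U oU.

Local Notation G := fr_G.
Local Notation al := fr_ral.
Local Notation be := fr_rbe.
Local Notation ii := fr_ii.
Local Notation half := fr_half.
Local Notation cj := fr_cj.

Lemma fr_cjK : involutive cj.
Proof. exact: sf_cjK. Qed.

Lemma ring_al : al * al * G 0 0 = 1.
Proof.
by apply: smfun_ext => x Ux; rewrite (smfun1 _ Ux) !smfunM !(srealE _ _ Ux) -!rmorphM (alE Ux).
Qed.

Lemma ring_be : be * be * (G 0 0 * (G 0 0 * G 1 1 - G 0 1 * G 0 1)) = 1.
Proof.
apply: smfun_ext => x Ux; rewrite (smfun1 _ Ux) !smfunM smfunD smfunN !smfunM !(srealE _ _ Ux).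
have := beE Ux; rewrite /vol2; move: (fr_be x) (gram 0 0 x) (gram 1 1 x) (gram 0 1 x).
by move=> b g0 g1 g2 H; rewrite -!rmorphM -rmorphB -!rmorphM H.
Qed.

Lemma ring_ii : ii * ii = -1.
Proof.
apply: smfun_ext => x Ux; rewrite smfunM smfunN (smfun1 _ Ux) !(scstE _ _ Ux).
by rewrite -expr2 sqr_i.
Qed.

Lemma ring_half : 2 * half = 1.
Proof.
apply: smfun_ext => x Ux; rewrite smfunM (smfun1 _ Ux) (scstE _ _ Ux) (smfun_nat _ _ Ux) mulfV // pnatr_eq0.
Qed.

Lemma cj_ii : cj ii = - ii.
Proof.
apply: smfun_ext => x Ux; rewrite smfun_cj smfunN (scstE _ _ Ux).
by apply: complex_ext; rewrite ?(Re_conj, Im_conj, ReN, ImN) /= ?oppr0.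
Qed.

(** Coordinates of e1 - i e2 for the Gram-Schmidt frame. *)
Definition fr_a0 : A := al + ii * be * G 0 1.
Definition fr_a1 : A := - (ii * be * G 0 0).
Definition chart_E (f : A) : A := fr_a0 * sd 0 f + fr_a1 * sd 1 f.
Definition fr_det : A := cj fr_a0 * fr_a1 - fr_a0 * cj fr_a1.
Definition fr_idet : A := half * ii * al * be * G 0 0 * (G 0 0 * G 1 1 - G 0 1 * G 0 1).
(** The coefficient of [Eb] when the commutator of [E] and [Eb] is expanded in [E] and [Eb] by
    Cramer's rule. The coefficient of [E] is then its conjugate up to sign, since the commutator is
    anti-invariant under conjugation. *)
Definition fr_kap : A := fr_idet *
  ((chart_E (cj fr_a0) - Eb cj chart_E fr_a0) * fr_a1 - (chart_E (cj fr_a1) - Eb cj chart_E fr_a1) * fr_a0).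

Lemma fED f g : chart_E (f + g) = chart_E f + chart_E g.
Proof. by rewrite /chart_E !sdD; ring. Qed.

Lemma fEM f g : chart_E (f * g) = chart_E f * g + f * chart_E g.
Proof. by rewrite /chart_E !sdM; ring. Qed.

Lemma cj_a0 : cj fr_a0 = al - ii * be * G 0 1.
Proof.
rewrite /fr_a0 rmorphD !rmorphM cj_ii.
by rewrite /cj /= /al /be /G !cj_sreal; ring.
Qed.

Lemma cj_a1 : cj fr_a1 = ii * be * G 0 0.
Proof.
rewrite /fr_a1 rmorphN !rmorphM cj_ii.
by rewrite /cj /= /al /be /G !cj_sreal; ring.
Qed.

Lemma fr_detE : fr_det * fr_idet = 1.
Proof.
rewrite /fr_det /fr_idet cj_a0 cj_a1 /fr_a0 /fr_a1.
transitivity ((2 * half) * (- (ii * ii)) * (al * al * G 0 0)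
   * (be * be * (G 0 0 * (G 0 0 * G 1 1 - G 0 1 * G 0 1)))); first ring.
by rewrite ring_half ring_ii ring_al ring_be opprK !mul1r.
Qed.

Lemma EbE f : Eb cj chart_E f = cj fr_a0 * sd 0 f + cj fr_a1 * sd 1 f.
Proof.
rewrite /Eb /chart_E rmorphD !rmorphM /= !sd_cj.
by rewrite !(@sf_cjK R U oU).
Qed.

Lemma sd0E f : sd 0 f = fr_idet * (fr_a1 * Eb cj chart_E f - cj fr_a1 * chart_E f).
Proof.
rewrite EbE /chart_E -[LHS]mul1r -fr_detE /fr_det.
by move: (cj fr_a0) (cj fr_a1) (sd 0 f) (sd 1 f) => *; ring.
Qed.

Lemma sd1E f : sd 1 f = fr_idet * (cj fr_a0 * chart_E f - fr_a0 * Eb cj chart_E f).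
Proof.
rewrite EbE /chart_E -[LHS]mul1r -fr_detE /fr_det.
by move: (cj fr_a0) (cj fr_a1) (sd 0 f) (sd 1 f) => *; ring.
Qed.

Lemma cj_idet : cj fr_idet = - fr_idet.
Proof.
have hc : cj half = half.
  apply: smfun_ext => x Ux; rewrite smfun_cj (scstE _ _ Ux).
  by rewrite (_ : 2^-1 = (2^-1 : R)%:C%C) ?conjc_real // fmorphV rmorph_nat.
rewrite /fr_idet !rmorphM rmorphB !rmorphM cj_ii hc.
by rewrite /cj /= /al /be /G !cj_sreal; ring.
Qed.

Lemma fr_comm f : chart_E (Eb cj chart_E f) - Eb cj chart_E (chart_E f) =
  fr_kap * Eb cj chart_E f - cj fr_kap * chart_E f.
Proof.
pose c0 := chart_E (cj fr_a0) - Eb cj chart_E fr_a0.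
pose c1 := chart_E (cj fr_a1) - Eb cj chart_E fr_a1.
have cc a : cj (chart_E (cj a) - Eb cj chart_E a) = - (chart_E (cj a) - Eb cj chart_E a).
  by rewrite rmorphB /Eb fr_cjK; ring.
have L : chart_E (Eb cj chart_E f) - Eb cj chart_E (chart_E f) = c0 * sd 0 f + c1 * sd 1 f.
  rewrite (EbE f) (EbE (chart_E f)) /c0 /c1 (EbE fr_a0) (EbE fr_a1) /chart_E.
  move: (cj fr_a0) (cj fr_a1) fr_a0 fr_a1 => b0 b1 a0 a1.
  rewrite !sdD !sdM (sdC 1 0 f).
  move: (sd 0 (sd 0 f)) (sd 0 (sd 1 f)) (sd 1 (sd 1 f)) (sd 0 f) (sd 1 f) => f00 f01 f11 f0 f1.
  by move: (sd 0 b0) (sd 1 b0) (sd 0 b1) (sd 1 b1) (sd 0 a0) (sd 1 a0) (sd 0 a1) (sd 1 a1) => *; ring.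
rewrite L; have cc0 : cj c0 = - c0 by exact: cc.
have cc1 : cj c1 = - c1 by exact: cc.
have dM u v w y z : cj (u * (v * w - y * z)) = cj u * (cj v * cj w - cj y * cj z).
  by rewrite rmorphM rmorphB rmorphM [cj (y * z)]rmorphM.
have -> : fr_kap = fr_idet * (c0 * fr_a1 - c1 * fr_a0) by [].
rewrite dM cj_idet cc0 cc1 (EbE f) /chart_E.
have e : (c0 * sd 0 f + c1 * sd 1 f) * (fr_det * fr_idet) = c0 * sd 0 f + c1 * sd 1 f.
  by rewrite fr_detE mulr1.
rewrite -[LHS]e /fr_det.
by move: (cj fr_a0) (cj fr_a1) fr_a0 fr_a1 fr_idet (c0) (c1) (sd 0 f) (sd 1 f) => *; ring.
Qed.

Local Notation EVf := (EV chart_E).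
Local Notation EbVf := (EbV cj chart_E).
Local Notation DbVf := (DbV cj chart_E fr_kap).
Local Notation cV := (cjV cj).

Definition XV : 'rV[A]_n := \row_j sreal oU (sXj j).
Definition sdV i (u : 'rV[A]_n) := map_mx (sd i) u.
(** Beltrami's formula Lap X = 2 (H - X) taken as the definition; the agreement with
    [mean_curvature_vector] is [HV_at]. *)
Definition HV : 'rV[A]_n := half *: DbVf 1 (EVf XV) + XV.
Let F1 := EVf XV.

Lemma XV_real : cV XV = XV.
Proof. by apply/rowP => j; rewrite !mxE; exact: cj_sreal. Qed.

Lemma sdVE i j x : U x -> sdV i XV 0 j x = (partial i (fun y => X y 0 j) x)%:C%C.
Proof.
move=> Ux; rewrite 2!mxE (sd_sreal oU (sXj j) (smooth_partial i (sXj j))).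
by rewrite (srealE _ _ Ux).
Qed.

Lemma XX_1 : bdot XV XV = 1.
Proof.
apply: smfun_ext => x Ux; rewrite (smfun1 _ Ux) smfun_sum.
have e : \sum_j X x 0 j * X x 0 j = 1.
  have := X1 Ux; rewrite /enorm /Defs.dot mxE => /(congr1 (fun t => t ^+ 2)).
  rewrite sqr_sqrtr ?expr1n => [<-|]; last first.
    by apply: sumr_ge0 => j _; rewrite mxE -expr2 sqr_ge0.
  by apply: eq_bigr => j _; rewrite mxE.
have -> : \sum_i (XV 0 i * XV 0 i) x = (\sum_j X x 0 j * X x 0 j)%:C%C.
  rewrite rmorph_sum; apply: eq_bigr => j _.
  by rewrite smfunM mxE (srealE _ _ Ux) rmorphM.
by rewrite e.
Qed.

Lemma gram_ring i k : bdot (sdV i XV) (sdV k XV) = G i k.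
Proof.
apply: smfun_ext => x Ux; rewrite smfun_sum (srealE _ _ Ux) /gram rmorph_sum.
by apply: eq_bigr => j _; rewrite smfunM !sdVE // rmorphM.
Qed.

Lemma EV_sdV u : EVf u = fr_a0 *: sdV 0 u + fr_a1 *: sdV 1 u.
Proof. by apply/rowP => j; rewrite !mxE. Qed.

Lemma EbV_sdV u : EbVf u = cj fr_a0 *: sdV 0 u + cj fr_a1 *: sdV 1 u.
Proof. by apply/rowP => j; rewrite !mxE EbE. Qed.

Lemma cj_sdV i u : cV (sdV i u) = sdV i (cV u).
Proof. by apply/rowP => j; rewrite !mxE; exact: esym (sd_cj _ _). Qed.

Lemma cV_F1 : cV F1 = cj fr_a0 *: sdV 0 XV + cj fr_a1 *: sdV 1 XV.
Proof. by rewrite /F1 EV_sdV cjVD !cjVZ !cj_sdV XV_real. Qed.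

Lemma ring_det : be * be * G 0 0 * (G 0 0 * G 1 1 - G 0 1 * G 0 1) = 1.
Proof. by rewrite -mulrA ring_be. Qed.

Lemma fr_F11 : bdot F1 F1 = 0.
Proof.
rewrite /F1 EV_sdV dotDl !dotDr !dotZl !dotZr !gram_ring.
have -> : G 1 0 = G 0 1.
  by apply: smfun_ext => x Ux; rewrite !(srealE _ _ Ux) gramC.
rewrite /fr_a0 /fr_a1.
transitivity (al * al * G 0 0 + (ii * ii) * (be * be * G 0 0 * (G 0 0 * G 1 1 - G 0 1 * G 0 1))).
  ring.
by rewrite ring_al ring_ii ring_det mulN1r subrr.
Qed.

Lemma fr_F1c1 : bdot F1 (cV F1) = 2.
Proof.
rewrite cV_F1 {1}/F1 EV_sdV dotDl !dotDr !dotZl !dotZr !gram_ring cj_a0 cj_a1.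
have -> : G 1 0 = G 0 1.
  by apply: smfun_ext => x Ux; rewrite !(srealE _ _ Ux) gramC.
rewrite /fr_a0 /fr_a1.
transitivity (al * al * G 0 0 - (ii * ii) * (be * be * G 0 0 * (G 0 0 * G 1 1 - G 0 1 * G 0 1))).
  ring.
by rewrite ring_al ring_ii ring_det mulN1r opprK.
Qed.

Lemma fr_DbF1 : DbVf 1 F1 = 2 *: (HV - XV).
Proof. by rewrite /HV addrK scalerA ring_half scale1r. Qed.

(** Conjugation reverses the order of [E] and [Eb] in the second derivative of the real vector X,
    and [fr_comm] accounts exactly for the difference. *)
Lemma HV_real : cV HV = HV.
Proof.
have hc : cj half = half by exact: cjhalf ring_half.
rewrite /HV cjVD cjVZ XV_real hc; congr (_ *: _ + _).
apply/rowP => j; rewrite [LHS]mxE !DbVj mul1r rmorphB rmorphM (fr_cjK fr_kap).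
have -> : EVf XV 0 j = chart_E (XV 0 j) by rewrite mxE.
have cX : cj (XV 0 j) = XV 0 j by rewrite -{2}XV_real [RHS]mxE.
have -> : cj (Eb cj chart_E (chart_E (XV 0 j))) = chart_E (Eb cj chart_E (XV 0 j)).
  by rewrite /Eb fr_cjK cX.
have -> : cj (chart_E (XV 0 j)) = Eb cj chart_E (XV 0 j) by rewrite /Eb cX.
have aux (p q r s : A) : p - q = r - s -> p - r = q - s.
  move=> e; apply/eqP; rewrite -subr_eq0; apply/eqP.
  by transitivity (p - q - (r - s)); [ring|rewrite e subrr].
exact: aux (fr_comm (XV 0 j)).
Qed.

Lemma fr_XF1 : bdot XV F1 = 0.
Proof.
apply: (half_inj ring_half).
have := E_dot fED fEM XV XV; rewrite XX_1 (E1 fEM) -/F1 (dotC F1) => e.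
by rewrite [RHS]e; ring.
Qed.

Lemma fr_HF1 : bdot HV F1 = 0.
Proof.
have e : bdot (DbVf 1 F1) F1 = 0.
  apply: (half_inj ring_half).
  have := Db_dot fr_kap fr_cjK fED fEM 1 1 F1 F1; rewrite fr_F11 (Ebn cj fED fEM 0).
  by rewrite (dotC F1) mulr0 subr0 => h; rewrite -[RHS]h; ring.
by rewrite /HV dotDl dotZl e fr_XF1 mulr0 addr0.
Qed.

Lemma fr_HX : bdot HV XV = 0.
Proof.
have e : bdot XV (DbVf 1 F1) = - 2.
  have := Db_dot fr_kap fr_cjK fED fEM 0 1 XV F1; rewrite fr_XF1 (Ebn cj fED fEM 0).
  have -> : DbVf 0 XV = cV F1.
    by rewrite /F1 cjV_EV ?XV_real; [rewrite /DbV mul0r scale0r subr0|exact: fr_cjK].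
  by rewrite (dotC (cV F1)) fr_F1c1 mulr0 subr0 addrC => /eqP; rewrite addr_eq0 => /eqP.
rewrite /HV dotDl dotZl (dotC _ XV) e XX_1 mulrN (mulrC half) ring_half addNr //.
Qed.

End ChartFrame.

Lemma dot_bdot (R : realType) n (u v : 'rV[R]_n) : dot u v = bdot u v.
Proof. by rewrite /dot mxE; apply: eq_bigr => j _; rewrite mxE. Qed.

Lemma mulmx2E (R : comPzRingType) m p (B : 'M[R]_(m, 2)) (C : 'M[R]_(2, p)) i k :
  (B *m C) i k = B i 0 * C 0 k + B i 1 * C 1 k.
Proof. by rewrite mxE sum2. Qed.

Lemma mul_tr_row (R : comPzRingType) m n (u : 'rV[R]_n) (B : 'M[R]_(m, n)) i :
  (u *m B^T) 0 i = bdot u (row i B).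
Proof. by rewrite mxE; apply: eq_bigr => j _; rewrite !mxE. Qed.

Lemma mul_tr_mul1 (R : comPzRingType) n (u v : 'rV[R]_n) : u *m v^T *m v = bdot u v *: v.
Proof.
apply/rowP => j; rewrite mxE big_ord1 mul_tr_row [RHS]mxE; congr (bdot _ _ * _).
by apply/rowP => k; rewrite mxE.
Qed.

Lemma mul_tr_mul2 (R : comPzRingType) n (u : 'rV[R]_n) (B : 'M[R]_(2, n)) :
  u *m B^T *m B = bdot u (row 0 B) *: row 0 B + bdot u (row 1 B) *: row 1 B.
Proof. by apply/rowP => j; rewrite mulmx2E !mul_tr_row !mxE. Qed.

Section QuadSum.
Variables (R : realType) (n : nat) (e : 'M[R]_2) (B : 'I_2 -> 'I_2 -> 'rV[R]_n).
Hypothesis BC : B 1 0 = B 0 1.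

Definition quad_sum i k := \sum_p \sum_q (e i p * e k q) *: B p q.

Lemma quad_sumE i k : quad_sum i k = (e i 0 * e k 0) *: B 0 0 +
  (e i 0 * e k 1 + e i 1 * e k 0) *: B 0 1 + (e i 1 * e k 1) *: B 1 1.
Proof. by rewrite /quad_sum !sum2 BC scalerDl !addrA. Qed.

Lemma quad_sum_sqr : let g := e^T *m e in
  \sum_(i < 2) \sum_(j < 2) \sum_(k < 2) \sum_(l < 2) g i k * g j l * dot (B i j) (B k l) =
  bdot (quad_sum 0 0) (quad_sum 0 0) + 2 * bdot (quad_sum 0 1) (quad_sum 0 1) +
  bdot (quad_sum 1 1) (quad_sum 1 1).
Proof.
rewrite /= !quad_sumE !sum2 !dot_bdot !mulmx2E ![e^T _ _]mxE BC.
move: (B 0 0) (B 0 1) (B 1 1) => B0 B1 B2.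
rewrite !dotDl !dotDr !dotZl !dotZr (dotC B1 B0) (dotC B2 B0) (dotC B2 B1).
move: (bdot B0 B0) (bdot B0 B1) (bdot B0 B2) (bdot B1 B1) (bdot B1 B2) (bdot B2 B2) => *.
move: (e 0 0) (e 0 1) (e 1 0) (e 1 1) => *; ring.
Qed.

End QuadSum.

(** * Normal projection and second fundamental form in the frame *)

Section NormalBundle.
Variables (R : realType) (N : nat) (U : set 'rV[R]_2) (oU : open U).
Variable X : 'rV[R]_2 -> 'rV[R]_N.+1.
Hypothesis sX : smooth_on U X.
Hypothesis X1 : forall x, U x -> enorm (X x) = 1.
Hypothesis Xfree : forall x, U x -> row_free (tangent_frame X x).

Local Notation A := (smfun oU).
Local Notation n := N.+1.
Local Notation G := (fr_G oU sX).
Local Notation al := (fr_ral oU sX Xfree).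
Local Notation be := (fr_rbe oU sX Xfree).
Local Notation ii := (fr_ii oU).
Local Notation half := (fr_half oU).
Local Notation cj := (fr_cj oU).
Local Notation XV := (XV oU sX).

Lemma XX_sd i : bdot XV (sdV i XV) = 0.
Proof.
have h : 2 * half = 1 by exact: ring_half.
apply: (half_inj h).
have := E_dot (@sdD R U oU i) (@sdM R U oU i) XV XV.
rewrite (XX_1 oU sX X1) (E1 (@sdM R U oU i)) (dotC (EV _ _)) => e.
by rewrite [RHS]e; change (2 * bdot XV (EV (sd i) XV) = bdot XV (EV (sd i) XV) + bdot XV (EV (sd i) XV)); ring.
Qed.

Section Point.
Variables (x : 'rV[R]_2) (Ux : U x).

Let T i := row i (tangent_frame X x).
Let a := fr_al X x.
Let b := fr_be X x.
Let g i k := gram X i k x.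
Definition fr_e : 'M[R]_2 :=
  \matrix_(i, k) if i == 0 then (if k == 0 then a else 0) else (if k == 0 then - (b * g 0 1) else b * g 0 0).

Lemma e00 : fr_e 0 0 = a. Proof. by rewrite mxE. Qed.
Lemma e01 : fr_e 0 1 = 0. Proof. by rewrite mxE. Qed.
Lemma e10 : fr_e 1 0 = - (b * g 0 1). Proof. by rewrite mxE. Qed.
Lemma e11 : fr_e 1 1 = b * g 0 0. Proof. by rewrite mxE. Qed.

Lemma ord2P (P : 'I_2 -> Prop) : P 0 -> P 1 -> forall i, P i.
Proof.
move=> P0 P1 i; case: (unliftP 0 i) => [j ->|-> //].
by rewrite (_ : lift 0 j = 1) //; apply/val_inj; rewrite /= ord1.
Qed.

Lemma fr_e_gram : fr_e *m first_form X x *m fr_e^T = 1%:M.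
Proof.
have gE i k : first_form X x i k = g i k by exact: (first_formE sX).
have aE : a * a * g 0 0 = 1 by exact: (alE sX Xfree Ux).
have bE : b * b * (g 0 0 * (g 0 0 * g 1 1 - g 0 1 * g 0 1)) = 1 by exact: (beE sX Xfree Ux).
have gC : g 1 0 = g 0 1 by exact: gramC.
apply/matrixP; apply: ord2P; apply: ord2P;
  rewrite mulmx2E !(mulmx2E fr_e) ![fr_e^T _ _]mxE [RHS]mxE !gE ?e00 ?e01 ?e10 ?e11 ?gC /=;
  move: a b (g 0 0) (g 0 1) (g 1 1) aE bE => A0 B0 g0 g1 g2 aE bE.
- by rewrite -[RHS]aE; ring.
- ring.
- ring.
- by rewrite -[RHS]bE; ring.
Qed.

Lemma first_form_inv : invmx (first_form X x) = fr_e^T *m fr_e.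
Proof. exact: invmx_congruence fr_e_gram. Qed.

Definition fr_m (i : 'I_2) := row i (fr_e *m tangent_frame X x).

(** The block matrix [M] orthonormalizes X, d_0 X, d_1 X at once, X being already a unit vector
    orthogonal to the other two; the inverse Gram matrix then factors through [M]. *)
Lemma normal_partE u : normal_part X x u =
  u - bdot u (X x) *: X x - bdot u (fr_m 0) *: fr_m 0 - bdot u (fr_m 1) *: fr_m 1.
Proof.
have XT : X x *m (tangent_frame X x)^T = 0.
  apply/rowP => i; rewrite mxE [RHS]mxE.
  have := congr1 (fun f : A => f x) (XX_sd i).
  rewrite smfun_sum; under eq_bigr do rewrite smfunM (sdVE _ _ _ _ Ux) mxE (srealE _ _ Ux) -rmorphM.
  rewrite -rmorph_sum => /(congr1 (@complex.Re R)) /= e.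
  by rewrite -[RHS]e; apply: eq_bigr => j _; rewrite [_^T _ _]mxE (tangent_frameE sX _ _ Ux).
have XX : X x *m (X x)^T = 1%:M.
  apply/matrixP => i j; rewrite !ord1 [RHS]mxE eqxx.
  have := X1 Ux; rewrite /enorm => /(congr1 (fun t => t ^+ 2)).
  rewrite sqr_sqrtr ?expr1n // dot_bdot.
  by apply: sumr_ge0 => k _; rewrite -expr2 sqr_ge0.
pose M : 'M[R]_(1 + 2) := block_mx 1%:M 0 0 fr_e.
pose F : 'M[R]_(1 + 2, n) := col_mx (X x) (tangent_frame X x).
have MF : M *m F = col_mx (X x) (fr_e *m tangent_frame X x).
  by rewrite /M /F mul_block_col !mul0mx mul1mx addr0 add0r.
have H : M *m (F *m F^T) *m M^T = 1%:M.
  rewrite mulmxA -mulmxA -trmx_mul MF tr_col_mx mul_col_row XX !trmx_mul.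
  rewrite mulmxA XT mul0mx -(mulmxA fr_e) -[tangent_frame X x *m (X x)^T]trmxK trmx_mul trmxK XT trmx0 mulmx0.
  rewrite mulmxA -(mulmxA fr_e) fr_e_gram.
  by rewrite -scalar_mx_block.
rewrite /normal_part -/F (invmx_congruence H).
rewrite mulmxA -(mulmxA _ M) MF -(mulmxA u) -trmx_mul MF tr_col_mx mul_mx_row mul_row_col.
rewrite mul_tr_mul1 mul_tr_mul2 !opprD !addrA //.
Qed.

Definition fr_II := quad_sum fr_e (fun p q => second_form X p q x).

Lemma mean_curvatureE : mean_curvature_vector X x = 2^-1 *: (fr_II 0 0 + fr_II 1 1).
Proof.
rewrite /mean_curvature_vector /fr_II /quad_sum first_form_inv -big_split; congr (_ *: _).
apply: eq_bigr => p _; rewrite -big_split; apply: eq_bigr => q _ /=.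
by rewrite -scalerDl mulmx2E ![fr_e^T _ _]mxE.
Qed.

Lemma second_formC i k : second_form X i k x = second_form X k i x.
Proof.
apply: (congr1 (normal_part X x)); apply/rowP => j.
have D l m : partial l (partial m X) x 0 j = partial l (partial m (fun y => X y 0 j)) x.
  rewrite (partial_coord _ (smooth_derivable (smooth_partial m sX) Ux)).
  apply: (partial_ext l oU _ Ux) => y Uy.
  exact: (partial_coord _ (smooth_derivable sX Uy)).
have e := partialC i k oU (smooth_coord j oU sX) Ux.
exact: (etrans (D i k) (etrans e (esym (D k i)))).
Qed.

Lemma fr_IIE i k : fr_II i k = (fr_e i 0 * fr_e k 0) *: second_form X 0 0 x +
  (fr_e i 0 * fr_e k 1 + fr_e i 1 * fr_e k 0) *: second_form X 0 1 x +
  (fr_e i 1 * fr_e k 1) *: second_form X 1 1 x.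
Proof. exact (@quad_sumE R _ fr_e (fun p q => second_form X p q x) (second_formC 1 0) i k). Qed.

Lemma sqnorm_second_formE : sqnorm_second_form X x =
  bdot (fr_II 0 0) (fr_II 0 0) + 2 * bdot (fr_II 0 1) (fr_II 0 1) + bdot (fr_II 1 1) (fr_II 1 1).
Proof. by rewrite /sqnorm_second_form first_form_inv; exact (@quad_sum_sqr R _ fr_e (fun p q => second_form X p q x) (second_formC 1 0)). Qed.

End Point.

Local Notation fE := (chart_E (oU:=oU) sX Xfree).
Local Notation kap := (fr_kap oU sX Xfree).
Local Notation a0 := (fr_a0 oU sX Xfree).
Local Notation a1 := (fr_a1 oU sX Xfree).
Local Notation F1 := (EV fE XV).
Local Notation F2 := (DV fE kap 1 F1).
Local Notation HV := (HV oU sX Xfree).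
Local Notation cV := (cjV cj).

Definition e1V := al *: sdV 0 XV.
Definition e2V := (- (be * G 0 1)) *: sdV 0 XV + (be * G 0 0) *: sdV 1 XV.

Lemma F1_e : F1 = e1V - ii *: e2V.
Proof.
rewrite EV_sdV; apply/rowP => j; rewrite !mxE /fr_a0 /fr_a1.
by move: (sd 0 _) (sd 1 _) => *; ring.
Qed.

Lemma cV_F1_e : cV F1 = e1V + ii *: e2V.
Proof.
rewrite (cV_F1 oU sX Xfree) cj_a0 cj_a1; apply/rowP => j; rewrite !mxE.
by move: (sd 0 _) (sd 1 _) => *; ring.
Qed.

(** The tangent plane is spanned by the isotropic pair [F1], [cV F1] with mutual product 2, so each
    component is read against the conjugate vector and halved. *)
Definition PN u := u - bdot u XV *: XV - (half * bdot u (cV F1)) *: F1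
  - (half * bdot u F1) *: cV F1.

Lemma PND u v : PN (u + v) = PN u + PN v.
Proof.
rewrite /PN !dotDl; move: (bdot u _) (bdot v _) (bdot u _) (bdot v _) (bdot u _) (bdot v _) => *.
by move: (cV F1) F1 XV => *; apply/rowP => j; rewrite !mxE; ring.
Qed.

Lemma PNZ c u : PN (c *: u) = c *: PN u.
Proof.
rewrite /PN !dotZl; move: (bdot u _) (bdot u _) (bdot u _) => *.
by move: (cV F1) F1 XV => *; apply/rowP => j; rewrite !mxE; ring.
Qed.

Lemma PN_fix u : bdot u XV = 0 -> bdot u F1 = 0 -> bdot u (cV F1) = 0 -> PN u = u.
Proof. by rewrite /PN => -> -> ->; rewrite !mulr0 !scale0r !subr0. Qed.

Let F11 : bdot F1 F1 = 0 := fr_F11 oU sX Xfree.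
Let F1c1 : bdot F1 (cV F1) = 2 := fr_F1c1 oU sX Xfree.
Let XF1 : bdot XV F1 = 0 := fr_XF1 oU sX X1 Xfree.

Lemma fr_XcF1 : bdot XV (cV F1) = 0.
Proof.
have := congr1 cj XF1; rewrite cj_dot rmorph0 => <-.
by rewrite (XV_real oU sX).
Qed.

Lemma fr_cF11 : bdot (cV F1) (cV F1) = 0.
Proof. by rewrite -cj_dot F11 rmorph0. Qed.

Lemma PN_X : PN XV = 0.
Proof.
rewrite /PN (XX_1 oU sX X1) XF1 fr_XcF1.
by rewrite !mulr0 !scale0r !subr0 scale1r subrr.
Qed.

Lemma PN_F1 : PN F1 = 0.
Proof.
rewrite /PN F11 F1c1 (dotC F1 XV) XF1.
by rewrite !mulr0 !scale0r !subr0 mulrC (ring_half oU) scale1r subrr.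
Qed.

Lemma PN_cF1 : PN (cV F1) = 0.
Proof.
rewrite /PN fr_cF11 (dotC (cV F1) F1) F1c1 (dotC (cV F1) XV) fr_XcF1.
by rewrite !mulr0 !scale0r !subr0 mulrC (ring_half oU) scale1r subrr.
Qed.

Lemma PN_sd i : PN (sdV i XV) = 0.
Proof.
have cFj j : cV F1 0 j = Eb cj fE (XV 0 j).
  by rewrite [LHS]mxE [F1 0 j]mxE /Eb -[in RHS](XV_real oU sX) [cV XV 0 j]mxE (@fr_cjK _ _ oU).
have [p [q ->]] : exists p q, sdV i XV = p *: F1 + q *: cV F1.
  move: i; apply: ord2P.
    exists (- (fr_idet oU sX Xfree * cj a1)), (fr_idet oU sX Xfree * a1).
    apply/rowP => j; rewrite mxE (sd0E sX Xfree) [RHS]mxE [(_ *: F1) _ _]mxE [F1 0 j]mxE [(_ *: cV _) _ _]mxE cFj.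
    by move: (fE (XV 0 j)) (Eb cj fE (XV 0 j)) => *; ring.
  exists ((fr_idet oU sX Xfree * cj a0)), (- (fr_idet oU sX Xfree * a0)).
  apply/rowP => j; rewrite mxE (sd1E sX Xfree) [RHS]mxE [(_ *: F1) _ _]mxE [F1 0 j]mxE [(_ *: cV _) _ _]mxE cFj.
  by move: (fE (XV 0 j)) (Eb cj fE (XV 0 j)) => *; ring.
by rewrite PND !PNZ PN_F1 PN_cF1 !scaler0 addr0.
Qed.

Definition NV i k := PN (sdV i (sdV k XV)).

Lemma sdVD i u v : sdV i (u + v) = sdV i u + sdV i v :> 'rV[A]_n.
Proof. by apply/rowP => j; rewrite !mxE sdD. Qed.

Lemma sdVZ i c u : sdV i (c *: u) = sd i c *: u + c *: sdV i u :> 'rV[A]_n.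
Proof. by apply/rowP => j; rewrite !mxE sdM. Qed.

Lemma NVC : NV 1 0 = NV 0 1.
Proof. by congr PN; apply/rowP => j; rewrite !mxE sdC. Qed.

Lemma PN_sdF1 i : PN (sdV i F1) = a0 *: NV i 0 + a1 *: NV i 1.
Proof.
rewrite EV_sdV sdVD 2!sdVZ 3!PND 4!PNZ -/(NV i 0) -/(NV i 1).
have := PN_sd 0; have := PN_sd 1; move: (PN (sdV 0 XV)) (PN (sdV 1 XV)) (NV i 0) (NV i 1) => p q N0 N1 -> ->.
by rewrite !scaler0 !add0r.
Qed.

Let HX : bdot HV XV = 0 := fr_HX oU sX X1 Xfree.
Let HF1 : bdot HV F1 = 0 := fr_HF1 oU sX X1 Xfree.
Let cjK : involutive cj := @fr_cjK _ _ oU.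
Let ED := fED sX Xfree (oU := oU).
Let EM := fEM sX Xfree (oU := oU).
Let halfE : 2 * half = 1 := ring_half oU.
Let Xreal := XV_real oU sX.
Let Hreal := HV_real oU sX Xfree.
Let XX := XX_1 oU sX X1.
Let DbF1 := fr_DbF1 oU sX Xfree.

(** [F2] is normal already, so projecting it changes nothing, but the projection kills every term in
    which a frame coefficient is differentiated. *)
Lemma F2_NV : F2 = (a0 * a0) *: NV 0 0 + (2 * a0 * a1) *: NV 0 1 + (a1 * a1) *: NV 1 1.
Proof.
rewrite -[LHS]PN_fix; last first.
- exact: (pmc_F2c1 cjK ED EM halfE Xreal Hreal XX F1c1 DbF1 HF1).
- exact: (pmc_F2F1 kap ED EM halfE F11).
- exact: (pmc_F2X kap ED EM halfE XX F11).
rewrite /DV PND PNZ PN_F1 scaler0 addr0 [EV fE F1]EV_sdV PND 2!PNZ 2!PN_sdF1 NVC.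
move: (NV 0 0) (NV 0 1) (NV 1 1) => N0 N1 N2; apply/rowP => j; rewrite !mxE.
by move: a0 a1 (N0 0 j) (N1 0 j) (N2 0 j) => *; ring.
Qed.

Lemma fr_HcF1 : bdot HV (cV F1) = 0.
Proof. by have := congr1 cj HF1; rewrite cj_dot rmorph0 Hreal. Qed.

Lemma HV_NV : HV = half *: ((cj a0 * a0) *: NV 0 0 + (cj a0 * a1 + cj a1 * a0) *: NV 0 1
  + (cj a1 * a1) *: NV 1 1).
Proof.
rewrite -[LHS](PN_fix HX HF1 fr_HcF1) /HV PND PN_X addr0 PNZ; congr (_ *: _).
rewrite /DbV -scaleNr PND PNZ PN_F1 scaler0 addr0 [EbV cj fE F1]EbV_sdV PND 2!PNZ 2!PN_sdF1 NVC.
move: (NV 0 0) (NV 0 1) (NV 1 1) => N0 N1 N2; apply/rowP => j; rewrite !mxE.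
by move: (cj a0) (cj a1) a0 a1 (N0 0 j) (N1 0 j) (N2 0 j) => *; ring.
Qed.

Definition IIV00 := (al * al) *: NV 0 0.
Definition IIV01 := (- (al * be * G 0 1)) *: NV 0 0 + (al * be * G 0 0) *: NV 0 1.
Definition IIV11 := (be * be * (G 0 1 * G 0 1)) *: NV 0 0 +
  (- (be * be * (2 * G 0 1 * G 0 0))) *: NV 0 1 + (be * be * (G 0 0 * G 0 0)) *: NV 1 1.

Lemma F2_II : F2 = IIV00 - IIV11 - (2 * ii) *: IIV01.
Proof.
rewrite F2_NV /IIV00 /IIV01 /IIV11 /fr_a0 /fr_a1.
have i2 : ii * ii = -1 := ring_ii oU.
move: (NV 0 0) (NV 0 1) (NV 1 1) => N0 N1 N2; apply/rowP => j; rewrite !mxE.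
move: ii i2 al be (G 0 0) (G 0 1) (N0 0 j) (N1 0 j) (N2 0 j) => i i2 a b g0 g1 n0 n1 n2.
transitivity (a * a * n0 + 2 * i * a * b * g1 * n0 - 2 * i * a * b * g0 * n1
   + (i * i) * (b * b * (g1 * g1 * n0 - 2 * g1 * g0 * n1 + g0 * g0 * n2))); first ring.
by rewrite i2; ring.
Qed.

Lemma HV_II : HV = half *: (IIV00 + IIV11).
Proof.
rewrite HV_NV cj_a0 cj_a1 /IIV00 /IIV01 /IIV11 /fr_a0 /fr_a1; congr (_ *: _).
have i2 : ii * ii = -1 := ring_ii oU.
move: (NV 0 0) (NV 0 1) (NV 1 1) => N0 N1 N2; apply/rowP => j; rewrite !mxE.
move: ii i2 al be (G 0 0) (G 0 1) (N0 0 j) (N1 0 j) (N2 0 j) => i i2 a b g0 g1 n0 n1 n2.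
transitivity (a * a * n0 
   - (i * i) * (b * b * (g1 * g1 * n0 - 2 * g1 * g0 * n1 + g0 * g0 * n2))); first ring.
by rewrite i2; ring.
Qed.

Definition real_at x (u : 'rV[A]_n) (w : 'rV[R]_n) := forall j, u 0 j x = (w 0 j)%:C%C.

Lemma real_atD x u w u' w' : real_at x u w -> real_at x u' w' -> real_at x (u + u') (w + w').
Proof. by move=> h h' j; rewrite !mxE smfunD h h' rmorphD. Qed.

Lemma real_atZ x (c : A) r u w : c x = r%:C%C -> real_at x u w -> real_at x (c *: u) (r *: w).
Proof. by move=> h h' j; rewrite !mxE smfunM h h' rmorphM. Qed.

Lemma real_atN x u w : real_at x u w -> real_at x (- u) (- w).
Proof. by move=> h j; rewrite !mxE smfunN h rmorphN. Qed.

Lemma real_at_dot x u w u' w' : real_at x u w -> real_at x u' w' ->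
  bdot u u' x = (bdot w w')%:C%C.
Proof.
move=> h h'; rewrite smfun_sum rmorph_sum; apply: eq_bigr => j _.
by rewrite smfunM h h' rmorphM.
Qed.

Lemma PN_e u : PN u = u - bdot u XV *: XV - bdot u e1V *: e1V - bdot u e2V *: e2V.
Proof.
rewrite /PN cV_F1_e F1_e; move: e1V e2V (u - bdot u XV *: XV) => n1 n2 w.
rewrite !dotDr !dotNr !dotZr.
have i2 : ii * ii = -1 := ring_ii oU.
have h := halfE.
move: (bdot u n1) (bdot u n2) => b c.
apply/rowP => j; rewrite !mxE.
move: ii i2 half h (w 0 j) (n1 0 j) (n2 0 j) => i i2 k h a m1 m2.
transitivity (a - ((2 * k) * (b * m1 - (i * i) * c * m2))); first ring.
by rewrite h i2; ring.
Qed.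

Section AtPoint.
Variables (x : 'rV[R]_2) (Ux : U x).

Lemma al_at : al x = (fr_al X x)%:C%C. Proof. exact: srealE. Qed.
Lemma be_at : be x = (fr_be X x)%:C%C. Proof. exact: srealE. Qed.
Lemma G_at i k : G i k x = (gram X i k x)%:C%C. Proof. exact: srealE. Qed.
Lemma XV_at : real_at x XV (X x).
Proof. by move=> j; rewrite mxE (srealE _ _ Ux). Qed.

Lemma sdV_at i : real_at x (sdV i XV) (row i (tangent_frame X x)).
Proof. by move=> j; rewrite (sdVE oU sX _ _ Ux) mxE (tangent_frameE sX _ _ Ux). Qed.

Lemma fr_m0E : fr_m x 0 = fr_al X x *: row 0 (tangent_frame X x).
Proof. by apply/rowP => j; rewrite mxE mulmx2E e00 e01 mul0r addr0 !mxE. Qed.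

Lemma fr_m1E : fr_m x 1 = (- (fr_be X x * gram X 0 1 x)) *: row 0 (tangent_frame X x)
  + (fr_be X x * gram X 0 0 x) *: row 1 (tangent_frame X x).
Proof. by apply/rowP => j; rewrite mxE mulmx2E e10 e11 !mxE. Qed.

Lemma e1V_at : real_at x e1V (fr_m x 0).
Proof. by rewrite fr_m0E; apply: real_atZ al_at (sdV_at 0). Qed.

Lemma e2V_at : real_at x e2V (fr_m x 1).
Proof.
rewrite fr_m1E; apply: real_atD; (apply: real_atZ; last exact: sdV_at).
  by rewrite smfunN smfunM be_at G_at rmorphN rmorphM.
by rewrite smfunM be_at G_at rmorphM.
Qed.

Lemma PN_at u w : real_at x u w -> real_at x (PN u) (normal_part X x w).
Proof.
move=> h; rewrite PN_e (normal_partE Ux).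
have k v z : real_at x v z -> real_at x (- (bdot u v *: v)) (- (bdot w z *: z)).
  by move=> vz; apply: real_atN; apply: (real_atZ (real_at_dot h vz) vz).
apply: real_atD; last exact: k e2V_at.
apply: real_atD; last exact: k e1V_at.
by apply: real_atD h (k _ _ XV_at).
Qed.

Lemma NV_at i k : real_at x (NV i k) (second_form X i k x).
Proof.
apply: PN_at => j; rewrite mxE [(sdV k XV) 0 j]mxE [XV 0 j]mxE.
rewrite (sd_sreal oU (sXj oU sX j) (smooth_partial k (sXj oU sX j))).
rewrite (sd_sreal oU _ (smooth_partial i (smooth_partial k (sXj oU sX j)))) (srealE _ _ Ux).
rewrite (partial_coord _ (smooth_derivable (smooth_partial k sX) Ux)); congr (_%:C%C).
apply: (partial_ext i oU _ Ux) => y Uy.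
exact: esym (partial_coord _ (smooth_derivable sX Uy)).
Qed.

Lemma IIV00_at : real_at x IIV00 (fr_II x 0 0).
Proof.
rewrite (fr_IIE Ux 0 0).
have := NV_at 0 0; have := NV_at 0 1; have := NV_at 1 1.
move: (second_form X 0 0 x) (second_form X 0 1 x) (second_form X 1 1 x) => B0 B1 B2 h2 h1 h0.
rewrite e00 e01 mulr0 !mul0r addr0 !scale0r !addr0.
by apply: real_atZ h0; rewrite smfunM al_at rmorphM.
Qed.

Lemma IIV01_at : real_at x IIV01 (fr_II x 0 1).
Proof.
rewrite (fr_IIE Ux 0 1).
have := NV_at 0 0; have := NV_at 0 1; have := NV_at 1 1.
move: (second_form X 0 0 x) (second_form X 0 1 x) (second_form X 1 1 x) => B0 B1 B2 h2 h1 h0.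
rewrite e00 e01 e10 e11 !mul0r addr0 !scale0r !addr0.
apply: real_atD; [apply: real_atZ h0|apply: real_atZ h1].
  by rewrite smfunN !smfunM al_at be_at G_at mulrN rmorphN !rmorphM mulrA.
by rewrite !smfunM al_at be_at G_at !rmorphM mulrA.
Qed.

Lemma IIV11_at : real_at x IIV11 (fr_II x 1 1).
Proof.
rewrite (fr_IIE Ux 1 1).
have := NV_at 0 0; have := NV_at 0 1; have := NV_at 1 1.
move: (second_form X 0 0 x) (second_form X 0 1 x) (second_form X 1 1 x) => B0 B1 B2 h2 h1 h0.
rewrite e10 e11.
apply: real_atD; [apply: real_atD; [apply: real_atZ h0|apply: real_atZ h1]|apply: real_atZ h2];
  rewrite ?smfunN !smfunM ?(smfun_nat _ _ Ux) be_at ?G_at -?(rmorph_nat (real_complex R) 2) -!rmorphM -?rmorphN;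
  congr (_%:C%C); move: (fr_be X x) (gram X 0 0 x) (gram X 0 1 x) => *; ring.
Qed.

Lemma half_at : half x = (2^-1 : R)%:C%C.
Proof. by rewrite (scstE _ _ Ux) fmorphV rmorph_nat. Qed.

Lemma HV_at : real_at x HV (mean_curvature_vector X x).
Proof.
rewrite HV_II (mean_curvatureE Ux).
by apply: real_atZ half_at _; apply: real_atD; [exact: IIV00_at|exact: IIV11_at].
Qed.

Lemma HV_sqr_at : bdot HV HV x = ((enorm (mean_curvature_vector X x)) ^+ 2)%:C%C.
Proof.
rewrite (real_at_dot HV_at HV_at) /enorm dot_bdot sqr_sqrtr //.
by apply: sumr_ge0 => j _; rewrite -expr2 sqr_ge0.
Qed.

End AtPoint.

Lemma PN_cV u : cV (PN u) = PN (cV u).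
Proof.
rewrite /PN !cjVD !cjVN !cjVZ Xreal !rmorphM !cj_dot (cjVK cjK) Xreal (cjhalf cj halfE).
by rewrite addrAC.
Qed.

Lemma NV_real i k : cV (NV i k) = NV i k.
Proof. by rewrite /NV PN_cV !cj_sdV Xreal. Qed.

(** F2 = h11 - h22 - 2 i h12 and 2 H = h11 + h22, so the cross terms of h11 and h22 cancel. *)
Lemma F2_sqr : half * bdot F2 (cV F2) + 2 * bdot HV HV =
  bdot IIV00 IIV00 + 2 * bdot IIV01 IIV01 + bdot IIV11 IIV11.
Proof.
have ca : cj al = al by exact: cj_sreal.
have cb : cj be = be by exact: cj_sreal.
have c0 : cj (G 0 0) = G 0 0 by exact: cj_sreal.
have c1 : cj (G 0 1) = G 0 1 by exact: cj_sreal.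
have [c00 c01 c11] : [/\ cV IIV00 = IIV00, cV IIV01 = IIV01 & cV IIV11 = IIV11].
  have := NV_real 0 0; have := NV_real 0 1; have := NV_real 1 1.
  rewrite /IIV00 /IIV01 /IIV11; move: (NV 0 0) (NV 0 1) (NV 1 1) => N0 N1 N2 n2 n1 n0.
  move: al be (G 0 0) (G 0 1) ca cb c0 c1 => a b g0 g1 ca cb c0 c1.
  split; first by rewrite cjVZ rmorphM ca n0.
    by rewrite cjVD !cjVZ n0 n1 rmorphN !rmorphM ca cb c0 c1.
  by rewrite !cjVD !cjVZ n0 n1 n2 rmorphN !rmorphM (cjn _ 2) cb c0 c1.
clear c0 c1.
rewrite HV_II F2_II; move: IIV00 IIV01 IIV11 c00 c01 c11 => B0 B1 B2 c0 c1 c2.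
have i2 : ii * ii = -1 := ring_ii oU.
have ci : cj ii = - ii := cj_ii oU.
rewrite !cjVD !cjVN !cjVZ c0 c1 c2 rmorphM ci (cjn _ 2).
have -> : B0 - B2 - (2 * ii) *: B1 = B0 + (-1) *: B2 + (- (2 * ii)) *: B1.
  by rewrite scaleN1r scaleNr.
have -> : B0 - B2 - (2 * - ii) *: B1 = B0 + (-1) *: B2 + (2 * ii) *: B1.
  by rewrite scaleN1r -scaleNr mulrN opprK.
rewrite !(dotDl, dotDr, dotZl, dotZr).
rewrite (dotC B1 B0) (dotC B2 B0) (dotC B2 B1).
move: half halfE (bdot B0 B0) (bdot B0 B1) (bdot B0 B2) (bdot B1 B1) (bdot B1 B2) (bdot B2 B2).
move: ii i2 ci => i i2 _ k h d0 d1 d2 d3 d4 d5.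
transitivity (k * (d0 + d5 - 2 * d2 - 4 * (i * i) * d3) + (2 * k) * k * (d0 + 2 * d2 + d5)); first ring.
rewrite i2 h mul1r.
transitivity ((2 * k) * (d0 + d5 + 2 * d3)); first ring.
by rewrite h; ring.
Qed.

Lemma sqnorm_at x (Ux : U x) :
  (half * bdot F2 (cV F2) + 2 * bdot HV HV) x = (sqnorm_second_form X x)%:C%C.
Proof.
rewrite F2_sqr (sqnorm_second_formE Ux).
have := IIV00_at Ux; have := IIV01_at Ux; have := IIV11_at Ux.
move: IIV00 IIV01 IIV11 (fr_II x 0 0) (fr_II x 0 1) (fr_II x 1 1) => B0 B1 B2 b0 b1 b2 h2 h1 h0.
rewrite !smfunD smfunM (smfun_nat _ _ Ux) (real_at_dot h0 h0) (real_at_dot h1 h1).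
by rewrite (real_at_dot h2 h2) !rmorphD rmorphM rmorph_nat.
Qed.

(* [EV fE HV] is [a0 d_0 HV + a1 d_1 HV], and [PN] is the normal projection. *)
Lemma parallelE :
  (forall i x, U x -> normal_derivative X i (mean_curvature_vector X) x = 0) ->
  EV fE HV = bdot (EV fE HV) XV *: XV + (half * bdot (EV fE HV) (cV F1)) *: F1
    + (half * bdot (EV fE HV) F1) *: cV F1.
Proof.
move=> par; have P i : PN (sdV i HV) = 0.
  apply/rowP => j; apply: smfun_ext => x Ux.
  have h : real_at x (sdV i HV) (partial i (mean_curvature_vector X) x).
    have eR k y : U y -> (complex.Re (R:=R) \o HV 0 k) y = mean_curvature_vector X y 0 k.
      by move=> Uy /=; rewrite (HV_at Uy).
    have eI k y : U y -> (complex.Im (R:=R) \o HV 0 k) y = 0.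
      by move=> Uy /=; rewrite (HV_at Uy).
    have d : derivable (mean_curvature_vector X) x (delta_mx 0 i).
      apply/derivable_mxP => p k; rewrite ord1.
      have sk : smooth_on U (fun y => mean_curvature_vector X y 0 k).
        by apply: (smooth_ext oU _ (sf_Re (HV 0 k))) => y Uy; exact: eR.
      exact: smooth_derivable sk Ux.
    move=> k; rewrite mxE sdE // (partial_coord _ d).
    rewrite (partial_ext i oU (eR k) Ux) (partial_ext i oU (eI k) Ux).
    by rewrite partial_cst.
  rewrite (PN_at Ux h) [normal_part _ _ _](par i x Ux) !mxE smfun0.
  by [].
have : PN (EV fE HV) = 0 by rewrite EV_sdV PND !PNZ !P !scaler0 addr0.
rewrite /PN; move: (bdot _ XV *: XV) (_ *: F1) (_ *: cV F1) => a b c.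
move: (EV fE HV) => d e.
have -> : d = (d - a - b - c) + (a + b + c) by apply/rowP => j; rewrite !mxE; move: (a 0 j) (b 0 j) (c 0 j) (d 0 j) => *; ring.
by rewrite e add0r.
Qed.

End NormalBundle.

(** * Calculus on the surface *)

Section Gradient.
Variables (R : realType) (N : nat).
Implicit Types (X : 'rV[R]_2 -> 'rV[R]_N.+1) (f : 'rV[R]_2 -> R).
Local Notation n := N.+1.

Definition grad_mx X x := invmx (first_form X x) *m tangent_frame X x.

(** Coordinates of the gradient of the A-th component of X, that is, of the tangential part of the
    A-th ambient basis vector; on real functions it is [tang] ([chart_tangE]). *)
Definition grad_field X (A : 'I_n) (i : 'I_2) x := grad_mx X x i A.

Definition differential f x : 'rV[R]_2 := \row_i partial i f x.

Lemma vderiv_grad X A f x :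
  vderiv (grad_field X A) f x = (differential f x *m grad_mx X x) 0 A.
Proof.
rewrite mulmx2E /vderiv /grad_field !mxE.
by move: (partial 0 f x) (partial 1 f x) => p q; rewrite [p * _]mulrC [q * _]mulrC.
Qed.

Lemma grad_mx_change (J : 'M[R]_2) (T : 'M[R]_(2, n)) (d : 'rV[R]_2) :
  row_free (J *m T) -> T *m T^T \in unitmx ->
  (d *m J^T) *m (invmx ((J *m T) *m (J *m T)^T) *m (J *m T)) = d *m (invmx (T *m T^T) *m T).
Proof.
move=> fJT uG.
have uJ : J \in unitmx.
  rewrite -row_free_unit /row_free eqn_leq rank_leq_row /=.
  by move: fJT; rewrite /row_free => /eqP {1}<-; exact: mxrankM_maxl.
have -> : invmx ((J *m T) *m (J *m T)^T) = invmx J^T *m invmx (T *m T^T) *m invmx J.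
  apply: invmx_right.
  rewrite trmx_mul !mulmxA -(mulmxA _ J^T) mulmxV ?unitmx_tr // mulmx1.
  by rewrite -(mulmxA J) -(mulmxA J) mulmxV // mulmx1 mulmxV.
rewrite !mulmxA -(mulmxA d) mulmxV ?unitmx_tr // mulmx1.
by rewrite -(mulmxA _ (invmx J)) mulVmx // mulmx1.
Qed.

End Gradient.

Section ChartGradient.
Variables (R : realType) (N : nat) (U : set 'rV[R]_2) (oU : open U).
Variable X : 'rV[R]_2 -> 'rV[R]_N.+1.
Hypothesis sX : smooth_on U X.
Hypothesis Xfree : forall x, U x -> row_free (tangent_frame X x).

Local Notation A := (smfun oU).
Local Notation n := N.+1.
Local Notation G := (fr_G oU sX).
Local Notation al := (fr_ral oU sX Xfree).
Local Notation be := (fr_rbe oU sX Xfree).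
Local Notation ii := (fr_ii oU).
Local Notation half := (fr_half oU).
Local Notation cj := (fr_cj oU).
Local Notation XV := (XV oU sX).
Local Notation fE := (chart_E (oU := oU) sX Xfree).
Local Notation e1V := (e1V oU sX Xfree).
Local Notation e2V := (e2V oU sX Xfree).
Local Notation chart_tang := (tang cj fE half XV).

Lemma first_form_unit x : U x -> first_form X x \in unitmx.
Proof.
move=> Ux; have := fr_e_gram sX Xfree Ux; rewrite -mulmxA => /mulmx1C/mulmx1_unit[].
by rewrite unitmx_mul => /andP[].
Qed.

Lemma chart_tang_e B (a : A) : chart_tang B a = e1V 0 B * (al * sd 0 a) +
  e2V 0 B * (- (be * G 0 1) * sd 0 a + be * G 0 0 * sd 1 a).
Proof.
rewrite /tang cV_F1_e F1_e EbE /chart_E cj_a0 cj_a1 /fr_a0 /fr_a1.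
have i2 : ii * ii = -1 := ring_ii oU.
have h : 2 * half = 1 := ring_half oU.
move: e1V e2V => u v; rewrite !mxE.
move: half h ii i2 (u 0 B) (v 0 B) (sd 0 a) (sd 1 a) al be (G 0 0) (G 0 1) => k h i i2 u0 v0 f0 f1 a0 b0 g0 g1.
transitivity ((2 * k) * (u0 * (a0 * f0) - (i * i) * (v0 * (- (b0 * g1) * f0 + b0 * g0 * f1)))); first ring.
by rewrite h i2; ring.
Qed.

Lemma chart_tangE B f (sf : smooth_on U f) x : U x ->
  chart_tang B (sreal oU sf) x = (vderiv (grad_field X B) f x)%:C%C.
Proof.
move=> Ux; rewrite chart_tang_e.
have s i : sd i (sreal oU sf) x = (partial i f x)%:C%C.
  by rewrite (sd_sreal oU sf (smooth_partial i sf)) (srealE _ _ Ux).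
have h1 := e1V_at oU sX Xfree Ux B; have h2 := e2V_at oU sX Xfree Ux B.
rewrite smfunD !smfunM smfunD !smfunM smfunN !smfunM !s h1 h2.
rewrite (al_at oU sX Xfree Ux) (be_at oU sX Xfree Ux) !(G_at oU sX Ux).
have m i : fr_m X x i 0 B = (fr_e X x *m tangent_frame X x) i B by rewrite mxE.
rewrite vderiv_grad /grad_mx (first_form_inv sX Xfree Ux) -(mulmxA (fr_e X x)^T) mulmx2E.
rewrite !(mulmx2E (fr_e X x)^T) -!m ![(_^T) _ _]mxE ![differential _ _ _ _]mxE.
rewrite (e00 X x) (e01 X x) (e10 X x) (e11 X x); gen_partial.
move: (fr_m _ _ _ _ _) (fr_m _ _ _ _ _) (fr_al _ _) (fr_be _ _) (gram _ _ _ _) (gram _ _ _ _) => *.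
by rewrite -!rmorphM -!rmorphN -!rmorphM -!rmorphD -!rmorphM -!rmorphD; congr (_%:C%C); ring.
Qed.

Lemma smooth_grad_field B i : smooth_on U (grad_field X B i).
Proof.
have sc : smooth_on U (fun y : 'rV[R]_2 => y 0 i) by exact: smooth_coord_fun.
apply: (smooth_ext oU _ (sf_Re (chart_tang B (sreal oU sc)))) => y Uy.
rewrite [LHS](congr1 (@complex.Re R) (chart_tangE B sc Uy)) [LHS]/= /vderiv !partial_coord_fun.
move: i {sc}; apply: ord2P; rewrite /= ?mulr1 ?mulr0 ?addr0 ?add0r //.
Qed.

Lemma chart_tang_sreal B f (sf : smooth_on U f) :
  chart_tang B (sreal oU sf) = sreal oU (smooth_vderiv oU (smooth_grad_field B) sf).
Proof. by apply: smfun_ext => x Ux; rewrite (srealE _ _ Ux); exact: chart_tangE. Qed.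

Lemma grad_field_elliptic : elliptic_on (grad_field X) U.
Proof.
move=> x p q Ux pq.
pose v : 'rV[R]_2 := p *: delta_mx 0 0 + q *: delta_mx 0 1.
have v0 : v 0 0 = p by rewrite !mxE /= mulr1 mulr0 addr0.
have v1 : v 0 1 = q by rewrite !mxE /= mulr1 mulr0 add0r.
have E B : grad_field X B 0 x * p + grad_field X B 1 x * q = (v *m grad_mx X x) 0 B.
  by rewrite mulmx2E v0 v1 /grad_field mulrC [q * _]mulrC.
under eq_bigr do rewrite E.
rewrite lt_neqAle sumr_ge0 ?andbT; last by move=> j _; exact: sqr_ge0.
apply/eqP => /esym/eqP; rewrite psumr_eq0; last by move=> j _; exact: sqr_ge0.
move=> /allP z.
have w0 : v *m grad_mx X x = 0.
  by apply/rowP => j; rewrite [RHS]mxE; have := z j (mem_index_enum j); rewrite sqrf_eq0 => /eqP.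
have : v = 0.
  rewrite -[v]mulmx1 -(mulVmx (first_form_unit Ux)) /first_form !mulmxA.
  by rewrite -(mulmxA v (invmx _)) -/(first_form X x) -/(grad_mx X x) w0 mul0mx.
by move=> v00; move: pq; rewrite -v0 -v1 v00 !mxE eqxx.
Qed.

End ChartGradient.

(** * Chart-independent gradient and Laplacian on the surface *)

Section GlobalCalculus.
Variables (R : realType) (M : topologicalType) (A : smooth_atlas R M).
Variables (N : nat) (Phi : M -> 'rV[R]_N.+1).
Local Notation n := N.+1.
Local Notation ch a := (@atlas_chart R M A a).
Local Notation cod a := (chart_cod (ch a)).
Local Notation rep a := (@local_rep R M A N Phi a).
Hypothesis sPhi : forall a, smooth_on (cod a) (rep a).
Hypothesis fPhi : forall a x, cod a x -> row_free (tangent_frame (rep a) x).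

Definition msmooth (f : M -> R) := forall a, smooth_on (cod a) (f \o param (ch a)).

Definition gradM (B : 'I_n) (f : M -> R) p :=
  let a := index_at A p in
  vderiv (grad_field (rep a) B) (f \o param (ch a)) (Defs.coord (ch a) p).

Lemma cod_open a : open (cod a). Proof. exact: chart_cod_open. Qed.

Lemma open_overlap a b : open (overlap (ch a) (ch b)).
Proof.
rewrite openE => x [Ux Vx]; apply: filterI; first by apply: open_nbhs_nbhs; split => //; exact: cod_open.
apply: (param_continuous Ux); apply: open_nbhs_nbhs; split => //; exact: chart_dom_open.
Qed.

(** The chart selected by [index_at] may jump from point to point. Under a change of chart the
    differential is multiplied by the transposed Jacobian and the gradient matrix by its inverse, so
    any chart gives the same value. *)
Lemma gradM_chart B f a x : msmooth f -> cod a x ->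
  gradM B f (param (ch a) x) = vderiv (grad_field (rep a) B) (f \o param (ch a)) x.
Proof.
move=> sf Ux; rewrite /gradM; set b := index_at _ _; set t := transition (ch a) (ch b).
have Wx : overlap (ch a) (ch b) x by split => //; exact: index_atP.
have st : smooth_on (overlap (ch a) (ch b)) t by exact: transition_smooth.
have tK y : overlap (ch a) (ch b) y -> param (ch b) (t y) = param (ch a) y.
  by move=> [Uy Vy]; exact: coordK.
have tU y : overlap (ch a) (ch b) y -> cod b (t y) by case=> Uy Vy; exact: coord_cod.
have oW : open (overlap (ch a) (ch b)) by exact: open_overlap.
have dt i : derivable t x (delta_mx 0 i) := smooth_derivable st Wx.
have P (h : M -> R) i : smooth_on (cod b) (h \o param (ch b)) ->
    partial i (h \o param (ch a)) x = (differential (h \o param (ch b)) (t x) *m (tangent_frame t x)^T) 0 i.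
  move=> sh.
  have e y : overlap (ch a) (ch b) y -> (h \o param (ch a)) y = ((h \o param (ch b)) \o t) y.
    by move=> Wy /=; rewrite tK.
  rewrite (partial_ext i oW e Wx).
  rewrite (chain_rule (@cod_open b) (smooth_C1 sh) (tU _ Wx) (dt i)).
  rewrite mulmx2E; have d k : differential (h \o param (ch b)) (t x) 0 k = partial k (h \o param (ch b)) (t x) by rewrite mxE.
  have J k : (tangent_frame t x)^T k i = partial i t x 0 k by rewrite !mxE.
  by rewrite !d !J; gen_partial; rewrite [X in X + _]mulrC [X in _ + X]mulrC.
have dfE : differential (f \o param (ch a)) x =
    differential (f \o param (ch b)) (t x) *m (tangent_frame t x)^T.
  by apply/rowP => i; rewrite mxE; exact: P.
have TE : tangent_frame (rep a) x = tangent_frame t x *m tangent_frame (rep b) (t x).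
  apply/matrixP => i j.
  rewrite (tangent_frameE (sPhi a) _ _ Ux) mulmx2E !(tangent_frameE (sPhi b) _ _ (tU _ Wx)).
  have := P (fun p => Phi p 0 j) i (smooth_coord j (@cod_open b) (sPhi b)).
  rewrite mulmx2E => E; rewrite [LHS]E; clear.
  have d k : differential ((fun p => Phi p 0 j) \o param (ch b)) (t x) 0 k = partial k (fun y => rep b y 0 j) (t x) by rewrite mxE.
  have J k : (tangent_frame t x)^T k i = tangent_frame t x i k by rewrite mxE.
  by rewrite !d !J; gen_partial; rewrite [X in X + _]mulrC [X in _ + X]mulrC.
have fT := fPhi Ux; have uG := first_form_unit (sPhi b) (@fPhi b) (tU _ Wx).
rewrite !vderiv_grad dfE /grad_mx /first_form TE; rewrite TE in fT.
by rewrite (grad_mx_change _ fT uG).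
Qed.

Lemma param_coord p : let a := index_at A p in param (ch a) (Defs.coord (ch a) p) = p.
Proof. exact: coordK (index_atP A p). Qed.

Lemma coord_in p : let a := index_at A p in cod a (Defs.coord (ch a) p).
Proof. exact: coord_cod (index_atP A p). Qed.

Let sgrad a B : forall i, smooth_on (cod a) (grad_field (rep a) B i) :=
  smooth_grad_field (@cod_open a) (sPhi a) (@fPhi a) B.

Lemma msmooth_cst (k : R) : msmooth (fun=> k).
Proof. by move=> a; apply: smooth_cst; exact: cod_open. Qed.

Lemma msmoothD f g : msmooth f -> msmooth g -> msmooth (fun p => f p + g p).
Proof. by move=> sf sg a; apply: smoothD => //; exact: cod_open. Qed.

Lemma msmoothM f g : msmooth f -> msmooth g -> msmooth (fun p => f p * g p).
Proof. by move=> sf sg a; apply: smoothM => //; exact: cod_open. Qed.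

Lemma msmoothN f : msmooth f -> msmooth (fun p => - f p).
Proof. by move=> sf a; apply: smoothN => //; exact: cod_open. Qed.

Lemma msmoothV f : (forall p, f p != 0) -> msmooth f -> msmooth (fun p => (f p)^-1).
Proof. by move=> f0 sf a; apply: (smoothV (@cod_open a)) => // x _; exact: f0. Qed.

Lemma msmooth_sum (I : Type) (s : seq I) (F : I -> M -> R) :
  (forall i, msmooth (F i)) -> msmooth (fun p => \sum_(i <- s) F i p).
Proof.
by move=> sF a; apply: smooth_sum; [exact: cod_open|move=> i; exact: sF].
Qed.

Lemma msmooth_Phi j : msmooth (fun p => Phi p 0 j).
Proof. by move=> a; apply: (smooth_coord j (@cod_open a) (sPhi a)). Qed.

Lemma msmooth_grad B f : msmooth f -> msmooth (gradM B f).
Proof.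
move=> sf a; apply: (smooth_ext (@cod_open a) _ (smooth_vderiv (@cod_open a) (@sgrad a B) (sf a))).
by move=> y Uy; rewrite [RHS](gradM_chart B sf Uy).
Qed.

Lemma gradMD B f g p : msmooth f -> msmooth g ->
  gradM B (fun p => f p + g p) p = gradM B f p + gradM B g p.
Proof. by move=> sf sg; exact: vderivD (sf _) (sg _) (coord_in p). Qed.

Lemma gradMM B f g p : msmooth f -> msmooth g ->
  gradM B (fun p => f p * g p) p = f p * gradM B g p + g p * gradM B f p.
Proof.
move=> sf sg; have := vderivM (grad_field (rep (index_at A p)) B) (sf _) (sg _) (coord_in p).
rewrite /= param_coord; exact.
Qed.

Lemma gradM_cst B (k : R) p : gradM B (fun=> k) p = 0.
Proof. exact: vderiv_cst. Qed.

Definition LapM f p := \sum_B gradM B (gradM B f) p.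

Lemma LapM_chart f a x : msmooth f -> cod a x ->
  LapM f (param (ch a) x) = sumsq_op (grad_field (rep a)) (f \o param (ch a)) x.
Proof.
move=> sf Ux; apply: eq_bigr => B _; rewrite (gradM_chart B (msmooth_grad B sf) Ux).
by apply: (vderiv_ext _ (@cod_open a) _ Ux) => y Uy /=; rewrite (gradM_chart B sf Uy).
Qed.

Lemma msmooth_continuous f : msmooth f -> continuous f.
Proof.
move=> sf p; set a := index_at A p.
have Dp : chart_dom (ch a) p by exact: index_atP.
have h : {for p, continuous ((f \o param (ch a)) \o Defs.coord (ch a))}.
  have c1 : {for p, continuous (Defs.coord (ch a))} by exact: (Defs.coord_continuous Dp).
  have c2 : {for Defs.coord (ch a) p, continuous (f \o param (ch a))}.
    by apply: (smooth_continuous (sf a)); exact: coord_cod.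
  exact: (continuous_comp c1 c2).
have hd : nbhs p (chart_dom (ch a)) by apply: open_nbhs_nbhs; split => //; exact: chart_dom_open.
move=> W; have e : ((f \o param (ch a)) \o Defs.coord (ch a)) p = f p by rewrite /= coordK.
rewrite -{1}e => /h hW; have hW' : nbhs p (((f \o param (ch a)) \o Defs.coord (ch a)) @^-1` W) := hW.
have : nbhs p (f @^-1` W) by apply: filterS (filterI hW' hd) => q [/= + Dq]; rewrite coordK.
exact.
Qed.

Section Compact.
Hypothesis M0 : [set: M] !=set0.
Hypothesis cptM : compact [set: M].

Lemma max_exists f : msmooth f -> exists p, forall q, f q <= f p.
Proof.
move=> sf; have cf : {within [set: M], continuous f}.
  by apply: continuous_subspaceT; exact: msmooth_continuous.
by have [p _ h] := compact_EVT_max M0 cptM cf; exists p => q; apply: h; rewrite inE.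
Qed.

Lemma min_exists f : msmooth f -> exists p, forall q, f p <= f q.
Proof.
move=> /msmoothN/max_exists[p h]; exists p => q.
by have := h q; rewrite lerN2.
Qed.

End Compact.

Lemma LapM_max f p : msmooth f -> (forall q, f q <= f p) -> LapM f p <= 0.
Proof.
move=> sf fp; rewrite -(param_coord p) LapM_chart //; last exact: coord_in.
apply: (sumsq_op_max (@cod_open _) (@sgrad _) (sf _) (coord_in p)) => y Uy /=.
by rewrite param_coord.
Qed.

(** The set where the maximum is attained is closed by continuity and open by the local
    principle. *)
Lemma strong_max f (m : R) p0 : connected [set: M] -> msmooth f ->
  (forall p, 0 <= LapM f p) -> (forall p, f p <= m) -> f p0 = m -> forall p, f p = m.
Proof.
move=> conM sf Lf fm fp0 p.
suff E : [set q | f q = m] = [set: M] by have : [set: M] p by []; rewrite -E.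
apply: conM; first by exists p0.
  exists [set q | f q = m]; last by rewrite setTI.
  rewrite openE => q fq; set a := index_at A q.
  have Dq : chart_dom (ch a) q by exact: index_atP.
  have Uq : cod a (Defs.coord (ch a) q) by exact: coord_cod.
  have := strong_max_local (@cod_open a) (@sgrad a) (grad_field_elliptic (sPhi a) (@fPhi a)) (sf a).
  move=> /(_ (Defs.coord (ch a) q) m) H.
  have {}H : \forall y \near Defs.coord (ch a) q, (f \o param (ch a)) y = m.
    apply: H => // [y Uy|y Uy /=|/=]; last by rewrite coordK.
      by rewrite -LapM_chart.
    exact: fm.
  have h : nbhs q [set z | (f \o param (ch a)) (Defs.coord (ch a) z) = m].
    exact: (Defs.coord_continuous Dq H).
  have hd : nbhs q (chart_dom (ch a)) by apply: open_nbhs_nbhs; split => //; exact: chart_dom_open.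
  by apply: filterS (filterI h hd) => z [/= e Dz]; rewrite -e coordK.
exists [set q | f q = m]; last by rewrite setTI.
exact: ((continuous_closedP f).1 (msmooth_continuous sf) _ (@closed_eq _ m)).
Qed.

(** A vanishing gradient makes the Laplacian zero, so the strong maximum principle replaces
    integration along paths. *)
Lemma grad0_cst f : [set: M] !=set0 -> compact [set: M] -> connected [set: M] ->
  msmooth f -> (forall B p, gradM B f p = 0) -> forall p q, f p = f q.
Proof.
move=> M0 cM conM sf g0; have [p0 h] := max_exists M0 cM sf.
have L p : 0 <= LapM f p.
  rewrite /LapM big1 // => B _.
  have -> : gradM B f = fun=> 0 by apply/funext => q; exact: g0.
  exact: gradM_cst.
by move=> p q; rewrite !(strong_max conM sf L h (erefl _)).
Qed.

End GlobalCalculus.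

(** * Vanishing of the quartic form *)

Section ParallelSurface.
Variables (R : realType) (M : topologicalType) (A : smooth_atlas R M).
Variables (N : nat) (Phi : M -> 'rV[R]_N.+1).
Local Notation n := N.+1.
Local Notation ch a := (@atlas_chart R M A a).
Local Notation cod a := (chart_cod (ch a)).
Local Notation rep a := (@local_rep R M A N Phi a).
Hypothesis Phi1 : forall p, enorm (Phi p) = 1.
Hypothesis sPhi : forall a, smooth_on (cod a) (rep a).
Hypothesis fPhi : forall a x, cod a x -> row_free (tangent_frame (rep a) x).
Hypothesis par : parallel_mean_curvature A Phi.

Local Notation msm := (@msmooth R M A).
Local Notation gradM := (gradM A Phi).
Local Notation LapM := (LapM A Phi).

Lemma msmooth_LapM f : msm f -> msm (LapM f).
Proof. by move=> sf; apply: msmooth_sum => B; do 2 apply: msmooth_grad => //. Qed.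

(* The Laplacian of the position vector is 2 (H - Phi). *)
Definition mc_vec j p := Phi p 0 j + 2^-1 * LapM (fun p => Phi p 0 j) p.
Definition mc_sqr p := \sum_j mc_vec j p * mc_vec j p.
Definition hessM B C j := gradM B (gradM C (fun p => Phi p 0 j)).
(* [traceless_sqr] is 2 (S - 2 H^2), and [quartic_sqr] is the squared modulus of
   the holomorphic quadratic form q = <H, h(E, E)>; both are written with
   globally defined derivatives only. *)
Definition traceless_sqr p := \sum_B \sum_C \sum_j hessM B C j p * hessM B C j p + (-4) * (1 + mc_sqr p).
Definition quartic_sqr p := 2 * (\sum_B \sum_C (\sum_j mc_vec j p * hessM B C j p) * (\sum_j mc_vec j p * hessM B C j p)
  + (-2) * (mc_sqr p * mc_sqr p)).

Lemma msmooth_Hv j : msm (mc_vec j).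
Proof.
have sP : msm (fun p => Phi p 0 j) by exact: msmooth_Phi.
by apply: msmoothD => //; apply: msmoothM; [exact: msmooth_cst|exact: msmooth_LapM].
Qed.

Lemma msmooth_h2g : msm mc_sqr.
Proof. by apply: msmooth_sum => j; apply: msmoothM; exact: msmooth_Hv. Qed.

Lemma msmooth_hessM B C j : msm (hessM B C j).
Proof.
have sP : msm (fun p => Phi p 0 j) by exact: msmooth_Phi.
by do 2 apply: msmooth_grad => //.
Qed.

Lemma msmooth_a2g : msm traceless_sqr.
Proof.
apply: msmoothD.
  apply: msmooth_sum => B; apply: msmooth_sum => D; apply: msmooth_sum => j.
  by apply: msmoothM; exact: msmooth_hessM.
apply: msmoothM; first exact: msmooth_cst.
by apply: msmoothD; [exact: msmooth_cst|exact: msmooth_h2g].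
Qed.

Lemma msmooth_Wg : msm quartic_sqr.
Proof.
apply: msmoothM; first exact: msmooth_cst; apply: msmoothD.
  apply: msmooth_sum => B; apply: msmooth_sum => D; apply: msmoothM; apply: msmooth_sum => j;
    by apply: msmoothM; [exact: msmooth_Hv|exact: msmooth_hessM].
apply: msmoothM; first exact: msmooth_cst.
by apply: msmoothM; exact: msmooth_h2g.
Qed.

Section Lift.
Variable a : atlas_index A.
Local Notation oU := (@cod_open R M A a).
Local Notation C := (smfun oU).

(** Made total by excluded middle, so that functions on [M] can be moved into the chart ring by
    rewriting; the default 0 never occurs for globally smooth functions ([lfE]). *)
Definition lf (f : M -> R) : C :=
  if pselect (smooth_on (cod a) (f \o param (ch a))) is left sf then sreal oU sf else 0.

Lemma lfE f x : msm f -> cod a x -> lf f x = (f (param (ch a) x))%:C%C.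
Proof.
move=> sf Ux; rewrite /lf; case: pselect => [s|/(_ (sf a))//].
by rewrite (srealE _ _ Ux).
Qed.

Lemma lf_sreal f (s : smooth_on (cod a) (f \o param (ch a))) : msm f -> lf f = sreal oU s.
Proof. by move=> sf; apply: smfun_ext => x Ux; rewrite lfE // (srealE _ _ Ux). Qed.

Lemma lf_inj f g x : msm f -> msm g -> cod a x -> lf f = lf g ->
  f (param (ch a) x) = g (param (ch a) x).
Proof.
move=> sf sg Ux /(congr1 (fun u : C => u x)); rewrite !lfE //.
by move=> /(congr1 (@complex.Re R)).
Qed.

Lemma lf_cst k : lf (fun=> k) = scst oU k%:C%C.
Proof.
apply: smfun_ext => x Ux; rewrite (scstE _ _ Ux) lfE //; exact: msmooth_cst.
Qed.

Lemma lfD f g : msm f -> msm g -> lf (fun p => f p + g p) = lf f + lf g.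
Proof.
move=> sf sg; apply: smfun_ext => x Ux; rewrite smfunD !lfE //; last exact: msmoothD.
by rewrite rmorphD.
Qed.

Lemma lfM f g : msm f -> msm g -> lf (fun p => f p * g p) = lf f * lf g.
Proof.
move=> sf sg; apply: smfun_ext => x Ux; rewrite smfunM !lfE //; last exact: msmoothM.
by rewrite rmorphM.
Qed.

Lemma lf_sum (I : Type) (s : seq I) (F : I -> M -> R) : (forall i, msm (F i)) ->
  lf (fun p => \sum_(i <- s) F i p) = \sum_(i <- s) lf (F i).
Proof.
move=> sF; apply: smfun_ext => x Ux; rewrite smfun_sum lfE //; last exact: msmooth_sum.
by rewrite rmorph_sum; apply: eq_bigr => i _; rewrite lfE.
Qed.

Local Notation half := (fr_half oU).
Local Notation cj := (fr_cj oU).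
Local Notation XV := (XV oU (sPhi a)).
Local Notation fE := (chart_E (oU := oU) (sPhi a) (@fPhi a)).
Local Notation kap := (fr_kap oU (sPhi a) (@fPhi a)).
Local Notation HV := (HV oU (sPhi a) (@fPhi a)).
Local Notation F1 := (EV fE XV).
Local Notation F2 := (DV fE kap 1 F1).
Local Notation ctang := (tang cj fE half XV).
Local Notation clap := (lap cj fE kap).

Lemma cj_lf f : cj (lf f) = lf f.
Proof. by rewrite /lf; case: pselect => s; [exact: cj_sreal|rewrite rmorph0]. Qed.

Lemma tang_lf B f : msm f -> ctang B (lf f) = lf (gradM B f).
Proof.
move=> sf; have sg := msmooth_grad sPhi fPhi B sf.
rewrite (lf_sreal (sf a) sf) chart_tang_sreal; apply: smfun_ext => x Ux.
by rewrite (srealE _ _ Ux) (lfE sg Ux) (gradM_chart sPhi fPhi B sf Ux).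
Qed.

Let X1 x : cod a x -> enorm (rep a x) = 1. Proof. by move=> _; exact: Phi1. Qed.
Let cjK : involutive cj := @fr_cjK _ _ oU.
Let ED := fED (sPhi a) (@fPhi a) (oU := oU).
Let EM := fEM (sPhi a) (@fPhi a) (oU := oU).
Let halfE : 2 * half = 1 := ring_half oU.
Let Ecomm := fr_comm (oU := oU) (sPhi a) (@fPhi a).
Let Xreal := XV_real oU (sPhi a).
Let Hreal := HV_real oU (sPhi a) (@fPhi a).
Let XX := XX_1 oU (sPhi a) X1.
Let F11 := fr_F11 oU (sPhi a) (@fPhi a).
Let F1c1 := fr_F1c1 oU (sPhi a) (@fPhi a).
Let DbF1 := fr_DbF1 oU (sPhi a) (@fPhi a).
Let HX := fr_HX oU (sPhi a) X1 (@fPhi a).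
Let HF1 := fr_HF1 oU (sPhi a) X1 (@fPhi a).
Let parallel := parallelE oU (sPhi a) X1 (@fPhi a) (fun i x => par i (x := x)).

Lemma lap_lf f : msm f -> clap (lf f) = lf (LapM f).
Proof.
move=> sf; rewrite -(sum_tang_lap cjK ED EM halfE Ecomm Xreal Hreal XX F11 F1c1 DbF1 HF1).
have s B : msm (gradM B f) by exact: msmooth_grad.
rewrite /LapM lf_sum; last by move=> B; apply: msmooth_grad.
by apply: eq_bigr => B _; rewrite !tang_lf.
Qed.

Lemma XV_lf j : XV 0 j = lf (fun p => Phi p 0 j).
Proof.
rewrite mxE; apply: smfun_ext => x Ux; rewrite (srealE _ _ Ux) lfE //; exact: msmooth_Phi.
Qed.

Lemma Hv_lf j : HV 0 j = lf (mc_vec j).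
Proof.
have sP : msm (fun p => Phi p 0 j) by exact: msmooth_Phi.
rewrite /mc_vec lfD //; last by apply: msmoothM; [exact: msmooth_cst|exact: msmooth_LapM].
rewrite lfM; [|exact: msmooth_cst|exact: msmooth_LapM].
rewrite -lap_lf // -!XV_lf (lap_X DbF1) lf_cst fmorphV rmorph_nat.
have e : scst oU 2^-1 * 2 = 1 by rewrite mulrC; exact: halfE.
by rewrite mulrA e mul1r addrC subrK.
Qed.

Lemma h2_lf : bdot HV HV = lf mc_sqr.
Proof.
rewrite lf_sum; last by move=> j; apply: msmoothM; exact: msmooth_Hv.
by apply: eq_bigr => j _; rewrite lfM ?Hv_lf //; exact: msmooth_Hv.
Qed.

Lemma hess_lf B C j : ctang B (ctang C (XV 0 j)) = lf (hessM B C j).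
Proof.
have sP : msm (fun p => Phi p 0 j) by exact: msmooth_Phi.
by rewrite XV_lf tang_lf // tang_lf //; exact: msmooth_grad.
Qed.

Lemma lf_nat k : lf (fun=> k%:R) = k%:R.
Proof.
apply: smfun_ext => x Ux; rewrite lfE ?(smfun_nat _ _ Ux) ?rmorph_nat //; exact: msmooth_cst.
Qed.

Lemma lf_natN k : lf (fun=> - k%:R) = - k%:R.
Proof.
apply: smfun_ext => x Ux; rewrite lfE ?smfunN ?(smfun_nat _ _ Ux) ?rmorphN ?rmorph_nat //; exact: msmooth_cst.
Qed.

Lemma a2_lf : bdot F2 (cjV cj F2) = lf traceless_sqr.
Proof.
have := sum_sqr_hess cjK ED EM halfE Xreal Hreal XX F11 F1c1 DbF1 HX HF1.
have sh := msmooth_hessM; have s2 := msmooth_h2g.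
have ss B C : msm (fun p => \sum_j hessM B C j p * hessM B C j p).
  by apply: msmooth_sum => j; apply: msmoothM.
have -> : \sum_B \sum_C \sum_j ctang B (ctang C (XV 0 j)) ^+ 2 =
    lf (fun p => \sum_B \sum_C \sum_j hessM B C j p * hessM B C j p).
  rewrite lf_sum; last by move=> B; apply: msmooth_sum => D.
  apply: eq_bigr => B _; rewrite lf_sum //; apply: eq_bigr => D _.
  rewrite lf_sum; last by move=> j; apply: msmoothM.
  by apply: eq_bigr => j _; rewrite lfM // hess_lf expr2.
rewrite h2_lf => e.
rewrite /traceless_sqr lfD; [|by apply: msmooth_sum => B; apply: msmooth_sum => D|]; last first.
  by apply: msmoothM; [exact: msmooth_cst|apply: msmoothD => //; exact: msmooth_cst].
rewrite e lfM; [|exact: msmooth_cst|by apply: msmoothD => //; exact: msmooth_cst].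
rewrite lfD //; last exact: msmooth_cst.
by rewrite (lf_nat 1) (lf_natN 4) mulNr [X in X - _]addrC addrK.
Qed.

Lemma q_lf : bdot HV F2 * cj (bdot HV F2) = lf quartic_sqr.
Proof.
have := sum_sqr_shape cjK ED EM halfE Xreal Hreal F11 F1c1 DbF1 HX HF1.
have sh := msmooth_hessM; have s2 := msmooth_h2g; have sv := msmooth_Hv.
have s1 B C : msm (fun p => \sum_j mc_vec j p * hessM B C j p).
  by apply: msmooth_sum => j; apply: msmoothM.
have ss B C : msm (fun p => (\sum_j mc_vec j p * hessM B C j p) * (\sum_j mc_vec j p * hessM B C j p)).
  by apply: msmoothM.
have -> : \sum_B \sum_C (\sum_j HV 0 j * ctang B (ctang C (XV 0 j))) ^+ 2 =
    lf (fun p => \sum_B \sum_C (\sum_j mc_vec j p * hessM B C j p) * (\sum_j mc_vec j p * hessM B C j p)).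
  rewrite lf_sum; last by move=> B; apply: msmooth_sum => D.
  apply: eq_bigr => B _; rewrite lf_sum //; apply: eq_bigr => D _.
  rewrite lfM // expr2; suff -> : \sum_j HV 0 j * ctang B (ctang D (XV 0 j)) =
    lf (fun p => \sum_j mc_vec j p * hessM B D j p) by [].
  rewrite lf_sum; last by move=> j; apply: msmoothM.
  by apply: eq_bigr => j _; rewrite lfM // hess_lf Hv_lf.
rewrite h2_lf => e.
have s3 : msm (fun p => -2 * (mc_sqr p * mc_sqr p)).
  by apply: msmoothM; [exact: msmooth_cst|apply: msmoothM].
have s4 : msm (fun p => \sum_B \sum_C (\sum_j mc_vec j p * hessM B C j p) * (\sum_j mc_vec j p * hessM B C j p)).
  by apply: msmooth_sum => B; apply: msmooth_sum => D.
rewrite /quartic_sqr lfM; [|exact: msmooth_cst|exact: msmoothD].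
rewrite (lfD s4 s3) e lfM; [|exact: msmooth_cst|exact: msmoothM].
rewrite lfM // (lf_nat 2) (lf_natN 2) mulNr addrK [RHS]mulrA halfE mul1r.
by [].
Qed.

Lemma E_h2_0 : fE (lf mc_sqr) = 0.
Proof. by rewrite -h2_lf (E_h2 cjK ED EM halfE Xreal Hreal DbF1 HX HF1 parallel). Qed.

(** [D] is the frame-dependent derivative of q; only the sign of its squared modulus is used. *)
Lemma lap_Wg : exists D, lf (LapM quartic_sqr) = D * cj D + (4 * (1 + lf mc_sqr) - lf traceless_sqr) * lf quartic_sqr.
Proof.
have sW := msmooth_Wg.
exists (D fE kap 2 (bdot HV F2)).
rewrite -lap_lf // -q_lf (lap_q cjK ED EM halfE Ecomm Xreal Hreal XX F11 F1c1 DbF1 HX HF1 parallel).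
by rewrite (pmc_curv cjK ED EM halfE Ecomm Xreal Hreal XX F11 F1c1 DbF1 HX HF1 parallel) h2_lf a2_lf.
Qed.

End Lift.

End ParallelSurface.

(** * Pointwise Hermitian inequalities *)

Section PointwiseHermitian.
Variables (R : realType) (U : set 'rV[R]_2) (oU : open U) (n : nat).
Local Notation A := (smfun oU).
Local Notation cj := (fr_cj oU).
Implicit Types (f : A) (u v : 'rV[A]_n).

Definition sqmod f x : R := complex.Re (f x) ^+ 2 + complex.Im (f x) ^+ 2.

Lemma sqmod_ge0 f x : 0 <= sqmod f x.
Proof. by rewrite addr_ge0 ?sqr_ge0. Qed.

Lemma sqmodE f x : (f * cj f) x = (sqmod f x)%:C%C.
Proof.
rewrite smfunM [cj f x]smfun_cj; apply: complex_ext.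
  by rewrite ReM Re_conj Im_conj /sqmod /=; ring.
by rewrite ImM Re_conj Im_conj /=; ring.
Qed.

Definition nsq u x : R := \sum_j sqmod (u 0 j) x.

Lemma nsq_ge0 u x : 0 <= nsq u x.
Proof. by apply: sumr_ge0 => j _; exact: sqmod_ge0. Qed.

Lemma nsqE u x : bdot u (cjV cj u) x = (nsq u x)%:C%C.
Proof.
rewrite smfun_sum rmorph_sum; apply: eq_bigr => j _.
have -> : cjV cj u 0 j = cj (u 0 j) by rewrite mxE.
exact: sqmodE.
Qed.

(** Cauchy-Schwarz from the square norm of S u - Z v, with S = |v|^2 and Z the product of u and v.
    It carries a factor |v|^2, so points where v vanishes are treated apart. *)
Lemma sqmod_dot_le u v x : U x -> sqmod (bdot u (cjV cj v)) x <= nsq u x * nsq v x.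
Proof.
move=> Ux; set S := bdot v (cjV cj v); set Z := bdot u (cjV cj v).
have cjK : involutive cj by exact: fr_cjK.
have cS : cj S = S by rewrite cj_dot cjVK // dotC.
have e : bdot (S *: u - Z *: v) (cjV cj (S *: u - Z *: v)) =
    S * (S * bdot u (cjV cj u) - Z * cj Z).
  have cZ : cj Z = bdot v (cjV cj u) by rewrite cj_dot cjVK // dotC.
  rewrite cjVD cjVN !cjVZ cS !(dotDl, dotDr, dotNl, dotNr, dotZl, dotZr) -/Z -cZ -/S; ring.
have := congr1 (fun f : A => f x) e.
rewrite nsqE smfunM smfunD smfunN smfunM sqmodE !nsqE -!rmorphM -rmorphB -rmorphM.
move=> /(congr1 (@complex.Re R)) /= => {}e.
have h : 0 <= nsq v x * (nsq v x * nsq u x - sqmod Z x) by rewrite -e nsq_ge0.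
have := nsq_ge0 v x; rewrite le0r => /orP[/eqP v0|v0]; last first.
  by move: h; rewrite pmulr_rge0 // subr_ge0 mulrC.
suff z0 : Z x = 0 by rewrite /sqmod z0 /= !expr0n addr0 v0 mulr0.
rewrite smfun_sum big1 // => j _; rewrite smfunM mxE [cj _ x]smfun_cj.
suff -> : v 0 j x = 0 by rewrite conjc0 mulr0.
have /eqP : nsq v x = 0 by [].
rewrite psumr_eq0; last by move=> k _; exact: sqmod_ge0.
move=> /allP/(_ j (mem_index_enum j)); rewrite paddr_eq0 ?sqr_ge0 // !sqrf_eq0 => /andP[/eqP r0 /eqP i0].
exact: complex_ext.
Qed.

End PointwiseHermitian.

(** * The rescaled minimal surface *)

Section RescaledSurface.
Variables (R : realType) (M : topologicalType) (A : smooth_atlas R M).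
Variables (N : nat) (Phi : M -> 'rV[R]_N.+1).
Local Notation n := N.+1.
Local Notation ch a := (@atlas_chart R M A a).
Local Notation cod a := (chart_cod (ch a)).
Local Notation rep a := (@local_rep R M A N Phi a).
Hypothesis Phi1 : forall p, enorm (Phi p) = 1.
Hypothesis sPhi : forall a, smooth_on (cod a) (rep a).
Hypothesis fPhi : forall a x, cod a x -> row_free (tangent_frame (rep a) x).
Hypothesis par : parallel_mean_curvature A Phi.

Local Notation msm := (@msmooth R M A).
Local Notation gradM := (gradM A Phi).
Local Notation LapM := (LapM A Phi).
Local Notation mc_sqr := (mc_sqr A Phi).
Local Notation traceless_sqr := (traceless_sqr A Phi).
Local Notation quartic_sqr := (quartic_sqr A Phi).

Variable c : R.
Hypothesis c_gt0 : 0 < c.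
Hypothesis h2c : forall p, 1 + mc_sqr p = c.
Hypothesis W0 : forall p, quartic_sqr p = 0.
Hypothesis a2_gt0 : forall p, 0 < traceless_sqr p.

(** For the rescaled immersion [F1] is unchanged while the frame shrinks by 1 / sqrt c, so each
    tangential derivative acquires one such factor and the Laplacian the factor 1 / c. *)
Definition invs := (Num.sqrt c)^-1.
Definition scaled_grad B (f : M -> R) p := invs * gradM B f p.
Definition scaled_lap f p := \sum_B scaled_grad B (scaled_grad B f) p.
Definition scaled_dot f g p := \sum_B scaled_grad B f p * scaled_grad B g p.
Definition rhog p := (2 * c)^-1 * traceless_sqr p.
Definition irhog p := (rhog p)^-1.
(* In a chart, [ratio_r] is |G3|^2 / |F2|^2 and [ratio_Q] is |w4|^2 / |F2|^2
   ([rg_lf], [Qg_lf]); taking the Laplacian identities as definitions makes them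
   globally defined and smooth. *)
Definition ratio_r p := (irhog p * scaled_lap rhog p + (-1) * (irhog p * irhog p * scaled_dot rhog rhog p))
  + (3 * rhog p + (-4)).
Definition ratio_Q p := scaled_lap ratio_r p + (-2) * (ratio_r p * (1 + (-1) * ratio_r p)).

Lemma invs_sqr : invs * invs * c = 1.
Proof. by rewrite /invs -invfM -expr2 sqr_sqrtr ?ltW // mulVf // gt_eqF. Qed.

Lemma rhog_gt0 p : 0 < rhog p.
Proof. by rewrite mulr_gt0 // invr_gt0 mulr_gt0. Qed.

Lemma msmooth_gradn B f : msm f -> msm (scaled_grad B f).
Proof. by move=> sf; apply: msmoothM; [exact: msmooth_cst|exact: msmooth_grad]. Qed.

Lemma msmooth_Lapn f : msm f -> msm (scaled_lap f).
Proof. by move=> sf; apply: msmooth_sum => B; do 2 apply: msmooth_gradn => //. Qed.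

Lemma msmooth_dotn f g : msm f -> msm g -> msm (scaled_dot f g).
Proof. by move=> sf sg; apply: msmooth_sum => B; apply: msmoothM; exact: msmooth_gradn. Qed.

Lemma msmooth_rhog : msm rhog.
Proof. by apply: msmoothM; [exact: msmooth_cst|exact: msmooth_a2g]. Qed.

Lemma msmooth_irhog : msm irhog.
Proof.
by apply: msmoothV; [move=> p; rewrite gt_eqF // rhog_gt0|exact: msmooth_rhog].
Qed.

Lemma msmooth_rg : msm ratio_r.
Proof.
have k := @msmooth_cst R M A; have s1 := msmooth_rhog; have s2 := msmooth_irhog.
have s3 := msmooth_Lapn s1; have s4 := msmooth_dotn s1 s1.
by apply: msmoothD; apply: msmoothD => //; repeat (apply: msmoothM => //).
Qed.

Lemma msmooth_Qg : msm ratio_Q.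
Proof.
have k := @msmooth_cst R M A; have s1 := msmooth_rg; have s2 := msmooth_Lapn s1.
by apply: msmoothD => //; repeat (apply: msmoothM => //); apply: msmoothD => //; apply: msmoothM.
Qed.

Section Chart.
Variable a : atlas_index A.
Local Notation oU := (@cod_open R M A a).
Local Notation C := (smfun oU).
Local Notation lf := (@lf R M A a).
Local Notation half := (fr_half oU).
Local Notation cj := (fr_cj oU).
Local Notation XV := (XV oU (sPhi a)).
Local Notation fE := (chart_E (oU := oU) (sPhi a) (@fPhi a)).
Local Notation kap := (fr_kap oU (sPhi a) (@fPhi a)).
Local Notation HV := (HV oU (sPhi a) (@fPhi a)).
Local Notation F1 := (EV fE XV).
Local Notation F2 := (DV fE kap 1 F1).

Let X1 x : cod a x -> enorm (rep a x) = 1. Proof. by move=> _; exact: Phi1. Qed.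
Let cjK : involutive cj := @fr_cjK _ _ oU.
Let ED := fED (sPhi a) (@fPhi a) (oU := oU).
Let EM := fEM (sPhi a) (@fPhi a) (oU := oU).
Let halfE : 2 * half = 1 := ring_half oU.
Let Ecomm := fr_comm (oU := oU) (sPhi a) (@fPhi a).
Let Xreal := XV_real oU (sPhi a).
Let Hreal := HV_real oU (sPhi a) (@fPhi a).
Let XX := XX_1 oU (sPhi a) X1.
Let F11 : bdot F1 F1 = 0 := fr_F11 oU (sPhi a) (@fPhi a).
Let F1c1 : bdot F1 (cjV cj F1) = 2 := fr_F1c1 oU (sPhi a) (@fPhi a).
Let DbF1 := fr_DbF1 oU (sPhi a) (@fPhi a).
Let HX := fr_HX oU (sPhi a) X1 (@fPhi a).
Let HF1 := fr_HF1 oU (sPhi a) X1 (@fPhi a).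
Let parallel := parallelE oU (sPhi a) X1 (@fPhi a) (fun i x => par i (x := x)).

Definition iS : C := lf (fun=> invs).
(** The frame of the metric scaled by 1 + H^2; this factor is constant, so the connection
    coefficient scales in the same way. *)
Definition rE f : C := iS * fE f.
Definition rkap : C := iS * kap.
Definition rX := iS *: (XV - HV).

Lemma fE_cst k : fE (lf (fun=> k)) = 0.
Proof. by rewrite lf_cst /chart_E !sd_scst !mulr0 addr0. Qed.

Lemma cj_iS : cj iS = iS.
Proof. exact: cj_lf. Qed.

Lemma iS_sqr : iS * iS * (1 + bdot HV HV) = 1.
Proof.
apply: smfun_ext => x Ux; rewrite (h2_lf Phi1 sPhi fPhi) (smfun1 _ Ux) !smfunM smfunD (smfun1 _ Ux).
rewrite !lfE //; [|exact: msmooth_cst|exact: msmooth_h2g].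
rewrite -!rmorphM -(rmorph1 (real_complex R)) -rmorphD h2c -rmorphM invs_sqr.
by [].
Qed.

Lemma rED f g : rE (f + g) = rE f + rE g.
Proof. by rewrite /rE ED mulrDr. Qed.

Lemma rEM f g : rE (f * g) = rE f * g + f * rE g.
Proof. by rewrite /rE EM mulrDr mulrA [in iS * (f * _)]mulrCA. Qed.

Lemma rEb f : Eb cj rE f = iS * Eb cj fE f.
Proof. by rewrite /Eb /rE rmorphM cj_iS. Qed.

Lemma fE_iS : fE iS = 0. Proof. exact: fE_cst. Qed.

Lemma Eb_iS : Eb cj fE iS = 0.
Proof. by rewrite /Eb cj_iS fE_iS rmorph0. Qed.

Lemma rEcomm f : rE (Eb cj rE f) - Eb cj rE (rE f) = rkap * Eb cj rE f - cj rkap * rE f.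
Proof.
have aux (p q r s u v i : C) : p - q = u * r - v * s ->
    i * (i * p) - i * (i * q) = i * u * (i * r) - i * v * (i * s).
  by move=> e; transitivity (i * i * (p - q)); [ring|rewrite e; ring].
have e1 : rE (Eb cj rE f) = iS * (iS * fE (Eb cj fE f)).
  by rewrite rEb /rE EM fE_iS mul0r add0r.
have e2 : Eb cj rE (rE f) = iS * (iS * Eb cj fE (fE f)).
  by rewrite rEb /rE (EbM cjK EM) Eb_iS mul0r add0r.
rewrite e1 e2 rEb /rkap rmorphM cj_iS; exact: aux (Ecomm f).
Qed.

Lemma q0 : bdot HV F2 = 0.
Proof.
have e := q_lf Phi1 sPhi fPhi a.
apply: smfun_ext => x Ux; have := congr1 (fun f : C => f x) e.
rewrite lfE //; last exact: msmooth_Wg.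
rewrite W0 sqmodE => /(congr1 (@complex.Re R)) /= /eqP.
rewrite paddr_eq0 ?sqr_ge0 // !sqrf_eq0 => /andP[/eqP r0 /eqP i0].
exact: complex_ext.
Qed.

(** The factors [iS] of the frame and of the position vector cancel the 1 + H^2 of [EV_center]. The
    isotropy relations of [F1] thus carry over unchanged. *)
Lemma rE_rX : EV rE rX = F1.
Proof.
have e := EV_center cjK ED EM halfE Xreal Hreal DbF1 HX HF1 parallel q0.
apply/rowP => j; have := congr1 (fun u : 'rV[C]_n => u 0 j) e.
rewrite /rX; move: (XV - HV) (F1) => u v; rewrite !mxE => ej.
by rewrite /rE EM fE_iS mul0r add0r ej !mulrA iS_sqr mul1r.
Qed.

Lemma rX_real : cjV cj rX = rX.
Proof. by rewrite /rX cjVZ cjVD cjVN Xreal Hreal cj_iS. Qed.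

Lemma rF11 : bdot (EV rE rX) (EV rE rX) = 0. Proof. by rewrite rE_rX. Qed.

Lemma rF1c1 : bdot (EV rE rX) (cjV cj (EV rE rX)) = 2. Proof. by rewrite rE_rX. Qed.

Lemma rDbF1 : DbV cj rE rkap 1 (EV rE rX) = (-2) *: rX.
Proof.
rewrite rE_rX; have := DbF1; rewrite /rX; move: F1 => u; move: XV HV => v w e.
apply/rowP => j; have := congr1 (fun u : 'rV[C]_n => u 0 j) e.
have ck : cj rkap = iS * cj kap by rewrite /rkap rmorphM cj_iS.
rewrite /= !DbVj rEb ck.
have -> : (2 *: (w - v)) 0 j = 2 * (w 0 j - v 0 j) by rewrite !mxE.
have -> : (-2 *: (iS *: (v - w))) 0 j = -2 * (iS * (v 0 j - w 0 j)) by rewrite !mxE.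
move: (Eb cj fE (u 0 j)) => p; move: (u 0 j) (v 0 j) (w 0 j) (cj kap) iS => q r s t i {}e.
transitivity (i * (p - 1 * t * q)); first ring.
by rewrite e; ring.
Qed.

Lemma rXX : bdot rX rX = 1.
Proof.
have := iS_sqr; have := HX; have := XX; rewrite /rX; move: XV HV iS => v w i xx hx e.
rewrite -scaleN1r dotZl dotZr dotDl !dotDr !dotZl !dotZr (dotC v w) xx hx.
by rewrite -[RHS]e; ring.
Qed.

Local Notation rF1 := (EV rE rX).
Local Notation rF2 := (DV rE rkap 1 rF1).
Local Notation rtang := (tang cj rE half rX).

Lemma rtang_lf B f : msm f -> rtang B (lf f) = lf (scaled_grad B f).
Proof.
move=> sf; have := tang_lf sPhi fPhi a B sf => e.
have -> : lf (scaled_grad B f) = iS * lf (gradM B f).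
  by apply: lfM; [exact: msmooth_cst|exact: msmooth_grad].
rewrite -e /tang rE_rX rEb /rE.
move: (Eb cj fE (lf f)) => p; move: (fE (lf f)) => q.
by move: (cjV cj F1 0 B) (F1 0 B) iS half => *; ring.
Qed.

Lemma rlap_lf f : msm f -> lap cj rE rkap (lf f) = lf (scaled_lap f).
Proof.
move=> sf.
(* The rescaled surface is minimal, so the general lemma is used with mean curvature vector 0. *)
have h0 : cjV cj (0 : 'rV[C]_n) = 0 by apply/rowP => j; rewrite !mxE rmorph0.
have hF : bdot (0 : 'rV[C]_n) rF1 = 0 by rewrite -(scale0r 0) dotZl mul0r.
have hD : DbV cj rE rkap 1 rF1 = 2 *: (0 - rX).
  by rewrite rDbF1 sub0r scalerN scaleNr.
rewrite -(sum_tang_lap cjK rED rEM halfE rEcomm rX_real h0 rXX rF11 rF1c1 hD hF).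
have s B : msm (scaled_grad B f) by exact: msmooth_gradn.
rewrite /scaled_lap lf_sum; last by move=> B; apply: msmooth_gradn.
by apply: eq_bigr => B _; rewrite !rtang_lf.
Qed.

Lemma rsqr_lf f : msm f -> rE (lf f) * Eb cj rE (lf f) = lf (scaled_dot f f).
Proof.
move=> sf; rewrite -(sum_tang_sqr halfE rF11 rF1c1).
have s B : msm (scaled_grad B f) by exact: msmooth_gradn.
rewrite lf_sum; last by move=> B; apply: msmoothM.
by apply: eq_bigr => B _; rewrite rtang_lf // [RHS]lfM // expr2.
Qed.

Lemma rF2E : rF2 = iS *: F2.
Proof.
rewrite rE_rX /DV /rkap; move: F1 => u; apply/rowP => j.
have -> : (EV rE u + (1 * (iS * kap)) *: u) 0 j = rE (u 0 j) + iS * kap * u 0 j.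
  by rewrite !mxE mul1r.
have -> : (iS *: (EV fE u + (1 * kap) *: u)) 0 j = iS * (fE (u 0 j) + kap * u 0 j).
  by rewrite !mxE mul1r.
by rewrite /rE; move: (fE (u 0 j)) => p; ring.
Qed.

Lemma ra2 : bdot rF2 (cjV cj rF2) = lf (fun p => c^-1 * traceless_sqr p).
Proof.
have sa := @msmooth_a2g R M A N Phi sPhi fPhi.
rewrite rF2E cjVZ dotZl dotZr cj_iS (a2_lf Phi1 sPhi fPhi).
apply: smfun_ext => x Ux; rewrite !smfunM !lfE //; try exact: msmooth_cst.
  rewrite -!rmorphM; congr (_%:C%C); rewrite mulrA; congr (_ * _).
  by rewrite -[RHS]mul1r -invs_sqr mulfK // gt_eqF.
by apply: msmoothM => //; exact: msmooth_cst.
Qed.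

Definition rnu : C := lf (fun p => (c^-1 * traceless_sqr p)^-1).

Lemma ca2_gt0 p : 0 < c^-1 * traceless_sqr p.
Proof. by rewrite mulr_gt0 // invr_gt0. Qed.

Lemma msmooth_ca2 : msm (fun p => c^-1 * traceless_sqr p).
Proof. by apply: msmoothM; [exact: msmooth_cst|exact: msmooth_a2g]. Qed.

Lemma msmooth_ica2 : msm (fun p => (c^-1 * traceless_sqr p)^-1).
Proof. by apply: msmoothV msmooth_ca2 => p; rewrite gt_eqF // ca2_gt0. Qed.

Lemma rnuE : rnu * bdot rF2 (cjV cj rF2) = 1.
Proof.
rewrite ra2; apply: smfun_ext => x Ux; rewrite smfunM (smfun1 _ Ux) !lfE //.
- by rewrite -rmorphM mulVf // gt_eqF // ca2_gt0.
- exact: msmooth_ica2.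
- exact: msmooth_ca2.
Qed.

Lemma rhogE : lf rhog = half * bdot rF2 (cjV cj rF2).
Proof.
rewrite ra2; apply: smfun_ext => x Ux; rewrite smfunM (half_at oU Ux) !lfE //.
- by rewrite -rmorphM /rhog invfM mulrA.
- exact: msmooth_ca2.
- exact: msmooth_rhog.
Qed.

Definition rsig : C := rnu * rE (bdot rF2 (cjV cj rF2)).
Definition rG3 := DV rE rkap 2 rF2 - rsig *: rF2.
Definition rrr : C := rnu * bdot rG3 (cjV cj rG3).
Definition rw4 := DV rE rkap 3 rG3 - rsig *: rG3.
Definition rQQ : C := rnu * bdot rw4 (cjV cj rw4).
Definition rv5 := DV rE rkap 4 rw4 - rsig *: rw4.

Lemma rg_lf : lf ratio_r = rrr.
Proof.
have := lap_rho cjK rED rEM halfE rEcomm rX_real rF11 rF1c1 rDbF1 rnuE rhogE (erefl rsig)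
  (erefl rG3) (erefl rrr).
have s1 := msmooth_rhog.
rewrite (rlap_lf s1) (rsqr_lf s1) => e; apply: smfun_ext => x Ux.
rewrite (lfE msmooth_rg Ux).
have ep := lfE s1 Ux; have el := lfE (msmooth_Lapn s1) Ux; have ed := lfE (msmooth_dotn s1 s1) Ux.
have n3 := smfun_nat oU 3 Ux; have n4 := smfun_nat oU 4 Ux.
move: rrr (lf rhog) (lf (scaled_lap rhog)) (lf (scaled_dot rhog rhog)) (3%:R : C) (4%:R : C) n3 n4 ep el ed e => r p l d k3 k4 n3 n4 ep el ed.
move/(congr1 (fun f : C => f x)); rewrite !(smfunD, smfunM, smfunN) n3 n4 ep el ed.
have := rhog_gt0 (param (ch a) x); rewrite /ratio_r /irhog.
move: (r x) (rhog _) (scaled_lap _ _) (scaled_dot _ _ _) => r0 p0 l0 d0 pp e0.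
have pC : (p0%:C)%C != 0 by rewrite fmorph_eq0 gt_eqF.
have pR : p0 != 0 by rewrite gt_eqF.
(* [lap_rho] is stated without inverses, whereas [ratio_r] contains the square of 1 / rho. *)
apply: (mulfI pC); apply: (mulfI pC).
have E : p0 * (p0 * (p0^-1 * l0 + -1 * (p0^-1 * p0^-1 * d0) + (3 * p0 + -4))) =
    p0 * l0 - d0 + p0 * p0 * (3 * p0 - 4) by field.
rewrite -!rmorphM E.
rewrite !rmorphD rmorphN !rmorphM rmorphB rmorphM !rmorph_nat e0.
have cE t : (real_complex R : {rmorphism R -> R[i]}) t = t%:C%C by [].
by rewrite !cE; move: (p0%:C)%C (d0%:C)%C => *; ring.
Qed.

Lemma Qg_lf : lf ratio_Q = rQQ.
Proof.
have := lap_rr cjK rED rEM halfE rEcomm rX_real rF11 rF1c1 rDbF1 rnuE rhogE (erefl rsig)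
  (erefl rG3) (erefl rrr) (erefl rw4) (erefl rQQ).
have s1 := msmooth_rg.
rewrite -rg_lf (rlap_lf s1) => e; apply: smfun_ext => x Ux.
rewrite (lfE msmooth_Qg Ux).
have ep := lfE s1 Ux; have el := lfE (msmooth_Lapn s1) Ux.
have n2 := smfun_nat oU 2 Ux; have n1 := smfun1 oU Ux.
move: rQQ (lf ratio_r) (lf (scaled_lap ratio_r)) (1 : C) (2%:R : C) n1 n2 ep el e => r p l k1 k2 n1 n2 ep el.
move/(congr1 (fun f : C => f x)); rewrite !(smfunD, smfunM, smfunN) n2 n1 ep el.
rewrite /ratio_Q; move: (r x) (ratio_r _) (scaled_lap _ _) => r0 p0 l0 e0.
have cE t : (real_complex R : {rmorphism R -> R[i]}) t = t%:C%C by [].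
have -> : l0 + -2 * (p0 * (1 + -1 * p0)) = l0 - 2 * (p0 * (1 - p0)) by ring.
rewrite !(rmorphB, rmorphM, rmorph1, rmorph_nat) !cE e0.
by move: (p0%:C)%C => *; ring.
Qed.

Section AtPoint.
Variables (x : 'rV[R]_2) (Ux : cod a x).
Let p := param (ch a) x.
Let nu0 : R := (c^-1 * traceless_sqr p)^-1.

Lemma rnu_at : rnu x = nu0%:C%C.
Proof. by rewrite lfE //; exact: msmooth_ica2. Qed.

Lemma nu0_gt0 : 0 < nu0. Proof. by rewrite invr_gt0 ca2_gt0. Qed.

Lemma real_complex_inj (s t : R) : s%:C%C = t%:C%C -> s = t.
Proof. by move=> /(congr1 (@complex.Re R)). Qed.

Lemma rg_at : ratio_r p = nu0 * nsq rG3 x.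
Proof.
apply: real_complex_inj; have := congr1 (fun f : C => f x) rg_lf.
rewrite (lfE msmooth_rg Ux) => ->; rewrite /rrr smfunM nsqE rnu_at.
by rewrite -rmorphM.
Qed.

Lemma Qg_at : ratio_Q p = nu0 * nsq rw4 x.
Proof.
apply: real_complex_inj; have := congr1 (fun f : C => f x) Qg_lf.
rewrite (lfE msmooth_Qg Ux) => ->; rewrite /rQQ smfunM nsqE rnu_at.
by rewrite -rmorphM.
Qed.

Lemma rg_ge0_at : 0 <= ratio_r p.
Proof. by rewrite rg_at mulr_ge0 ?nsq_ge0 // ltW // nu0_gt0. Qed.

Lemma Qg_ge0_at : 0 <= ratio_Q p.
Proof. by rewrite Qg_at mulr_ge0 ?nsq_ge0 // ltW // nu0_gt0. Qed.

Lemma sqmod_nu (z : C) : sqmod (rnu * z) x = nu0 ^+ 2 * sqmod z x.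
Proof.
rewrite /sqmod smfunM rnu_at; case: (z x) => re im /=; ring.
Qed.

(** Cauchy-Schwarz applied to E r = nu (w4, G3). *)
Lemma dot_rg_at : scaled_dot ratio_r ratio_r p <= ratio_r p * ratio_Q p.
Proof.
have -> : scaled_dot ratio_r ratio_r p = sqmod (rE (lf ratio_r)) x.
  apply: real_complex_inj; rewrite -(lfE (msmooth_dotn msmooth_rg msmooth_rg) Ux).
  rewrite -(rsqr_lf msmooth_rg) -sqmodE; congr ((_ * _) x).
  by rewrite -[in RHS](cj_lf a ratio_r).
have := E_rr cjK rED rEM halfE rEcomm rX_real rF11 rF1c1 rDbF1 rnuE rhogE (erefl rsig)
  (erefl rG3) (erefl rrr) (erefl rw4).
rewrite -rg_lf => ->; rewrite sqmod_nu rg_at Qg_at.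
have aux (s u v m : R) : 0 < m -> s <= u * v -> m ^+ 2 * s <= m * v * (m * u).
  move=> m0 h; have -> : m * v * (m * u) = m ^+ 2 * (u * v) by ring.
  by rewrite ler_pM2l // exprn_gt0.
exact: aux nu0_gt0 (sqmod_dot_le rw4 rG3 Ux).
Qed.

(** The identity [lap_QQ] solved for |v5|^2 / |F2|^2, which makes that quantity a function on the
    surface. *)
Definition ratio_V q := scaled_lap ratio_Q q - 4 * ratio_r q * (1 - ratio_r q) ^+ 2 + 5 * scaled_dot ratio_r ratio_r q
  - (8 - 5 * ratio_r q - rhog q) * ratio_Q q.

Lemma Vg_at : ratio_V p = nu0 * nsq rv5 x.
Proof.
have := lap_QQ cjK rED rEM halfE rEcomm rX_real rF11 rF1c1 rDbF1 rnuE rhogE (erefl rsig)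
  (erefl rG3) (erefl rrr) (erefl rw4) (erefl rQQ) (erefl rv5).
have s1 := msmooth_rg; have s2 := msmooth_Qg; have s3 := msmooth_rhog.
rewrite -rg_lf -Qg_lf (rlap_lf s2) (rsqr_lf s1) => e.
have ep := lfE s1 Ux; have el := lfE (msmooth_Lapn s2) Ux; have eq := lfE s2 Ux.
have eh := lfE s3 Ux; have ed := lfE (msmooth_dotn s1 s1) Ux.
have n1 := smfun1 oU Ux; have n4 := smfun_nat oU 4 Ux; have n5 := smfun_nat oU 5 Ux.
have n8 := smfun_nat oU 8 Ux.
have ev : (rnu * bdot rv5 (cjV cj rv5)) x = (nu0 * nsq rv5 x)%:C%C.
  by rewrite smfunM nsqE rnu_at -rmorphM.
move: (rnu * _) (lf ratio_Q) (lf (scaled_lap ratio_Q)) (lf rhog) (lf (scaled_dot ratio_r ratio_r)) (lf ratio_r) ev eq el eh ed ep e.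
move: (1 : C) (4%:R : C) (5%:R : C) (8%:R : C) n1 n4 n5 n8 => k1 k4 k5 k8 n1 n4 n5 n8.
move=> v q l h d r ev eq el eh ed ep.
move/(congr1 (fun f : C => f x)); rewrite !(smfunD, smfunM, smfunN) n8 n5 n4 n1 ev eq el eh ed ep.
rewrite /ratio_V -/p; move: (nu0 * _) (ratio_Q p) (scaled_lap ratio_Q p) (rhog p) (scaled_dot ratio_r ratio_r p) (ratio_r p) => v0 q0 l0 h0 d0 r0 e0.
have cE t : (real_complex R : {rmorphism R -> R[i]}) t = t%:C%C by [].
apply: real_complex_inj.
have -> : l0 - 4 * r0 * (1 - r0) ^+ 2 + 5 * d0 - (8 - 5 * r0 - h0) * q0 =
  l0 - (4 * (r0 * ((1 - r0) * (1 - r0))) - 5 * d0 + (8 - 5 * r0 - h0) * q0) by ring.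
rewrite !(rmorphB, rmorphD, rmorphM, rmorph1, rmorph_nat) !cE e0.
move: (v0%:C)%C (q0%:C)%C (h0%:C)%C (d0%:C)%C (r0%:C)%C => *.
by ring.
Qed.

Lemma Vg_ge0_at : 0 <= ratio_V p.
Proof. by rewrite Vg_at mulr_ge0 ?nsq_ge0 // ltW // nu0_gt0. Qed.

(** Cauchy-Schwarz applied to E Q - 2 (1 - r) E r = nu (v5, w4); [sum_half_sqr] turns the modulus
    into the sum over ambient coordinates. *)
Lemma grad_Qg_at :
  \sum_B (scaled_grad B ratio_Q p - 2 * (1 - ratio_r p) * scaled_grad B ratio_r p) ^+ 2 <= ratio_V p * ratio_Q p.
Proof.
pose z : C := rnu * bdot rv5 (cjV cj rw4).
have zE : z = rE (lf ratio_Q) - 2 * (1 - lf ratio_r) * rE (lf ratio_r).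
  have := E_QQ cjK rED rEM halfE rEcomm rX_real rF11 rF1c1 rDbF1 rnuE rhogE (erefl rsig)
    (erefl rG3) (erefl rrr) (erefl rw4) (erefl rQQ) (erefl rv5).
  by rewrite -rg_lf -Qg_lf -/z => ->; rewrite addrK.
have czE : cj z = Eb cj rE (lf ratio_Q) - 2 * (1 - lf ratio_r) * Eb cj rE (lf ratio_r).
  have h f : cj (rE (lf f)) = Eb cj rE (lf f) by rewrite /Eb cj_lf.
  have c2 : cj (2 * (1 - lf ratio_r)) = 2 * (1 - lf ratio_r).
    by rewrite (rmorphM cj) rmorphB (rmorph1 cj) (cjn cj 2) cj_lf.
  by rewrite zE rmorphB h [cj (_ * rE _)](rmorphM cj) c2 h.
have s1 := msmooth_rg; have s2 := msmooth_Qg.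
have eT B : (half * (cjV cj rF1 0 B * z + rF1 0 B * cj z)) x =
    (scaled_grad B ratio_Q p - 2 * (1 - ratio_r p) * scaled_grad B ratio_r p)%:C%C.
  have -> : half * (cjV cj rF1 0 B * z + rF1 0 B * cj z) =
      rtang B (lf ratio_Q) - 2 * (1 - lf ratio_r) * rtang B (lf ratio_r).
    rewrite czE zE /tang; move: (cjV cj rF1 0 B) (rF1 0 B) => u v.
    move: (Eb cj rE (lf ratio_Q)) (Eb cj rE (lf ratio_r)) => q' r'.
    by move: (rE (lf ratio_Q)) (rE (lf ratio_r)) (lf ratio_r) half => *; ring.
  rewrite (rtang_lf B s1) (rtang_lf B s2).
  have e1 := lfE (msmooth_gradn B s1) Ux; have e2 := lfE (msmooth_gradn B s2) Ux.
  have er := lfE s1 Ux; have n1 := smfun1 oU Ux; have n2 := smfun_nat oU 2 Ux.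
  move: (lf (scaled_grad B ratio_r)) (lf (scaled_grad B ratio_Q)) (lf ratio_r) (1 : C) (2%:R : C) n1 n2 e1 e2 er => a1 a2 r k1 k2 n1 n2 e1 e2 er.
  rewrite !(smfunD, smfunN, smfunM) n1 n2 e1 e2 er.
  have cE t : (real_complex R : {rmorphism R -> R[i]}) t = t%:C%C by [].
  by rewrite !(rmorphB, rmorphM, rmorph1, rmorph_nat) !cE.
have -> : \sum_B (scaled_grad B ratio_Q p - 2 * (1 - ratio_r p) * scaled_grad B ratio_r p) ^+ 2 = sqmod z x.
  apply: real_complex_inj; rewrite -sqmodE -(sum_half_sqr halfE z (cj z) rF11 rF1c1).
  rewrite smfun_sum rmorph_sum; apply: eq_bigr => B _.
  by rewrite expr2 smfunM !eT -rmorphM -expr2.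
rewrite sqmod_nu Vg_at Qg_at.
have aux (s u v m : R) : 0 < m -> s <= u * v -> m ^+ 2 * s <= m * u * (m * v).
  move=> m0 h; have -> : m * u * (m * v) = m ^+ 2 * (u * v) by ring.
  by rewrite ler_pM2l // exprn_gt0.
exact: aux nu0_gt0 (sqmod_dot_le rv5 rw4 Ux).
Qed.

End AtPoint.
End Chart.
End RescaledSurface.

(** * Calculus rules for the rescaled metric *)

Section RescaledCalculus.
Variables (R : realType) (M : topologicalType) (A : smooth_atlas R M).
Variables (N : nat) (Phi : M -> 'rV[R]_N.+1).
Local Notation ch a := (@atlas_chart R M A a).
Local Notation cod a := (chart_cod (ch a)).
Local Notation rep a := (@local_rep R M A N Phi a).
Hypothesis sPhi : forall a, smooth_on (cod a) (rep a).
Hypothesis fPhi : forall a x, cod a x -> row_free (tangent_frame (rep a) x).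
Variable c : R.
Hypothesis c_gt0 : 0 < c.
Local Notation msm := (@msmooth R M A).
Local Notation gradn := (scaled_grad A Phi c).
Local Notation Lapn := (scaled_lap A Phi c).
Local Notation dotn := (scaled_dot A Phi c).
Implicit Types f g h : M -> R.

Lemma gradnD B f g p : msm f -> msm g ->
  gradn B (fun q => f q + g q) p = gradn B f p + gradn B g p.
Proof. by move=> sf sg; rewrite /scaled_grad gradMD // mulrDr. Qed.

Lemma gradnM B f g p : msm f -> msm g ->
  gradn B (fun q => f q * g q) p = f p * gradn B g p + g p * gradn B f p.
Proof. by move=> sf sg; rewrite /scaled_grad gradMM // mulrDr !(mulrCA (invs c)). Qed.

Lemma gradn_cst B (k : R) p : gradn B (fun=> k) p = 0.
Proof. by rewrite /scaled_grad gradM_cst mulr0. Qed.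

Lemma LapnD f g p : msm f -> msm g -> Lapn (fun q => f q + g q) p = Lapn f p + Lapn g p.
Proof.
move=> sf sg; rewrite /scaled_lap -big_split; apply: eq_bigr => B _.
have -> : gradn B (fun q => f q + g q) = fun q => gradn B f q + gradn B g q.
  by apply/funext => q; rewrite gradnD.
by rewrite gradnD //; exact: msmooth_gradn.
Qed.

Lemma LapnM f g p : msm f -> msm g ->
  Lapn (fun q => f q * g q) p = f p * Lapn g p + g p * Lapn f p + 2 * dotn f g p.
Proof.
move=> sf sg; rewrite /scaled_lap /scaled_dot !mulr_sumr -!big_split; apply: eq_bigr => B _ /=.
have s1 : msm (gradn B f) by exact: msmooth_gradn.
have s2 : msm (gradn B g) by exact: msmooth_gradn.
have -> : gradn B (fun q => f q * g q) = fun q => f q * gradn B g q + g q * gradn B f q.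
  by apply/funext => q; rewrite gradnM.
have aux (f0 g0 u v s t : R) : f0 * t + v * u + (g0 * s + u * v) = f0 * t + g0 * s + 2 * (u * v).
  by ring.
rewrite (gradnD _ _ (msmoothM sf s2) (msmoothM sg s1)) (gradnM _ _ sf s2) (gradnM _ _ sg s1).
exact: aux.
Qed.

Lemma Lapn_cst (k : R) p : Lapn (fun=> k) p = 0.
Proof.
rewrite /scaled_lap big1 // => B _.
have -> : gradn B (fun=> k) = fun=> 0 by apply/funext => q; exact: gradn_cst.
exact: gradn_cst.
Qed.

Lemma LapnZ k f p : msm f -> Lapn (fun q => k * f q) p = k * Lapn f p.
Proof.
move=> sf; rewrite LapnM //; last exact: msmooth_cst.
by rewrite Lapn_cst /scaled_dot big1 ?mulr0 ?addr0 // => B _; rewrite gradn_cst mul0r.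
Qed.

Lemma LapnE f p : msm f -> Lapn f p = c^-1 * LapM A Phi f p.
Proof.
move=> sf; rewrite /scaled_lap /LapM mulr_sumr; apply: eq_bigr => B _.
rewrite /scaled_grad gradMM //; [|exact: msmooth_cst|exact: msmooth_grad].
rewrite gradM_cst mulr0 addr0 mulrA; congr (_ * _).
by rewrite -[LHS]mulr1 -(mulfV (lt0r_neq0 c_gt0)) mulrA invs_sqr // mul1r.
Qed.

Lemma Lapn_max f p : msm f -> (forall q, f q <= f p) -> Lapn f p <= 0.
Proof.
move=> sf fp; rewrite LapnE // pmulr_rle0 ?invr_gt0 //.
exact: (LapM_max sPhi fPhi sf fp).
Qed.

Lemma Lapn_strong_max f : [set: M] !=set0 -> compact [set: M] -> connected [set: M] ->
  msm f -> (forall p, 0 <= Lapn f p) -> forall p q, f p = f q.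
Proof.
move=> M0 cM conM sf Lf; have [p0 h] := max_exists M0 cM sf.
have L p : 0 <= LapM A Phi f p.
  by have := Lf p; rewrite LapnE // pmulr_rge0 ?invr_gt0.
by move=> p q; rewrite !(strong_max sPhi fPhi conM sf L h (erefl _)).
Qed.

Lemma Lapn0_of_cst f : (forall p q, f p = f q) -> forall p, Lapn f p = 0.
Proof.
move=> fc p; have -> : f = fun=> f p by apply/funext => q; exact: fc.
exact: Lapn_cst.
Qed.

End RescaledCalculus.

(** * Polynomial inequalities for the test function *)

Section TestFunction.
Variable F : realFieldType.
Implicit Types (e u r : F).

(* [tx e] = (9 - e) / 5 is the minimum of rho, [tm e] = 3 (tx e) - 4, [trb e] bounds r
   and [tu e] bounds u = 1 - tx e / rho.  The test function is
     (1 - u)^2 Q - 5 (tx e) r + 7 r^2 / 2 + (tg e (r - tm e) + tf e) u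
       + (tK e + th e (r - tm e)) u^2 / 2,
   whose coefficients [tg], [th], [tK], [tf] were found numerically. *)
Definition tg e := 20 - 10 * e.
Definition th e := 60 - 30 * e.
Definition tK e := 255 - 225 * e.
Definition tf e := (28 - 100 * e + 57 * e ^+ 2) / 5.
Definition tx e := (9 - e) / 5.
Definition tm e := (7 - 3 * e) / 5.
Definition trb e := 23 / 15 - e / 9.
Definition tu e := e * (7 - e) / 198.

(** [t_r], [t_u] and [t_uu] are the derivatives in r and u of the test function without its Q-term.
    The coefficients -5 tx and 7/2 are forced: Lap ((1-u)^2 Q) contributes (5 tx - 7 r) Q at u = 0,
    which [t_r] cancels there. *)
Definition t_r e u r := - 5 * tx e + 7 * r + tg e * u + th e * u ^+ 2 / 2.
Definition t_uu e r := tK e + th e * (r - tm e).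
Definition t_u e u r := tg e * (r - tm e) + tf e + t_uu e r * u.
(** What remains of the Laplacian of the test function without the terms in Q, V and gradients. The
    last factor uses (1 - u) rho = tx and tm = 3 tx - 4, which give (1 - u) (r - 3 rho + 4) = r - tm
    - (r + 4) u. *)
Definition tR e u r := 4 * (1 - u) ^+ 2 * r * (1 - r) ^+ 2 + 2 * r * (1 - r) * t_r e u r +
  (r - tm e - (r + 4) * u) * t_u e u r.
(** With w = 1 - u, the terms quadratic in grad r and grad log rho have coefficients 7 - 5 w^2 = 2 +
    10 u - 5 u^2, w tX (mixed) and w tP; [tX_le] is the discriminant condition for this form. *)
Definition tX e u r := tg e + th e * u - 4 * (1 - u) * (1 - r).
Definition tP e u r := t_uu e r * (1 - 2 * u) - tg e * (r - tm e) - tf e.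

Definition tp0 e u := 4 * (1 - u) ^+ 2 * tm e * (1 - tm e) ^+ 2
  + 2 * tm e * (1 - tm e) * (7 * tm e - 5 * tx e + tg e * u + th e * u ^+ 2 / 2)
  - (tm e + 4) * u * (tf e + tK e * u).
Definition tp1 e u := 4 * (1 - u) ^+ 2 * (1 - tm e) * (1 - 3 * tm e)
  + 2 * ((1 - 2 * tm e) * (7 * tm e - 5 * tx e + tg e * u + th e * u ^+ 2 / 2) + 7 * tm e * (1 - tm e))
  + (1 - u) * (tf e + tK e * u) - (tm e + 4) * u * (tg e + th e * u).
Definition tp2 e u := 4 * (1 - u) ^+ 2 * (3 * tm e - 2)
  + 2 * (7 * (1 - 2 * tm e) - (7 * tm e - 5 * tx e + tg e * u + th e * u ^+ 2 / 2))
  + (1 - u) * (tg e + th e * u).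
Definition tp3 u : F := 4 * (1 - u) ^+ 2 - 14.

Lemma tR_expand e u r : let n := r - tm e in
  tR e u r = tp0 e u + tp1 e u * n + (tp2 e u + tp3 u * n) * n ^+ 2.
Proof. rewrite /= /tR /t_r /t_u /t_uu /tp0 /tp1 /tp2 /tp3; ring. Qed.

(** On surfaces of constant rho one has u = 0 and n = 0. The value there vanishes at e = 0 and e =
    2/3, where the Calabi spheres lie; nonnegativity near n = 0 then forces the linear term to
    vanish too, and both carry the factor e (2 - 3 e). *)
Lemma tR_zero e r : let n := r - tm e in
  tR e 0 r = e * (2 - 3 * e) * ((28 - 12 * e) / 25 - n) + (2 + 6 * e - 10 * n) * n ^+ 2.
Proof.
rewrite /= /tR /t_r /t_u /t_uu /tg /th /tK /tf /tx /tm; by field.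
Qed.

Section Bounds.
Variables (e : F) (e_ge0 : 0 <= e) (e_le : e <= 2 / 3).

(* The polynomials bounded below have nonnegative Bernstein coefficients on
   [0, 2/3], which reduces each bound to linear arithmetic. *)
Lemma bernstein_ge0 i j : 0 <= e ^+ i * (2 / 3 - e) ^+ j.
Proof. by rewrite mulr_ge0 ?exprn_ge0 // subr_ge0. Qed.

Lemma tp0_ge : e / 20 <= tp0 e (tu e).
Proof.
have := bernstein_ge0 0 7; have := bernstein_ge0 1 6; have := bernstein_ge0 2 5;
  have := bernstein_ge0 3 4; have := bernstein_ge0 4 3; have := bernstein_ge0 5 2;
  have := bernstein_ge0 6 1; have := bernstein_ge0 7 0.
rewrite /tp0 /tp1 /tp2 /tp3 /tu /trb /tg /th /tK /tf /tx /tm !expr0 !mul1r !mulr1; lra.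
Qed.

Lemma tp1_ge0 : 0 <= tp1 e (tu e).
Proof.
have := bernstein_ge0 0 6; have := bernstein_ge0 1 5; have := bernstein_ge0 2 4;
  have := bernstein_ge0 3 3; have := bernstein_ge0 4 2; have := bernstein_ge0 5 1;
  have := bernstein_ge0 6 0.
rewrite /tp0 /tp1 /tp2 /tp3 /tu /trb /tg /th /tK /tf /tx /tm !expr0 !mul1r !mulr1; lra.
Qed.

Lemma tp1_le : tp1 e (tu e) <= e / 3.
Proof.
have := bernstein_ge0 0 6; have := bernstein_ge0 1 5; have := bernstein_ge0 2 4;
  have := bernstein_ge0 3 3; have := bernstein_ge0 4 2; have := bernstein_ge0 5 1;
  have := bernstein_ge0 6 0.
rewrite /tp0 /tp1 /tp2 /tp3 /tu /trb /tg /th /tK /tf /tx /tm !expr0 !mul1r !mulr1; lra.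
Qed.

Lemma tA_ge : 3 / 5 <= tp2 e (tu e) + tp3 (tu e) * (trb e - tm e).
Proof.
have := bernstein_ge0 0 6; have := bernstein_ge0 1 5; have := bernstein_ge0 2 4;
  have := bernstein_ge0 3 3; have := bernstein_ge0 4 2; have := bernstein_ge0 5 1;
  have := bernstein_ge0 6 0.
rewrite /tp0 /tp1 /tp2 /tp3 /tu /trb /tg /th /tK /tf /tx /tm !expr0 !mul1r !mulr1; lra.
Qed.

Lemma tu_ge0 : 0 <= tu e.
Proof. by rewrite /tu; have := e_ge0; have := e_le; nra. Qed.

Lemma tu_le : tu e <= e / 28.
Proof. by rewrite /tu; have := e_ge0; have := e_le; nra. Qed.

(* The polynomial of [tX_rbar_le] is D0 - D1 u - D2 u^2 + D3 u^3. *)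
Let D0 := (19 + 131 / 225) + (86 + 16 / 135) * e - (151 + 179 / 405) * e ^+ 2.
Let D1 := (576 + 26 / 75) - (972 + 14 / 45) * e + (661 + 11 / 27) * e ^+ 2.
Let D2 := (7320 + 49 / 75) - (5837 + 16 / 45) * e - (143 + 2 / 27) * e ^+ 2.
Let D3 := (5978 + 124 / 225) - (5417 + 31 / 135) * e + (726 + 70 / 81) * e ^+ 2.

Let D012_ge0 : 0 <= D0 - D1 * (e / 28) - D2 * (e / 28) ^+ 2.
Proof.
have := bernstein_ge0 0 4; have := bernstein_ge0 1 3; have := bernstein_ge0 2 2;
  have := bernstein_ge0 3 1; have := bernstein_ge0 4 0.
rewrite /D0 /D1 /D2 /D3 !expr0 !mul1r !mulr1; lra.
Qed.

Let D1_ge0 : 0 <= D1.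
Proof.
have := bernstein_ge0 0 2; have := bernstein_ge0 1 1; have := bernstein_ge0 2 0.
rewrite /D0 /D1 /D2 /D3 !expr0 !mul1r !mulr1; lra.
Qed.

Let D2_ge0 : 0 <= D2.
Proof.
have := bernstein_ge0 0 2; have := bernstein_ge0 1 1; have := bernstein_ge0 2 0.
rewrite /D0 /D1 /D2 /D3 !expr0 !mul1r !mulr1; lra.
Qed.

Let D3_ge0 : 0 <= D3.
Proof.
have := bernstein_ge0 0 2; have := bernstein_ge0 1 1; have := bernstein_ge0 2 0.
rewrite /D0 /D1 /D2 /D3 !expr0 !mul1r !mulr1; lra.
Qed.

Lemma tX_rbar_le u : 0 <= u -> u <= e / 28 ->
  0 <= (2 + 10 * u - 5 * u ^+ 2) * tP e u (trb e) - (1 - u) * tX e u (trb e) ^+ 2.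
Proof.
move=> u0 ul.
(* The linear and quadratic terms decrease in u, so they are bounded by their values at e / 28,
   leaving a polynomial in e alone; the cubic term is nonnegative. *)
have -> : (2 + 10 * u - 5 * u ^+ 2) * tP e u (trb e) - (1 - u) * tX e u (trb e) ^+ 2 =
    (D0 - D1 * (e / 28) - D2 * (e / 28) ^+ 2) + (e / 28 - u) * (D1 + D2 * (e / 28 + u)) + D3 * u ^+ 3.
  by rewrite /D0 /D1 /D2 /D3 /tX /tP /t_uu /tg /th /tK /tf /tm /trb; field.
apply: addr_ge0; last exact: mulr_ge0 D3_ge0 (exprn_ge0 _ u0).
apply: addr_ge0 D012_ge0 _; apply: mulr_ge0; first by rewrite subr_ge0.
apply: addr_ge0 D1_ge0 _; apply: mulr_ge0 D2_ge0 _; apply: addr_ge0 u0.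
by rewrite divr_ge0.
Qed.

Lemma bernoulli9 (t : F) : 0 <= t -> t <= 1 / 8 -> 1 - 9 * t <= (1 - t) ^+ 9.
Proof.
move=> t0 t1.
have h2 : 1 - 2 * t <= (1 - t) ^+ 2 by have := sqr_ge0 t; rewrite !expr2; lra.
have h4 : 1 - 4 * t <= (1 - t) ^+ 4.
  have -> : (1 - t) ^+ 4 = ((1 - t) ^+ 2) ^+ 2 by rewrite -exprM.
  have : (1 - 2 * t) ^+ 2 <= ((1 - t) ^+ 2) ^+ 2 by rewrite lerXn2r ?nnegrE // ?sqr_ge0 //; lra.
  by have := sqr_ge0 t; move: (((1 - t) ^+ 2) ^+ 2) => k; rewrite !expr2; lra.
have h8 : 1 - 8 * t <= (1 - t) ^+ 8.
  have -> : (1 - t) ^+ 8 = ((1 - t) ^+ 4) ^+ 2 by rewrite -exprM.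
  have : (1 - 4 * t) ^+ 2 <= ((1 - t) ^+ 4) ^+ 2 by rewrite lerXn2r ?nnegrE // ?exprn_ge0 //; lra.
  by have := sqr_ge0 t; move: (((1 - t) ^+ 4) ^+ 2) => k; rewrite !expr2; lra.
rewrite exprS; have : (1 - t) * (1 - 8 * t) <= (1 - t) * (1 - t) ^+ 8 by apply: ler_wpM2l => //; lra.
by have := sqr_ge0 t; move: ((1 - t) * (1 - t) ^+ 8) => k; rewrite !expr2; lra.
Qed.

(** The hypothesis on [b] reads b <= 4 q - 17/3, whose value at q = 9/5 is 23/15 = trb 0.
    Multiplying by 1 - u replaces q by tx and raises the exponent to 9, after which Bernoulli's
    inequality leaves a polynomial condition at u = tu e. *)
Lemma rbar_le u a b q : 0 <= u -> u <= tu e -> q * (1 - u) = tx e ->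
  2 + 6 * b - 8 * (3 * q - 4) <= 0 -> (1 - u) ^+ 8 * a <= b -> a <= trb e.
Proof.
move=> u0 ul qu bq ab; have um := tu_le; have el := e_le.
have w0 : 0 < 1 - u by lra.
have trb0 : 0 < trb e by rewrite /trb; lra.
rewrite leNgt; apply/negP => ra.
have k2 : (1 - u) ^+ 9 * a <= (1 - u) * b by rewrite exprS -mulrA ler_pM2l.
have k3 : (1 - u) * b <= 4 * tx e - 17 / 3 * (1 - u).
  rewrite -qu; have -> : 4 * (q * (1 - u)) - 17 / 3 * (1 - u) = (1 - u) * (4 * q - 17 / 3) by ring.
  by rewrite ler_pM2l //; lra.
have k4 : (1 - u) ^+ 9 * trb e < (1 - u) ^+ 9 * a by rewrite ltr_pM2l // exprn_gt0.
have k5 : 1 - 9 * u <= (1 - u) ^+ 9 by apply: bernoulli9 => //; lra.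
have k6 : (1 - 9 * u) * trb e <= (1 - u) ^+ 9 * trb e by rewrite ler_pM2r.
have k7 : u * trb e <= tu e * trb e by rewrite ler_pM2r.
have k8 : 4 * tx e <= (1 - 9 * tu e) * trb e + 17 / 3 * (1 - tu e).
  have b0 := bernstein_ge0 0 3; have b1 := bernstein_ge0 1 2.
  have b2 := bernstein_ge0 2 1; have b3 := bernstein_ge0 3 0.
  rewrite ?expr0 ?mul1r ?mulr1 in b0 b1 b2 b3.
  by rewrite /tx /tu /trb; lra.
by move: k2 k3 k4 k6; move: ((1 - u) ^+ 9) => k *; lra.
Qed.

Variables (r : F) (r_ge0 : 0 <= r) (r_le : r <= trb e).

Lemma eta_le : r - tm e <= 2 / 15 + 22 * e / 45.
Proof. by have := r_le; rewrite /trb /tm; lra. Qed.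

Lemma tR_zero_ge0 : 0 <= tR e 0 r.
Proof.
have n := eta_le; rewrite tR_zero /=; have a := e_ge0; have b := e_le.
have c : 0 <= 2 - 3 * e by lra.
have d : 0 <= (28 - 12 * e) / 25 - (r - tm e) by lra.
have f : 0 <= 2 + 6 * e - 10 * (r - tm e) by lra.
exact: addr_ge0 (mulr_ge0 (mulr_ge0 a c) d) (mulr_ge0 f (sqr_ge0 _)).
Qed.

Lemma tR_zero_gt0 : 0 < e -> e < 2 / 3 -> 0 < tR e 0 r.
Proof.
move=> a b; have n := eta_le; rewrite tR_zero /=.
have c : 0 < 2 - 3 * e by lra.
have d : 0 < (28 - 12 * e) / 25 - (r - tm e) by lra.
have f : 0 <= 2 + 6 * e - 10 * (r - tm e) by lra.
exact: ltr_wpDr (mulr_ge0 f (sqr_ge0 _)) (mulr_gt0 (mulr_gt0 a c) d).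
Qed.

(** As a polynomial in n = r - tm this has [tp3] <= 0, so the coefficient of n^2 is least at r = trb
    e, where it is at least 3/5. Completing the square leaves p0 - 5/12 p1^2, and p0 >= e / 20
    dominates since p1^2 <= e^2 / 9. *)
Lemma tR_max_gt0 : 0 < e -> 0 < tR e (tu e) r.
Proof.
move=> e0; rewrite tR_expand /=.
have u0 := tu_ge0; have ul := tu_le; have a := tA_ge; have b := tp0_ge; have c := tp1_ge0; have d := tp1_le.
have n : r - tm e <= trb e - tm e by rewrite lerD2r.
have p3 : tp3 (tu e) <= 0.
  have u1 : tu e <= 1 by have := e_le; lra.
  have : (1 - tu e) ^+ 2 <= 1 by rewrite exprn_ile1 // ?subr_ge0 // gerBl.
  by rewrite /tp3; lra.
set A := tp2 e (tu e) + tp3 (tu e) * (r - tm e).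
have A35 : 3 / 5 <= A by apply: le_trans a _; rewrite lerD2l ler_wnM2l.
move: A A35 (tp0 _ _) (tp1 _ _) (r - tm e) b c d {a n p3} => A A35 p0 p1 n b c d.
have h : 3 / 5 * n ^+ 2 <= A * n ^+ 2 by rewrite ler_wpM2r ?sqr_ge0.
have q : p1 ^+ 2 <= e * e / 9.
  have -> : e * e / 9 = (e / 3) ^+ 2 by field.
  by rewrite lerXn2r ?nnegrE //; lra.
have s : 0 <= (3 / 5 * n + p1 / 2) ^+ 2 by exact: sqr_ge0.
have l : e * e <= e * (2 / 3) by apply: ler_wpM2l => //; exact: e_le.
have -> : p0 + p1 * n + A * n ^+ 2 = (A * n ^+ 2 - 3 / 5 * n ^+ 2) + 5 / 3 * (3 / 5 * n + p1 / 2) ^+ 2 + (p0 - 5 / 12 * p1 ^+ 2).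
  by field.
have : 0 < p0 - 5 / 12 * p1 ^+ 2 by lra.
by lra.
Qed.

Lemma t_uu_ge : 60 <= t_uu e r.
Proof.
have a := e_ge0; have b := e_le; have c := r_ge0.
have h : 0 <= th e by rewrite /th; lra.
have d : 0 <= th e * r by rewrite mulr_ge0.
have f : 0 <= e * (2 / 3 - e) by rewrite mulr_ge0 // subr_ge0.
have -> : t_uu e r = tK e - th e * tm e + th e * r by rewrite /t_uu; ring.
have : 60 <= tK e - th e * tm e by rewrite /tK /th /tm; lra.
by lra.
Qed.

Lemma trb_le : trb e <= 23 / 15.
Proof. by rewrite /trb; have := e_ge0; lra. Qed.

(** [tR] is quadratic in u, and its leading coefficient is negative thanks to the size of [t_uu];
    hence only the two ends u = 0 and u = tu e have to be examined. *)
Lemma tR_concave u : 0 <= u -> u <= tu e -> (tu e - u) * tR e 0 r + u * tR e (tu e) r <= tu e * tR e u r.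
Proof.
move=> u0 ul; rewrite -subr_ge0.
have -> : tu e * tR e u r - ((tu e - u) * tR e 0 r + u * tR e (tu e) r) =
    ((r + 4) * t_uu e r - 4 * r * (1 - r) ^+ 2 - r * (1 - r) * th e) * (u * (tu e * (tu e - u))).
  by rewrite /tR /t_r /t_u; move: (tu e) (tx e) (tg e) (th e) (tf e) (tm e) (t_uu e r) => *; field.
have u1 := tu_ge0; have u2 : 0 <= tu e - u by rewrite subr_ge0.
apply: mulr_ge0; last exact: mulr_ge0 u0 (mulr_ge0 u1 u2).
have k := t_uu_ge; have rb := le_trans r_le trb_le; have a := e_ge0; have r0 := r_ge0.
have m1 : 0 <= (r + 4) * (t_uu e r - 60) by rewrite mulr_ge0 ?subr_ge0 //; lra.
have m2 : 0 <= r * r * (23 / 15 - r) by rewrite !mulr_ge0 ?subr_ge0.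
have m3 : 0 <= (2 / 3 - e) * (r * r) by rewrite !mulr_ge0 ?subr_ge0 //; exact: e_le.
have m4 : 0 <= e * r by rewrite mulr_ge0.
have m5 : 0 <= r * r by rewrite mulr_ge0.
by rewrite /th; lra.
Qed.

Lemma tR_ge0 u : 0 < e -> 0 <= u -> u <= tu e -> 0 <= tR e u r.
Proof.
move=> e0 u0 ul; have c := tR_concave u0 ul; have a := tR_zero_ge0; have b := tR_max_gt0 e0.
have u1 : 0 < tu e.
  by have := e_le; rewrite /tu => h; rewrite divr_gt0 // mulr_gt0 //; lra.
rewrite -(pmulr_rge0 _ u1); apply: le_trans c; apply: addr_ge0; apply: mulr_ge0 => //.
  by rewrite subr_ge0.
exact: ltW.
Qed.

Lemma tR_eq0 u : 0 < e -> 0 <= u -> u <= tu e -> tR e u r = 0 -> u = 0 /\ e = 2 / 3.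
Proof.
move=> e0 u0 ul R0; have c := tR_concave u0 ul; have a := tR_zero_ge0; have b := tR_max_gt0 e0.
have d : 0 <= (tu e - u) * tR e 0 r by rewrite mulr_ge0 // subr_ge0.
have uz : u = 0.
  apply/eqP; rewrite eq_le u0 andbT leNgt; apply/negP => up.
  have : 0 < u * tR e (tu e) r by exact: mulr_gt0.
  by move: c; rewrite R0 mulr0; lra.
split => //; apply/eqP; rewrite eq_le e_le /= leNgt; apply/negP => e2.
by have := tR_zero_gt0 e0 e2; rewrite uz in R0; rewrite R0 ltxx.
Qed.

(** Expanded in q = trb e - r >= 0, the difference is its value at r = trb e plus q times a
    nonnegative factor, so the extreme value of r is the worst. *)
Lemma tX_le u : 0 <= u -> u <= tu e -> (1 - u) * tX e u r ^+ 2 <= (2 + 10 * u - 5 * u ^+ 2) * tP e u r.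
Proof.
move=> u0 ul.
set q := trb e - r.
set T := tX e u (trb e).
have q0 : 0 <= q by rewrite subr_ge0.
have E : (2 + 10 * u - 5 * u ^+ 2) * tP e u r - (1 - u) * tX e u r ^+ 2 =
   ((2 + 10 * u - 5 * u ^+ 2) * tP e u (trb e) - (1 - u) * T ^+ 2)
   + q * (8 * (1 - u) ^+ 2 * T - (2 + 10 * u - 5 * u ^+ 2) * (th e * (1 - 2 * u) - tg e) - 16 * (1 - u) ^+ 3 * q).
  by rewrite /q /T /tX /tP /t_uu; ring.
have a := e_ge0; have b := e_le; have um : u <= e / 28 := le_trans ul tu_le.
have w1 : 41 / 42 <= 1 - u by lra.
have w2 : 19 / 20 <= (1 - u) ^+ 2.
  by apply: le_trans (_ : (41 / 42) ^+ 2 <= _); [lra|rewrite lerXn2r ?nnegrE //; lra].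
have w3 : (1 - u) ^+ 3 <= 1 by rewrite exprn_ile1 // ?subr_ge0 ?gerBl //; lra.
have Tg : tg e + 3 / 2 <= T.
  have k1 : 0 <= th e * u by rewrite mulr_ge0 // /th; lra.
  have k2 : 0 <= (1 - u - 41 / 42) * (trb e - 1) by apply: mulr_ge0; rewrite /trb; lra.
  rewrite /T /tX; move: k2; rewrite /trb; move: k1; rewrite /trb /tg /th; nra.
have F2 : 0 <= 8 * (1 - u) ^+ 2 * T - (2 + 10 * u - 5 * u ^+ 2) * (th e * (1 - 2 * u) - tg e)
    - 16 * (1 - u) ^+ 3 * q.
  have g13 : 40 / 3 <= tg e by rewrite /tg; lra.
  have k1 : 0 <= ((1 - u) ^+ 2 - 19 / 20) * T by apply: mulr_ge0; lra.
  have k2 : 0 <= (1 - (1 - u) ^+ 3) * q by apply: mulr_ge0; lra.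
  have k3 : q <= 23 / 15 by have := trb_le; have := r_ge0; rewrite /q; lra.
  have k4 : 0 <= 2 * tg e - (th e * (1 - 2 * u) - tg e).
    have k : 0 <= th e * u by rewrite mulr_ge0 // /th; lra.
    have -> : 2 * tg e - (th e * (1 - 2 * u) - tg e) = 2 * (th e * u) by rewrite /th /tg; ring.
    by rewrite mulr_ge0.
  have k5 : 0 <= th e * (1 - 2 * u) - tg e.
    have -> : th e * (1 - 2 * u) - tg e = tg e * (2 - 6 * u) by rewrite /th /tg; ring.
    by rewrite mulr_ge0 //; lra.
  have k6 : 0 <= (9 / 4 - (2 + 10 * u - 5 * u ^+ 2)) * (th e * (1 - 2 * u) - tg e).
    by apply: mulr_ge0 => //; have := sqr_ge0 u; lra.
  move: ((1 - u) ^+ 2) ((1 - u) ^+ 3) (T) (th e * (1 - 2 * u) - tg e) (2 + 10 * u - 5 * u ^+ 2) (tg e) w2 w3 Tg g13 k1 k2 k3 k4 k5 k6 => A B C D E' G; lra.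
have F1 := tX_rbar_le u0 um.
rewrite -subr_ge0 E; exact: addr_ge0 F1 (mulr_ge0 q0 F2).
Qed.

Lemma sqr_le_ge (s t : F) : 0 <= t -> s ^+ 2 <= t ^+ 2 -> - t <= s.
Proof.
move=> t0 st; rewrite lerNl; apply: le_trans (_ : `|s| <= _); first by rewrite -normrN ler_norm.
by rewrite -(ler_pXn2r (n := 2)) ?nnegrE // real_normK // num_real.
Qed.

(** The trace of the product of two positive semidefinite symmetric 2 x 2 matrices is
    nonnegative. *)
Lemma sqr_form_ge0 (X Y P y p z : F) : 0 <= Y -> 0 <= P -> 0 <= y -> 0 <= p ->
  X ^+ 2 <= Y * P -> z ^+ 2 <= p * y -> 0 <= Y * y + 2 * X * z + P * p.
Proof.
move=> Y0 P0 y0 p0 XX zz.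
suff : - (Y * y + P * p) <= 2 * X * z by lra.
apply: sqr_le_ge; first by rewrite addr_ge0 // mulr_ge0.
have h : X ^+ 2 * z ^+ 2 <= Y * P * (p * y) by rewrite ler_pM ?sqr_ge0.
have := sqr_ge0 (Y * y - P * p).
by move: h; rewrite !expr2; lra.
Qed.

(** Here p = |grad log rho|^2, y = |grad r|^2, and z, b are the products of grad log rho with grad r
    and with grad Q - 2 (1 - r) grad r. The exponent 2 of w in front of Q is the one that cancels
    the constant 8 in Lap Q. *)
Lemma test_laplacian_ge u rho Q V p y z b LQ : let w := 1 - u in let m := 3 * rho - 4 in
  0 <= u -> u <= tu e -> rho * w = tx e ->
  0 <= Q -> 0 <= V -> 0 <= p -> 0 <= y ->
  z ^+ 2 <= p * y -> b ^+ 2 <= p * (V * Q) ->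
  LQ = V + 4 * r * (1 - r) ^+ 2 - 5 * y + (8 - 5 * r - rho) * Q ->
  tR e u r <= w ^+ 2 * LQ + Q * (w ^+ 2 * (4 * p - 2 * (r - m))) - 4 * w ^+ 2 * (b + 2 * (1 - r) * z)
    + t_r e u r * (Q + 2 * r * (1 - r)) + t_u e u r * (w * (r - m - p))
    + 7 * y + 2 * (tg e + th e * u) * w * z + t_uu e r * w ^+ 2 * p.
Proof.
move=> w m u0 ul rw Q0 V0 p0 y0 zz bb ->.
have a := e_ge0; have a' := e_le; have um := tu_le; have r0 := r_ge0.
have u1 : u <= 1 / 42 by lra.
have w0 : 0 <= w by rewrite /w; lra.
pose C := 7 * r * (2 * u - u ^+ 2) + u * (tg e - 5 * tx e) + th e * u ^+ 2 / 2.
rewrite -subr_ge0.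
set L := (X in 0 <= X).
(* The parts are a semidefinite form by b^2 <= p V Q, the remaining coefficient of Q, the form in
   the two gradients, and a multiple of rho w - tx, which is zero. *)
have -> : L = w ^+ 2 * (1 * V + 2 * (-2) * b + 4 * (Q * p)) + C * Q +
   ((2 + 10 * u - 5 * u ^+ 2) * y + 2 * (w * tX e u r) * z + (w * tP e u r) * p)
   + (5 * w * Q - 3 * t_u e u r) * (rho * w - tx e).
  rewrite /L /C /m /w /tR /tX /tP /t_u /t_r.
  have -> : tm e = 3 * tx e - 4 by rewrite /tm /tx; field.
  by move: (tx e) (tg e) (th e) (tf e) (t_uu e r) => *; field.
rewrite rw subrr mulr0 addr0.
have uu : 0 <= u * (1 - u) by rewrite mulr_ge0.
have C0 : 0 <= C.
  have k1 : 0 <= r * (2 * u - u ^+ 2) by rewrite mulr_ge0 //; lra.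
  have k2 : 0 <= u * (tg e - 5 * tx e) by rewrite mulr_ge0 // /tg /tx; lra.
  have k3 : 0 <= th e * u ^+ 2 by rewrite mulr_ge0 ?sqr_ge0 // /th; lra.
  have -> : C = 7 * (r * (2 * u - u ^+ 2)) + u * (tg e - 5 * tx e) + th e * u ^+ 2 / 2 by rewrite /C mulrA.
  by apply: addr_ge0; [apply: addr_ge0 k2; apply: mulr_ge0 k1|rewrite divr_ge0].
have Y0 : 0 <= 2 + 10 * u - 5 * u ^+ 2 by lra.
have X0 := tX_le u0 ul.
have P0 : 0 <= tP e u r.
  have : 0 <= (2 + 10 * u - 5 * u ^+ 2) * tP e u r.
    by apply: le_trans X0; rewrite mulr_ge0 ?sqr_ge0.
  by rewrite pmulr_rge0 //; lra.
have bl : 0 <= 1 * V + 2 * (-2) * b + 4 * (Q * p).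
  apply: sqr_form_ge0 => //; [exact: mulr_ge0|lra|].
  by have -> : Q * p * V = p * (V * Q) by ring.
apply: addr_ge0; first by apply: addr_ge0; apply: mulr_ge0 => //; exact: sqr_ge0.
apply: sqr_form_ge0 => //; first exact: mulr_ge0.
have -> : (w * tX e u r) ^+ 2 = w * (w * tX e u r ^+ 2) by ring.
have -> : (2 + 10 * u - 5 * u ^+ 2) * (w * tP e u r) =
  w * ((2 + 10 * u - 5 * u ^+ 2) * tP e u r) by ring.
exact: ler_wpM2l w0 _ _ X0.
Qed.

End Bounds.
End TestFunction.

(** * Rigidity under pinching *)

Section ClosedParallelSurface.
Variables (R : realType) (M : topologicalType) (A : smooth_atlas R M).
Variables (N : nat) (Phi : M -> 'rV[R]_N.+1).
Local Notation ch a := (@atlas_chart R M A a).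
Local Notation cod a := (chart_cod (ch a)).
Local Notation rep a := (@local_rep R M A N Phi a).
Hypothesis Phi1 : forall p, enorm (Phi p) = 1.
Hypothesis sPhi : forall a, smooth_on (cod a) (rep a).
Hypothesis fPhi : forall a x, cod a x -> row_free (tangent_frame (rep a) x).
Hypothesis par : parallel_mean_curvature A Phi.
Hypothesis M0 : [set: M] !=set0.
Hypothesis cptM : compact [set: M].
Hypothesis conM : connected [set: M].

Local Notation msm := (@msmooth R M A).
Local Notation mc_sqr := (mc_sqr A Phi).
Local Notation traceless_sqr := (traceless_sqr A Phi).
Local Notation quartic_sqr := (quartic_sqr A Phi).

Lemma rep1 a x : cod a x -> enorm (rep a x) = 1.
Proof. by move=> _; exact: Phi1. Qed.

Lemma gradM_h2g B p : gradM A Phi B mc_sqr p = 0.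
Proof.
set a := index_at A p; have Ux := coord_in A p; have s2 := msmooth_h2g sPhi fPhi.
have e := tang_lf sPhi fPhi a B s2; rewrite -[p](param_coord A p) -/a.
have s3 : msm (fun=> 0 : R) by exact: msmooth_cst.
apply: (@lf_inj R M A a _ _ _ (msmooth_grad sPhi fPhi B s2) s3 Ux).
rewrite -e (lf_nat a 0) /tang /Eb cj_lf (E_h2_0 Phi1 sPhi fPhi par).
by rewrite rmorph0 !mulr0 addr0 mulr0.
Qed.

Lemma h2g_cst p q : mc_sqr p = mc_sqr q.
Proof.
exact: (grad0_cst sPhi fPhi M0 cptM conM (msmooth_h2g sPhi fPhi) gradM_h2g p q).
Qed.

Lemma curv_H_sqr p : curv_H A Phi p ^+ 2 = mc_sqr p.
Proof.
set a := index_at A p; have Ux := coord_in A p.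
have := HV_sqr_at (@cod_open R M A a) (sPhi a) (@rep1 a) (@fPhi a) Ux.
rewrite (h2_lf Phi1 sPhi fPhi) (lfE (msmooth_h2g sPhi fPhi) Ux) (param_coord A p).
by move=> /(congr1 (@complex.Re R)) /= <-.
Qed.

Lemma curv_S_eq p : curv_S A Phi p = 2^-1 * traceless_sqr p + 2 * mc_sqr p.
Proof.
set a := index_at A p; have Ux := coord_in A p.
have := sqnorm_at (@cod_open R M A a) (sPhi a) (@rep1 a) (@fPhi a) Ux.
rewrite (h2_lf Phi1 sPhi fPhi) (a2_lf Phi1 sPhi fPhi) smfunD !smfunM (smfun_nat _ _ Ux) (half_at _ Ux).
rewrite (lfE (msmooth_h2g sPhi fPhi) Ux) (lfE (msmooth_a2g sPhi fPhi) Ux) (param_coord A p).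
move=> /(congr1 (@complex.Re R)) h; apply: etrans (esym h) _ => /=.
by rewrite !mul0r !subr0; ring.
Qed.

Lemma Wg_ge0 p : 0 <= quartic_sqr p.
Proof.
set a := index_at A p; have Ux := coord_in A p.
have := q_lf Phi1 sPhi fPhi a; move=> /(congr1 (fun f : smfun _ => f (Defs.coord (ch a) p))).
rewrite sqmodE (lfE (msmooth_Wg sPhi fPhi) Ux) (param_coord A p).
by move=> /(congr1 (@complex.Re R)) /= <-; exact: sqmod_ge0.
Qed.

Lemma LapM_Wg_ge p : (4 * (1 + mc_sqr p) - traceless_sqr p) * quartic_sqr p <= LapM A Phi quartic_sqr p.
Proof.
set a := index_at A p; have Ux := coord_in A p.
have [D e] := lap_Wg Phi1 sPhi fPhi par a.
have sW := msmooth_Wg sPhi fPhi.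
have e1 := lfE (msmooth_LapM sPhi fPhi sW) Ux; have e2 := lfE sW Ux.
have e3 := lfE (msmooth_h2g sPhi fPhi) Ux; have e4 := lfE (msmooth_a2g sPhi fPhi) Ux.
have n1 := smfun1 (@cod_open R M A a) Ux; have n4 := smfun_nat (@cod_open R M A a) 4 Ux.
have d := sqmodE D (Defs.coord (ch a) p).
have k0 := sqmod_ge0 D (Defs.coord (ch a) p).
move: e1 e2 e3 e4; rewrite (param_coord A p) -/a => e1 e2 e3 e4.
move: (D * _) (sqmod _ _) (lf _ _) (lf _ mc_sqr) (lf _ traceless_sqr) (lf _ quartic_sqr) (1 : smfun (@cod_open R M A a)) (4%:R : smfun (@cod_open R M A a)) n1 n4 e1 e2 e3 e4 d e k0 => DD s L h a2 W k1 k4 n1 n4 e1 e2 e3 e4 d e k0.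
have := congr1 (fun f : smfun _ => f (Defs.coord (ch a) p)) e.
rewrite !(smfunD, smfunM, smfunN) n1 n4 e1 e2 e3 e4 d => /(congr1 (@complex.Re R)) /=.
rewrite !(mul0r, mulr0, subr0, addr0, oppr0) => ->.
by rewrite lerDr.
Qed.

Lemma Wg_eq0 : (forall p, traceless_sqr p < 4 * (1 + mc_sqr p)) -> forall p, quartic_sqr p = 0.
Proof.
move=> aH; have sW := msmooth_Wg sPhi fPhi; have [p0 h] := max_exists M0 cptM sW.
have L := LapM_max sPhi fPhi sW h; have L2 := LapM_Wg_ge p0.
have W0 : quartic_sqr p0 <= 0.
  have : (4 * (1 + mc_sqr p0) - traceless_sqr p0) * quartic_sqr p0 <= 0 by exact: le_trans L2 L.
  by rewrite pmulr_rle0 // subr_gt0.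
by move=> p; apply/eqP; rewrite eq_le Wg_ge0 andbT (le_trans (h p)).
Qed.

Section Facts.
Variable c : R.
Hypothesis c_gt0 : 0 < c.
Hypothesis h2c : forall p, 1 + mc_sqr p = c.
Hypothesis W0 : forall p, quartic_sqr p = 0.
Hypothesis a2_gt0 : forall p, 0 < traceless_sqr p.
Local Notation rhog := (rhog A Phi c).
Local Notation rg := (ratio_r A Phi c).
Local Notation Qg := (ratio_Q A Phi c).
Local Notation Vg := (ratio_V A Phi c).
Local Notation gradn := (scaled_grad A Phi c).
Local Notation Lapn := (scaled_lap A Phi c).
Local Notation dotn := (scaled_dot A Phi c).

Ltac at_chart p lem := rewrite -(param_coord A p);
  exact (lem _ _ _ _ _ Phi1 sPhi fPhi par c c_gt0 h2c W0 a2_gt0 (index_at A p) _ (coord_in A p)).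

Lemma rg_ge0 p : 0 <= rg p. Proof. at_chart p @rg_ge0_at. Qed.
Lemma Qg_ge0 p : 0 <= Qg p. Proof. at_chart p @Qg_ge0_at. Qed.
Lemma Vg_ge0 p : 0 <= Vg p. Proof. at_chart p @Vg_ge0_at. Qed.
Lemma dot_rg_le p : dotn rg rg p <= rg p * Qg p. Proof. at_chart p @dot_rg_at. Qed.
Lemma grad_Qg_le p :
  \sum_B (gradn B Qg p - 2 * (1 - rg p) * gradn B rg p) ^+ 2 <= Vg p * Qg p.
Proof. at_chart p @grad_Qg_at. Qed.

Lemma Lapn_rhog p : rhog p * Lapn rhog p =
  rhog p ^+ 2 * (rg p - (3 * rhog p - 4)) + dotn rhog rhog p.
Proof.
have r0 : rhog p != 0 by rewrite gt_eqF // rhog_gt0.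
rewrite /ratio_r /irhog; move: (Lapn _ _) (dotn _ _ _) (rhog p) r0 => l d r r0; field.
exact: r0.
Qed.

Lemma Lapn_rg p : Lapn rg p = Qg p + 2 * rg p * (1 - rg p).
Proof. by rewrite /ratio_Q; ring. Qed.

End Facts.

End ClosedParallelSurface.

Lemma cauchy_schwarz_sum (R : realFieldType) (I : finType) (a b : I -> R) :
  (\sum_i a i * b i) ^+ 2 <= (\sum_i a i ^+ 2) * (\sum_i b i ^+ 2).
Proof.
move SE : (\sum_i a i ^+ 2) => S; move DE : (\sum_i b i ^+ 2) => D.
move TE : (\sum_i a i * b i) => T.
have S0 : 0 <= S by rewrite -SE sumr_ge0 // => i _; exact: sqr_ge0.
have e : \sum_i (S * b i - T * a i) ^+ 2 = S * (S * D - T ^+ 2).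
  have -> : S * (S * D - T ^+ 2) = S * S * (\sum_i b i ^+ 2) + (- (2 * S * T)) * (\sum_i a i * b i)
      + T * T * (\sum_i a i ^+ 2) by rewrite SE DE TE; ring.
  by rewrite !mulr_sumr -!big_split; apply: eq_bigr => i _ /=; ring.
have h : 0 <= S * (S * D - T ^+ 2) by rewrite -e sumr_ge0 // => i _; exact: sqr_ge0.
move: S0; rewrite le0r => /orP[/eqP s0|s0]; last by move: h; rewrite pmulr_rge0 // subr_ge0.
suff -> : T = 0 by rewrite s0 mul0r expr0n.
rewrite -TE big1 // => i _; suff -> : a i = 0 by rewrite mul0r.
move/eqP: s0; rewrite -SE psumr_eq0; last by move=> k _; exact: sqr_ge0.
by move=> /allP/(_ i (mem_index_enum i)); rewrite sqrf_eq0 => /eqP.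
Qed.

(** * The bound on r and the test function on a pinched surface *)

Section PinchedSurface.
Variables (R : realType) (M : topologicalType) (A : smooth_atlas R M).
Variables (N : nat) (Phi : M -> 'rV[R]_N.+1).
Local Notation ch a := (@atlas_chart R M A a).
Local Notation cod a := (chart_cod (ch a)).
Local Notation rep a := (@local_rep R M A N Phi a).
Hypothesis Phi1 : forall p, enorm (Phi p) = 1.
Hypothesis sPhi : forall a, smooth_on (cod a) (rep a).
Hypothesis fPhi : forall a x, cod a x -> row_free (tangent_frame (rep a) x).
Hypothesis par : parallel_mean_curvature A Phi.
Hypothesis M0 : [set: M] !=set0.
Hypothesis cptM : compact [set: M].
Hypothesis conM : connected [set: M].
Variable c : R.
Hypothesis c_gt0 : 0 < c.
Hypothesis h2c : forall p, 1 + mc_sqr A Phi p = c.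
Hypothesis W0 : forall p, quartic_sqr A Phi p = 0.
Hypothesis a2_gt0 : forall p, 0 < traceless_sqr A Phi p.

Local Notation msm := (@msmooth R M A).
Local Notation rho := (rhog A Phi c).
Local Notation r := (ratio_r A Phi c).
Local Notation Q := (ratio_Q A Phi c).
Local Notation V := (ratio_V A Phi c).
Local Notation D := (scaled_grad A Phi c).
Local Notation Lap := (scaled_lap A Phi c).
Local Notation dotn := (scaled_dot A Phi c).

Let s_rho : msm rho := msmooth_rhog sPhi fPhi c.
Let s_r : msm r := msmooth_rg sPhi fPhi c_gt0 a2_gt0.
Let s_Q : msm Q := msmooth_Qg sPhi fPhi c_gt0 a2_gt0.

Lemma rho_gt0 p : 0 < rho p. Proof. exact: rhog_gt0. Qed.

(** [sg] is the gradient of log rho, [s2] its squared length, and [lm] the Laplacian of log rho; the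
    logarithm itself is never formed. *)
Definition sg B p := D B rho p / rho p.
Definition s2 p := \sum_B sg B p ^+ 2.
Definition lm p := r p - (3 * rho p - 4).
Definition zr p := \sum_B sg B p * D B r p.
Definition bQ p := \sum_B sg B p * (D B Q p - 2 * (1 - r p) * D B r p).

Lemma s2_ge0 p : 0 <= s2 p.
Proof. by apply: sumr_ge0 => B _; exact: sqr_ge0. Qed.

Lemma zr_sqr p : zr p ^+ 2 <= s2 p * dotn r r p.
Proof. by apply: cauchy_schwarz_sum. Qed.

Lemma bQ_sqr p : bQ p ^+ 2 <= s2 p * (V p * Q p).
Proof.
apply: le_trans (cauchy_schwarz_sum _ _) _; apply: ler_wpM2l; first exact: s2_ge0.
exact: (grad_Qg_le Phi1 sPhi fPhi par c_gt0 h2c W0 a2_gt0).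
Qed.

(* The derivatives of [F] up to second order are those of [rho ^ k]. *)
Definition logpow (k : R) F := [/\ msm F, forall B p, D B F p = k * F p * sg B p &
  forall p, Lap F p = F p * (k ^+ 2 * s2 p + k * lm p)].

Lemma dotn_rho p : dotn rho rho p = rho p ^+ 2 * s2 p.
Proof.
rewrite /scaled_dot /s2 mulr_sumr; apply: eq_bigr => B _.
by rewrite /sg expr_div_n [RHS]mulrC divfK ?expr2 // mulf_neq0 // gt_eqF // rho_gt0.
Qed.

Lemma logpow_rho : logpow 1 rho.
Proof.
split=> // [B p|p]; first by rewrite mul1r /sg mulrC divfK // gt_eqF // rho_gt0.
have r0 : rho p != 0 by rewrite gt_eqF // rho_gt0.
apply: (mulfI r0); rewrite (Lapn_rhog c_gt0 a2_gt0) dotn_rho /lm; ring.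
Qed.

Lemma logpow_mul k l F G : logpow k F -> logpow l G -> logpow (k + l) (fun p => F p * G p).
Proof.
move=> [sF dF LF] [sG dG LG]; split=> [|B p|p]; first exact: msmoothM.
  by rewrite gradnM // dF dG; ring.
rewrite (LapnM sPhi fPhi) // LF LG.
have -> : dotn F G p = k * F p * (l * G p) * s2 p.
  rewrite /scaled_dot /s2 mulr_sumr; apply: eq_bigr => B _.
  by rewrite dF dG; ring.
by move: (lm p) (s2 p) => *; ring.
Qed.

(** Obtained by differentiating rho * rho^-1 = 1 twice, so that the product rules suffice. *)
Lemma logpow_inv : logpow (-1) (fun p => (rho p)^-1).
Proof.
have r0 p : rho p != 0 by rewrite gt_eqF // rho_gt0.
have si : msm (fun p => (rho p)^-1) by exact: msmoothV.
have e : (fun p => rho p * (rho p)^-1) = fun=> 1 by apply/funext => p; rewrite mulfV.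
have [_ dr Lr] := logpow_rho.
have di B p : D B (fun p => (rho p)^-1) p = -1 * (rho p)^-1 * sg B p.
  have := gradnM Phi c B p s_rho si; rewrite e gradn_cst dr => h.
  apply: (mulfI (r0 p)); apply/eqP; rewrite -subr_eq0 {}h; apply/eqP.
  by field; exact: r0.
split=> // p; have := LapnM sPhi fPhi c p s_rho si.
rewrite e Lapn_cst Lr.
have -> : dotn rho (fun p => (rho p)^-1) p = - s2 p.
  rewrite /scaled_dot /s2 -sumrN; apply: eq_bigr => B _; rewrite dr di; field; exact: r0.
move=> h; apply: (mulfI (r0 p)); move: h (r0 p).
move: (Lap _ p) (s2 p) (lm p) (rho p) => L s l q h q0.
have -> : q * L = q * L + q^-1 * (q * (1 ^+ 2 * s + 1 * l)) + 2 * (- s)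
  - q^-1 * (q * (1 ^+ 2 * s + 1 * l)) + 2 * s by ring.
by rewrite -h; field.
Qed.

Variable e : R.
Hypothesis e_gt0 : 0 < e.
Hypothesis e_le : e <= 2 / 3.
Hypothesis rho_ge : forall p, tx e <= rho p.
Hypothesis rho_le : forall p, rho p * (1 - tu e) <= tx e.

Let e_ge0 : 0 <= e := ltW e_gt0.

Lemma tx_gt0 : 0 < tx e.
Proof. by move: e_le; rewrite /tx; lra. Qed.

Lemma trb_ge0 : 0 <= trb e.
Proof. by move: e_le; rewrite /trb; lra. Qed.

Definition wf p := tx e * (rho p)^-1.
Definition uf p := 1 + (-1) * wf p.

Lemma logpow_wf : logpow (-1) wf.
Proof.
have [si di Li] := logpow_inv; split=> [|B p|p].
- by apply: msmoothM => //; exact: msmooth_cst.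
- by rewrite /wf (gradnM _ _ _ _ (@msmooth_cst R M A _) si) gradn_cst di; ring.
- by rewrite /wf LapnZ // Li; ring.
Qed.

Lemma wf_rho p : rho p * wf p = tx e.
Proof. by rewrite /wf mulrCA mulfV ?mulr1 // gt_eqF // rho_gt0. Qed.

Lemma uf_ge0 p : 0 <= uf p.
Proof. by rewrite /uf mulN1r subr_ge0 ler_pdivrMr ?rho_gt0 // mul1r. Qed.

Lemma uf_le p : uf p <= tu e.
Proof.
rewrite /uf mulN1r lerBlDr -lerBlDl ler_pdivlMr ?rho_gt0 // mulrC.
exact: rho_le.
Qed.

Let Q0 p : 0 <= Q p := Qg_ge0 Phi1 sPhi fPhi par c_gt0 h2c W0 a2_gt0 p.
Let r0 p : 0 <= r p := rg_ge0 Phi1 sPhi fPhi par c_gt0 h2c W0 a2_gt0 p.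
Let V0 p : 0 <= V p := Vg_ge0 Phi1 sPhi fPhi par c_gt0 h2c W0 a2_gt0 p.
Let rr_le p : dotn r r p <= r p * Q p := dot_rg_le Phi1 sPhi fPhi par c_gt0 h2c W0 a2_gt0 p.

Lemma dotn_rr_ge0 p : 0 <= dotn r r p.
Proof. by apply: sumr_ge0 => B _; rewrite -expr2 sqr_ge0. Qed.

Lemma dotn_logpow k F f p : logpow k F -> dotn F f p = k * F p * \sum_B sg B p * D B f p.
Proof.
by move=> [_ dF _]; rewrite /scaled_dot mulr_sumr; apply: eq_bigr => B _; rewrite dF; ring.
Qed.

(** At a maximum of rho^8 r the terms Q + 16 z + 64 r |grad log rho|^2 are nonnegative, because
    |grad r|^2 <= r Q. What is left gives 2 + 6 r <= 8 (3 rho - 4) there. The eighth power is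
    reached by three squarings through [logpow_mul]. *)
Lemma r_le_trb p : r p <= trb e.
Proof.
pose F2 q := rho q * rho q; pose F4 q := F2 q * F2 q; pose F8 q := F4 q * F4 q.
have l2 : logpow (1 + 1) F2 by exact: (logpow_mul logpow_rho logpow_rho).
have l4 : logpow (1 + 1 + (1 + 1)) F4 by exact: (logpow_mul l2 l2).
have l8 := logpow_mul l4 l4; rewrite -/F8 in l8.
have [s8 _ L8] := l8.
have F8E q : F8 q = rho q ^+ 8 by rewrite /F8 /F4 /F2; ring.
have sf : msm (fun q => F8 q * r q) by exact: msmoothM.
have [p1 h] := max_exists M0 cptM sf.
have F8p q : 0 < F8 q by rewrite F8E exprn_gt0 // rho_gt0.
have := Lapn_max sPhi fPhi c_gt0 sf h.
rewrite (LapnM sPhi fPhi) // (dotn_logpow _ _ l8) L8 (Lapn_rg A Phi c p1) -/(zr p1).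
have qf : 0 <= 1 * Q p1 + 2 * 8 * zr p1 + 64 * (r p1 * s2 p1).
  apply: sqr_form_ge0 => //; [by rewrite mulr_ge0 // s2_ge0|lra|].
  have -> : r p1 * s2 p1 * Q p1 = s2 p1 * (r p1 * Q p1) by ring.
  by apply: le_trans (zr_sqr p1) _; apply: ler_wpM2l (rr_le p1); exact: s2_ge0.
set L := (X in X <= 0 -> _).
have -> : L = F8 p1 * ((1 * Q p1 + 2 * 8 * zr p1 + 64 * (r p1 * s2 p1)) + r p1 * (2 + 6 * r p1 - 8 * (3 * rho p1 - 4))).
  by rewrite /L /lm; ring.
rewrite pmulr_rle0 // => Ln.
have r1 : r p1 * (2 + 6 * r p1 - 8 * (3 * rho p1 - 4)) <= 0 by apply: le_trans Ln; rewrite lerDr.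
have [rp|rp] := leP (r p) 0; first by apply: le_trans rp _; exact: trb_ge0.
have r1p : 0 < r p1.
  have : 0 < F8 p1 * r p1 by apply: lt_le_trans (h p); exact: mulr_gt0.
  by rewrite (pmulr_rgt0 _ (F8p p1)).
move: r1; rewrite (pmulr_rle0 _ r1p) => r1.
(* The comparison rho(p)^8 r(p) <= rho(p1)^8 r(p1) is weakened by rho(p) >= tx e, so that only the
   ratio tx e / rho(p1) remains. *)
have k1 : wf p1 ^+ 8 * r p <= r p1.
  have x8 : 0 < rho p1 ^+ 8 by rewrite exprn_gt0 // rho_gt0.
  have hp : rho p ^+ 8 * r p <= rho p1 ^+ 8 * r p1 by have := h p; rewrite (F8E p) (F8E p1).
  have k : tx e ^+ 8 <= rho p ^+ 8.
    by rewrite lerXn2r ?nnegrE ?(ltW tx_gt0) ?(ltW (rho_gt0 p)).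
  have k' : tx e ^+ 8 * r p <= rho p ^+ 8 * r p by rewrite (ler_pM2r rp).
  rewrite -(ler_pM2l x8) mulrA -exprMn wf_rho; exact: le_trans k' hp.
have wE : wf p1 = 1 - uf p1 by rewrite /uf mulN1r subKr.
have wr := wf_rho p1; rewrite wE in k1 wr.
exact: (rbar_le e_ge0 e_le (uf_ge0 p1) (uf_le p1) wr r1 k1).
Qed.

Let s_wf : msm wf. Proof. by case: logpow_wf. Qed.

Lemma s_uf : msm uf.
Proof.
by apply: msmoothD; [exact: msmooth_cst|apply: msmoothM => //; exact: msmooth_cst].
Qed.

Lemma grad_uf B p : D B uf p = wf p * sg B p.
Proof.
have [_ dw _] := logpow_wf; have k := @msmooth_cst R M A.
rewrite /uf (gradnD _ _ _ _ (k 1) (msmoothM (k (-1)) s_wf)) gradn_cst.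
by rewrite (gradnM _ _ _ _ (k (-1)) s_wf) gradn_cst dw; ring.
Qed.

Lemma Lap_uf p : Lap uf p = wf p * (lm p - s2 p).
Proof.
have [_ _ Lw] := logpow_wf; have k := @msmooth_cst R M A.
rewrite /uf (LapnD sPhi fPhi c p (k 1) (msmoothM (k (-1)) s_wf)) Lapn_cst LapnZ // Lw; ring.
Qed.

Lemma dotn_r_uf p : dotn r uf p = wf p * zr p.
Proof.
rewrite /scaled_dot /zr mulr_sumr; apply: eq_bigr => B _; rewrite grad_uf.
by move: (D B r p) (wf p) (sg B p) => *; ring.
Qed.

Lemma dotn_uf_uf p : dotn uf uf p = wf p ^+ 2 * s2 p.
Proof.
rewrite /scaled_dot /s2 mulr_sumr; apply: eq_bigr => B _; rewrite grad_uf.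
by move: (wf p) (sg B p) => *; ring.
Qed.

Lemma dotn_r_uf2 p : dotn r (fun q => uf q * uf q) p = 2 * uf p * (wf p * zr p).
Proof.
rewrite -dotn_r_uf /scaled_dot mulr_sumr; apply: eq_bigr => B _.
rewrite (gradnM _ _ _ _ s_uf s_uf).
by move: (D B r p) (D B uf p) (uf p) => *; ring.
Qed.

Lemma sum_sg_Q p : \sum_B sg B p * D B Q p = bQ p + 2 * (1 - r p) * zr p.
Proof.
rewrite /bQ /zr mulr_sumr -big_split; apply: eq_bigr => B _ /=.
by move: (D B Q p) (D B r p) (sg B p) (r p) => *; ring.
Qed.

(** Expanded into monomials, so that the sum and product rules for the Laplacian apply term by
    term. *)
Definition test_fun p := wf p * wf p * Q p + (- 5 * tx e * r p + ((tf e - tg e * tm e) * uf p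
  + (7 / 2 * (r p * r p) + (tg e * (r p * uf p) + (th e / 2 * (r p * (uf p * uf p))
  + (tK e - th e * tm e) / 2 * (uf p * uf p)))))).

Lemma s_test_fun : msm test_fun.
Proof.
have k := @msmooth_cst R M A; have su := s_uf.
by repeat first [apply: k | apply: s_r | apply: s_Q | apply: s_wf | apply: su
  | apply: msmoothD | apply: msmoothM].
Qed.

Lemma Lap_test_fun p : Lap test_fun p =
  wf p ^+ 2 * Lap Q p + Q p * (wf p ^+ 2 * (4 * s2 p - 2 * lm p))
  - 4 * wf p ^+ 2 * (bQ p + 2 * (1 - r p) * zr p)
  + t_r e (uf p) (r p) * (Q p + 2 * r p * (1 - r p)) + t_u e (uf p) (r p) * (wf p * (lm p - s2 p))
  + 7 * dotn r r p + 2 * (tg e + th e * uf p) * wf p * zr p + t_uu e (r p) * wf p ^+ 2 * s2 p.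
Proof.
have k := @msmooth_cst R M A; have su := s_uf.
have suu := msmoothM su su; have sru := msmoothM s_r su; have srr := msmoothM s_r s_r.
have sruu := msmoothM s_r suu.
have lw2 : logpow (-1 + -1) (fun q => wf q * wf q) by exact: (logpow_mul logpow_wf logpow_wf).
have [sww _ Lww] := lw2.
have s6 := msmoothM (k ((tK e - th e * tm e) / 2)) suu.
have s5' := msmoothM (k (th e / 2)) sruu; have s5 := msmoothD s5' s6.
have s4' := msmoothM (k (tg e)) sru; have s4 := msmoothD s4' s5.
have s3' := msmoothM (k (7 / 2)) srr; have s3 := msmoothD s3' s4.
have s2_ := msmoothM (k (tf e - tg e * tm e)) su; have s22 := msmoothD s2_ s3.
have s1' := msmoothM (k (- 5 * tx e)) s_r; have s1 := msmoothD s1' s22.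
have s0' := msmoothM sww s_Q.
have LD f1 f2 (h1 : msm f1) (h2 : msm f2) := LapnD sPhi fPhi c p h1 h2.
have LM f1 f2 (h1 : msm f1) (h2 : msm f2) := LapnM sPhi fPhi c p h1 h2.
have LZ t f1 (h1 : msm f1) := LapnZ sPhi fPhi c t p h1.
have E1 : Lap (fun q => uf q * uf q) p = 2 * uf p * (wf p * (lm p - s2 p)) + 2 * (wf p ^+ 2 * s2 p).
  by rewrite (LM _ _ su su) Lap_uf dotn_uf_uf; ring.
have E2 := Lapn_rg A Phi c p.
have E3 : Lap (fun q => r q * (uf q * uf q)) p = r p * (2 * uf p * (wf p * (lm p - s2 p)) + 2 * (wf p ^+ 2 * s2 p))
   + uf p * uf p * (Q p + 2 * r p * (1 - r p)) + 2 * (2 * uf p * (wf p * zr p)).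
  by rewrite (LM _ _ s_r suu) E1 E2 dotn_r_uf2.
have E4 : Lap (fun q => r q * uf q) p = r p * (wf p * (lm p - s2 p)) + uf p * (Q p + 2 * r p * (1 - r p)) + 2 * (wf p * zr p).
  by rewrite (LM _ _ s_r su) E2 Lap_uf dotn_r_uf.
have E5 : Lap (fun q => r q * r q) p = 2 * r p * (Q p + 2 * r p * (1 - r p)) + 2 * dotn r r p.
  by rewrite (LM _ _ s_r s_r) E2; ring.
have E6 : Lap (fun q => wf q * wf q * Q q) p = wf p ^+ 2 * Lap Q p + Q p * (wf p ^+ 2 * (4 * s2 p - 2 * lm p))
    - 4 * wf p ^+ 2 * (bQ p + 2 * (1 - r p) * zr p).
  rewrite (LM _ _ sww s_Q) Lww (dotn_logpow _ _ lw2) sum_sg_Q.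
  by move: (wf p) (Lap Q p) (s2 p) (lm p) (bQ p) (zr p) (r p) (Q p) => *; ring.
have -> : Lap test_fun p = Lap (fun q => wf q * wf q * Q q) p + (- 5 * tx e * Lap r p + ((tf e - tg e * tm e) * Lap uf p
  + (7 / 2 * Lap (fun q => r q * r q) p + (tg e * Lap (fun q => r q * uf q) p + (th e / 2 * Lap (fun q => r q * (uf q * uf q)) p
  + (tK e - th e * tm e) / 2 * Lap (fun q => uf q * uf q) p))))).
  rewrite (LD _ _ s0' s1) (LD _ _ s1' s22) (LD _ _ s2_ s3) (LD _ _ s3' s4) (LD _ _ s4' s5) (LD _ _ s5' s6).
  by rewrite (LZ _ _ s_r) (LZ _ _ su) (LZ _ _ srr) (LZ _ _ sru) (LZ _ _ sruu) (LZ _ _ suu).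
rewrite E1 E2 E3 E4 E5 E6 Lap_uf /t_r /t_u /t_uu.
move: (wf p) (Lap Q p) (s2 p) (lm p) (bQ p) (zr p) (r p) (Q p) (uf p) (dotn r r p) (tx e) (tf e) (tg e) (th e) (tm e) (tK e) => *.
by field.
Qed.

Lemma Lap_test_fun_ge p : tR e (uf p) (r p) <= Lap test_fun p.
Proof.
have wE : wf p = 1 - uf p by rewrite /uf mulN1r subKr.
have wr : rho p * (1 - uf p) = tx e by rewrite -wE wf_rho.
have LQ : Lap Q p = V p + 4 * r p * (1 - r p) ^+ 2 - 5 * dotn r r p + (8 - 5 * r p - rho p) * Q p.
  by rewrite /ratio_V; ring.
have := test_laplacian_ge e_ge0 e_le (r0 p) (r_le_trb p) (uf_ge0 p) (uf_le p) wr (Q0 p) (V0 p)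
  (s2_ge0 p) (dotn_rr_ge0 p) (zr_sqr p) (bQ_sqr p) LQ.
by rewrite Lap_test_fun wE /= /lm.
Qed.

Lemma pinched_rigidity : e = 2 / 3 /\ forall p, rho p = tx e.
Proof.
have L0 p : 0 <= Lap test_fun p.
  apply: le_trans (Lap_test_fun_ge p).
  exact: (tR_ge0 e_ge0 e_le (r0 p) (r_le_trb p) e_gt0 (uf_ge0 p) (uf_le p)).
have fc := Lapn_strong_max sPhi fPhi c_gt0 M0 cptM conM s_test_fun L0.
have L1 : forall p, Lap test_fun p = 0 by apply: Lapn0_of_cst.
have uz p : uf p = 0 /\ e = 2 / 3.
  apply: (tR_eq0 e_ge0 e_le (r0 p) (r_le_trb p) e_gt0 (uf_ge0 p) (uf_le p)).
  apply/eqP; rewrite eq_le; apply/andP; split.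
    by rewrite -(L1 p); exact: Lap_test_fun_ge.
  exact: (tR_ge0 e_ge0 e_le (r0 p) (r_le_trb p) e_gt0 (uf_ge0 p) (uf_le p)).
have [p0 _] := M0; split; first by case: (uz p0).
move=> p; have [up _] := uz p; rewrite -(wf_rho p).
have -> : wf p = 1 by move/eqP: up; rewrite /uf mulN1r subr_eq0 => /eqP.
by rewrite mulr1.
Qed.

End PinchedSurface.

(** In terms of e the gap bounds u = 1 - tx / y by 24 e (7 - 3 e) / (d + 24 e (7 - 3 e)) with d =
    4752 - 1518 e + 89 e^2. At e = 0 its slope is 168 / 4752 = 7 / 198, the slope of [tu], and the
    difference is of order e^2 with a favourable sign. *)
Lemma pinching_gap (F : realFieldType) (e y : F) : 0 <= e -> e <= 2 / 3 ->
  y < tx e + 120 * tx e * (3 * tx e - 4) * (9 - 5 * tx e) /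
    (2225 * tx e ^+ 2 - 420 * tx e - 1701) ->
  y * (1 - tu e) <= tx e.
Proof.
move=> e0 e1.
have -> : 2225 * tx e ^+ 2 - 420 * tx e - 1701 = 4752 - 1518 * e + 89 * e ^+ 2.
  by rewrite /tx; field.
have -> : 120 * tx e * (3 * tx e - 4) * (9 - 5 * tx e) = 24 * e * (7 - 3 * e) * tx e.
  by rewrite /tx; field.
set d := 4752 - _ + _ => yx.
have d0 : 0 < d by have := sqr_ge0 e; rewrite /d; lra.
have x0 : 0 <= tx e by rewrite /tx; lra.
have t1 : 0 <= 1 - tu e by have := tu_le e0 e1; lra.
apply: le_trans (ler_wpM2r t1 (ltW yx)) _; rewrite -subr_ge0.
have -> : tx e - (tx e + 24 * e * (7 - 3 * e) * tx e / d) * (1 - tu e) =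
    tx e * (tu e * (d + 24 * e * (7 - 3 * e)) - 24 * e * (7 - 3 * e)) / d.
  by field; rewrite gt_eqF.
apply: divr_ge0; last exact: ltW.
apply: mulr_ge0 => //.
have -> : tu e * (d + 24 * e * (7 - 3 * e)) - 24 * e * (7 - 3 * e) =
    e * e * (54 + e * (1469 - 17 * e)) / 198.
  by rewrite /d /tu; field.
have k : 0 <= 1469 - 17 * e by lra.
have k2 : 0 <= 54 + e * (1469 - 17 * e) by have := mulr_ge0 e0 k; lra.
exact: divr_ge0 (mulr_ge0 (mulr_ge0 e0 e0) k2) (ler0n _ _).
Qed.

Lemma pinching_param (F : realFieldType) (t : F) : 5 / 3 <= t -> t <= 9 / 5 ->
  [/\ 0 <= 9 - 5 * t, 9 - 5 * t <= 2 / 3 & tx (9 - 5 * t) = t].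
Proof. by move=> t1 t2; split; [lra|lra|rewrite /tx; field]. Qed.

Lemma tu_le1 (F : realFieldType) (e : F) : 0 <= e -> e <= 2 / 3 -> 0 <= 1 - tu e.
Proof. by move=> e0 e1; have := tu_le e0 e1; lra. Qed.

(** * Translation of the hypotheses on S and H into rho *)

Section Main.
Variables (R : realType) (M : topologicalType) (A : smooth_atlas R M).
Variables (N : nat) (Phi : M -> 'rV[R]_N.+1) (g : riemannian_metric A).
Hypothesis hM : closed_surface M.
Hypothesis imm : isometric_immersion g Phi.
Hypothesis par : parallel_mean_curvature A Phi.
Local Notation S := (curv_S A Phi).
Local Notation H := (curv_H A Phi).
Hypothesis pinch : forall p, 5 / 3 + 11 / 3 * H p ^+ 2 <= S p /\
  S p <= 9 / 5 + 19 / 5 * H p ^+ 2.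
Hypothesis gap : forall p, S_max A Phi < S_min A Phi +
  (120 * (S_min A Phi - 2 * H p ^+ 2) * (3 * S_min A Phi - 4 - 10 * H p ^+ 2)
     * (9 - 5 * S_min A Phi + 19 * H p ^+ 2))
  / (2225 * (S_min A Phi - 2 * H p ^+ 2) ^+ 2
     - 420 * (1 + H p ^+ 2) * (S_min A Phi - 2 * H p ^+ 2)
     - 1701 * (1 + H p ^+ 2) ^+ 2).

Lemma curv_S_cst p : S p = 5 / 3 + 11 / 3 * H p ^+ 2.
Proof.
have [M0 _ _ cM conM] := hM; have [Phi1 im] := imm.
have sPhi (a : atlas_index A) : smooth_on (chart_cod (atlas_chart a)) (local_rep Phi a) by have [] := im a.
have fPhi (a : atlas_index A) x : chart_cod (atlas_chart a) x -> row_free (tangent_frame (@local_rep R M A N Phi a) x).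
  by move=> Ux; have [_ /(_ x Ux) []] := im a.
pose h := mc_sqr A Phi p; pose c := 1 + h.
have hq q : mc_sqr A Phi q = h by exact: (h2g_cst Phi1 sPhi fPhi par M0 cM conM).
have Hq q : H q ^+ 2 = h by rewrite (curv_H_sqr Phi1 sPhi fPhi) hq.
have h0 : 0 <= h by rewrite -(Hq p) sqr_ge0.
have c0 : 0 < c by rewrite /c; lra.
have h2c q : 1 + mc_sqr A Phi q = c by rewrite hq.
pose rho := rhog A Phi c.
have SE q : S q = c * rho q + 2 * h.
  rewrite (curv_S_eq Phi1 sPhi fPhi) hq /rho /rhog; field; rewrite gt_eqF //.
have rho1 q : 5 / 3 <= rho q.
  have [k _] := pinch q; rewrite SE Hq in k.
  by rewrite -(ler_pM2l c0); move: k; rewrite /c; lra.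
have rho2 q : rho q <= 9 / 5.
  have [_ k] := pinch q; rewrite SE Hq in k.
  by rewrite -(ler_pM2l c0); move: k; rewrite /c; lra.
have aE q : traceless_sqr A Phi q = 2 * c * rho q by rewrite /rho /rhog mulrA mulfV ?mul1r // mulf_neq0 // gt_eqF.
have a2_gt0 q : 0 < traceless_sqr A Phi q.
  rewrite aE; apply: mulr_gt0; first exact: mulr_gt0.
  by apply: lt_le_trans (rho1 q); rewrite divr_gt0.
(* The condition rho < 2 is positivity of the Gauss curvature, and 9/5 lies below 2. *)
have W0 : forall q, quartic_sqr A Phi q = 0.
  apply: (Wg_eq0 Phi1 sPhi fPhi par M0 cM) => q; rewrite aE h2c.
  have -> : 4 * c = 2 * c * 2 by ring.
  rewrite ltr_pM2l ?mulr_gt0 //; apply: le_lt_trans (rho2 q) _.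
  by rewrite ltr_pdivrMr // -natrM ltr_nat.
have s_rho := msmooth_rhog sPhi fPhi c.
have [p0 min0] := min_exists M0 cM s_rho; have [p1 max1] := max_exists M0 cM s_rho.
(* [inf] and [sup] carry their meaning only on bounded nonempty sets, so explicit bounds for S are
   supplied along with the points where the extrema are attained. *)
have minE : S_min A Phi = c * rho p0 + 2 * h.
  apply/eqP; rewrite eq_le; apply/andP; split.
    rewrite -SE; apply: ge_inf; last by exists p0.
    exists 0 => _ [q _ <-]; rewrite SE; apply: addr_ge0; last exact: mulr_ge0.
    by apply: mulr_ge0 (ltW c0) _; apply: le_trans (rho1 q); rewrite divr_ge0.
  apply: lb_le_inf; first by exists (S p0), p0.
  by move=> _ [q _ <-]; rewrite SE lerD2r (ler_pM2l c0); exact: min0.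
have maxE : S_max A Phi = c * rho p1 + 2 * h.
  apply/eqP; rewrite eq_le; apply/andP; split.
    apply: ge_sup; first by exists (S p0), p0.
    move=> _ [q _ <-]; rewrite (SE q) lerD2r (ler_pM2l c0); exact: max1.
  rewrite -SE; apply: sup_upper_bound; last by exists p1.
  split; first by exists (S p0), p0.
  exists (c * (9 / 5) + 2 * h) => _ [q _ <-]; rewrite (SE q) lerD2r (ler_pM2l c0); exact: rho2.
pose e := 9 - 5 * rho p0.
have [e_ge0 e_le xE] : [/\ 0 <= e, e <= 2 / 3 & tx e = rho p0].
  exact: (pinching_param (rho1 p0) (rho2 p0)).
(* After S = c rho + 2 H^2 and H^2 = c - 1, every factor of the gap is homogeneous in c: the
   numerator has degree 3 and the denominator degree 2, so c cancels and the case H = 0 remains. *)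
have gp : rho p1 < tx e + 120 * tx e * (3 * tx e - 4) * (9 - 5 * tx e) /
    (2225 * tx e ^+ 2 - 420 * tx e - 1701).
  have := gap p; rewrite Hq minE maxE -xE -/c.
  have hE : h = c - 1 by rewrite /c; ring.
  rewrite hE; set T := 120 * tx e * _ * _; set E := 2225 * tx e ^+ 2 - _ - _.
  have -> : 120 * (c * tx e + 2 * (c - 1) - 2 * (c - 1)) * (3 * (c * tx e + 2 * (c - 1)) - 4 - 10 * (c - 1)) *
    (9 - 5 * (c * tx e + 2 * (c - 1)) + 19 * (c - 1)) = c ^+ 2 * (c * T).
    by rewrite /T; ring.
  have -> : 2225 * (c * tx e + 2 * (c - 1) - 2 * (c - 1)) ^+ 2 -
    420 * c * (c * tx e + 2 * (c - 1) - 2 * (c - 1)) - 1701 * c ^+ 2 = c ^+ 2 * E.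
    by rewrite /E; ring.
  have c2 : c ^+ 2 != 0 by rewrite expf_neq0 // gt_eqF.
  by rewrite -mulf_div mulfV // mul1r [ltRHS]addrAC ltrD2r -mulrA -mulrDr (ltr_pM2l c0).
(* For e = 0 the factor 9 - 5 tx vanishes, and the strict gap would put the maximum of rho below its
   minimum. *)
have e_gt0 : 0 < e.
  rewrite lt_neqAle e_ge0 andbT; apply/eqP => ez.
  have : rho p1 < rho p0.
    have z : 9 - 5 * tx e = 0 by rewrite xE; exact: (esym ez).
    by move: gp; rewrite z mulr0 mul0r addr0 xE.
  by rewrite ltNge (max1 p0).
have r_ge q : tx e <= rho q by rewrite xE.
have r_le q : rho q * (1 - tu e) <= tx e.
  apply: le_trans (pinching_gap e_ge0 e_le gp); apply: ler_wpM2r; [exact: tu_le1|exact: max1].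
have [e23 rc] := pinched_rigidity Phi1 sPhi fPhi par M0 cM conM c0 h2c W0 a2_gt0 e_gt0 e_le r_ge r_le.
rewrite SE Hq [rho p](rc p) /tx e23 /c; by field.
Qed.

End Main.

Theorem corollary1p5 (R : realType) (M : topologicalType)
    (A : smooth_atlas R M) (g : riemannian_metric A)
    (hM : closed_surface M)
    (hMimm : exists (N0 : nat) (Psi : M -> 'rV[R]_N0.+1),
       isometric_immersion g Psi /\ parallel_mean_curvature A Psi) :
  forall N : nat,
  ~ exists Phi : M -> 'rV[R]_N.+1,
      let S := curv_S A Phi in
      let H := curv_H A Phi in
      let Smax := S_max A Phi in
      let Smin := S_min A Phi in
      [/\ isometric_immersion g Phi,
          parallel_mean_curvature A Phi,
          forall p, 5 / 3 + 11 / 3 * H p ^+ 2 <= S p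
                    /\ S p <= 9 / 5 + 19 / 5 * H p ^+ 2,
          ~ (forall p, S p = 5 / 3 + 11 / 3 * H p ^+ 2)
        & forall p,
            Smax < Smin +
              (120 * (Smin - 2 * H p ^+ 2) * (3 * Smin - 4 - 10 * H p ^+ 2)
                 * (9 - 5 * Smin + 19 * H p ^+ 2))
              / (2225 * (Smin - 2 * H p ^+ 2) ^+ 2
                 - 420 * (1 + H p ^+ 2) * (Smin - 2 * H p ^+ 2)
                 - 1701 * (1 + H p ^+ 2) ^+ 2)].
Proof.
move=> N [Phi [imm par pinch + gap]]; apply=> p.
exact: (curv_S_cst (g := g)).
Qed.
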